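(* Let $X$ be a $\mathbb{Z}$ subshift. Any $\mathbb{P}$-invariant measure of maximal entropy $\mu$ on $X^{\otimes\infty}$ is of the form $\mu=\Phi(\hat\mu)$, where $\hat\mu$ is the push-forward of $\mu$ via $\phi_\mu$ and is supported on $\widehat{X^{\otimes\infty}}_{\max}$ (i.e. $\hat\mu(\widehat{X^{\otimes\infty}}_{\max})=1$).
   Context: Let $\Sigma$ be a finite alphabet and $\hat\Sigma$ the set of nonempty subsets of $\Sigma$. Let $\mathbb{Z}^\infty=\bigoplus_{\mathbb{N}}\mathbb{Z}$ (finitely supported integer sequences), with standard generators $e_i$, and $F_n=F_n^{(\infty)}=[-n,n]^n\times\{0\}^\infty\subset\mathbb{Z}^\infty$, a F\o lner sequence. For $d\in\mathbb{N}\cup\{\infty\}$, $\mathbb{Z}^d$ acts on $\Sigma^{\mathbb{Z}^d}$ by shifts $(\sigma_vx)_g=x_{g+v}$; a $\mathbb{Z}^d$ subshift is a closed shift-invariant subset. $\mathcal{L}(Y,S)=\{y_S:y\in Y\}$ for a subshift $Y$ and finite $S$. For a $\mathbb{Z}$ subshift $X$, $$X^{\otimes\infty}=\{x\in\Sigma^{\mathbb{Z}^\infty}:\forall g\in\mathbb{Z}^\infty\ \forall i\in\mathbb{N},\ x_{g+\mathbb{Z}e_i}\in X\},$$ where $x_{g+\mathbb{Z}e_i}$ is the sequence $m\mapsto x_{g+me_i}$. All measures are Borel probability measures. For a $\mathbb{Z}^\infty$ subshift $Y$, $h(Y)=\lim_n\frac1{|F_n|}\log|\mathcal{L}(Y,F_n)|$,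 and for a shift-invariant measure $\mu$, $h(\mu)=\lim_n\frac{1}{|F_n|}H_\mu(F_n)$ with $H_\mu(F_n)=-\int\log\mu([x_{F_n}])\,d\mu(x)$, where $[x_F]=\{y : y_F=x_F\}$. A measure of maximal entropy on $Y$ is a shift-invariant measure $\mu$ on $Y$ with $h(\mu)=h(Y)$. $\mathbb{P}$ is the group of permutations of $\mathbb{N}$ fixing all but finitely many integers. It acts on $\mathbb{Z}^\infty$ by $(\rho(g))_i=g_{\rho(i)}$ and hence on $\Sigma^{\mathbb{Z}^\infty}$, $\hat\Sigma^{\mathbb{Z}^\infty}$ and $X^{\otimes\infty}$ by permuting coordinates of the index; a measure is $\mathbb{P}$-invariant if invariant under this action. For a shift-invariant measure $\mu$ on $X^{\otimes\infty}$ define, for $\mu$-a.e. $x$, $g\in\mathbb{Z}^\infty$, $a\in\Sigma$, the conditional probability $p_{x,g}(a)=\mu(\{z:z_g=a\}\mid z_{\{g\}^c}=x_{\{g\}^c})$, and $(\phi_\mu(x))_g=\{a\in\Sigma:p_{x,g}(a)>0\}$, which is $\mu$-a.s. a nonempty set for all $g$; so $\phi_\mu:X^{\otimes\infty}\to\hat\Sigma^{\mathbb{Z}^\infty}$ is a ($\mu$-a.e. defined) measurable shift-commuting map. For a $\mathbb{Z}^d$ subshift $Y\subset\Sigma^{\mathbb{Z}^d}$, $d\in\mathbb{N}\cup\{\infty\}$, the multi-choice shift is $\widehat Y=\{\hat x\in\hat\Sigma^{\mathbb{Z}^d}:\prod_{g}\hat x_g\subset Y\}$. The independence score of $\hat w\in\hat\Sigma^F$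 ($F$ finite) is $S(\hat w)=\frac1{|F|}\sum_{g\in F}\log|\hat w_g|$, and for $\hat x\in\hat\Sigma^{\mathbb{Z}^d}$, $S(\hat x)=\limsup_nS(\hat x_{F_n})$. For a $\mathbb{Z}$ subshift $X$, $h_{\mathrm{ind}}(X)=\lim_n\sup\{S(\hat w):\hat w\in\mathcal{L}(\widehat X,[-n,n])\}$. Set $\widehat{X^{\otimes\infty}}_{\max}=\{\hat x\in\widehat{X^{\otimes\infty}}:S(\hat x)=h_{\mathrm{ind}}(X)\}$. For a shift-invariant measure $\nu$ supported on $\widehat{X^{\otimes\infty}}_{\max}$, $\Phi(\nu)=\int_{\widehat{X^{\otimes\infty}}}\mu_{\hat x}\,d\nu(\hat x)$, where $\mu_{\hat x}$ is the independent product over $g\in\mathbb{Z}^\infty$ of the uniform measures on $\hat x_g$. *)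

(* Defs.v *)
From HB Require Import structures.
From mathcomp Require Import all_boot all_order all_algebra finmap.
From mathcomp Require Import zify.
From mathcomp Require Import all_classical all_reals all_analysis.
Set Implicit Arguments.
Unset Strict Implicit.
Unset Printing Implicit Defensive.
Import Order.TTheory GRing.Theory Num.Theory.
Import numFieldNormedType.Exports.
Local Open Scope classical_set_scope.
Local Open Scope ring_scope.

(* The library's measurable types are inhabited, hence so are alphabets. *)
#[short(type="alphabetType")]
HB.structure Definition Alphabet := { A of Finite A & isPointed A }.

(* The alphabet of nonempty subsets of A. *)
Definition hat (A : finType) : Type := {s : {set A} | s != finset.set0}.
HB.instance Definition _ (A : finType) := SubType.copy (hat A) {s : {set A} | s != finset.set0}.
HB.instance Definition _ (A : finType) := Finite.copy (hat A) {s : {set A} | s != finset.set0}.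

Lemma set1_neq0 (A : finType) (a : A) : [set a]%SET != finset.set0.
Proof. by apply/set0Pn; exists a; rewrite finset.in_set1. Qed.

Definition hat1 (A : finType) (a : A) : hat A := exist _ [set a]%SET (set1_neq0 a).

HB.instance Definition _ (A : alphabetType) := isPointed.Build (hat A) (hat1 point).

Definition finsupp_seq : {pred nat -> int} :=
  [pred g | `[< exists N : nat, forall i, (N <= i)%N -> g i = 0 >]].

Lemma finsupp_seq_zmod : zmod_closed finsupp_seq.
Proof.
split; first by apply/asboolP; exists 0%N.
move=> f g /asboolP[M hM] /asboolP[N hN]; apply/asboolP; exists (maxn M N) => i.
by rewrite geq_max => /andP[/hM fi /hN gi]; rewrite /= /GRing.add /= /GRing.opp /= fi gi.
Qed.

HB.instance Definition _ := GRing.isZmodClosed.Build _ finsupp_seq finsupp_seq_zmod.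

Record Zinf := MkZinf { coord :> nat -> int; _ : coord \in finsupp_seq }.
HB.instance Definition _ := [isSub for coord].
HB.instance Definition _ := [Choice of Zinf by <:].
HB.instance Definition _ := [SubChoice_isSubZmodule of Zinf by <:].

Lemma finsupp_delta (i : nat) : (fun j : nat => (j == i)%:R : int) \in finsupp_seq.
Proof.
by apply/asboolP; exists i.+1 => j; case: eqP => // ->; rewrite ltnn.
Qed.

Definition gen (i : nat) : Zinf := MkZinf (finsupp_delta i).

(* The product space A^I with its Borel sigma-algebra. *)
Definition borel (I : Type) (A : pointedType) : measurableType _ :=
  g_sigma_algebraType (@open {ptws I -> discrete_topology A}).

Lemma measurable_open (I : Type) (A : pointedType) (U : set (I -> A)) :
  open (U : set {ptws I -> discrete_topology A}) ->
  measurable (U : set (borel I A)).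
Proof. by move=> oU; apply: sub_sigma_algebra. Qed.

Lemma prod_continuous (J : Type) (T : topologicalType) (K : J -> topologicalType)
    (f : forall j, T -> K j) :
  (forall j, continuous (f j)) ->
  continuous ((fun x j => f j x) : T -> prod_topology K).
Proof.
move=> cf x; apply/cvg_sup.
move=> j; move: x.
apply/(@continuousP _ (initial_topology (fun g : prod_topology K => g j))) => _ [B oB <-].
rewrite -comp_preimage.
by apply: open_comp => // x _; exact: cf.
Qed.

Lemma coord_continuous (I : eqType) (A : pointedType) (i : I) :
  continuous ((fun x => x i) :
    {ptws I -> discrete_topology A} -> discrete_topology A).
Proof.
have := @proj_continuous I (fun=> (discrete_topology A : topologicalType)) i.
exact.
Qed.

Lemma reindex_continuous (I J : eqType) (A : pointedType) (f : J -> I) :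
  continuous ((fun x j => x (f j)) :
    {ptws I -> discrete_topology A} -> {ptws J -> discrete_topology A}).
Proof.
apply: (@prod_continuous J {ptws I -> discrete_topology A}
  (fun=> (discrete_topology A : topologicalType)) (fun j x => x (f j))) => j.
exact: coord_continuous.
Qed.

Lemma measurable_coord (I : eqType) (A : pointedType) (i : I) (a : A) :
  measurable ([set x | x i = a] : set (borel I A)).
Proof.
apply: measurable_open.
have /continuousP/(_ [set a] (discrete_open _)) := @coord_continuous I A i.
exact.
Qed.

Lemma measurable_reindex (I J : eqType) (A : pointedType) (f : J -> I) :
  measurable_fun setT ((fun x j => x (f j)) : borel I A -> borel J A).
Proof.
apply: (@measurability _ _ (borel I A) (borel J A) setT _
  (@open {ptws J -> discrete_topology A})) => //.
move=> _ [U oU <-]; rewrite setTI; apply: measurable_open.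
by have /continuousP/(_ _ oU) := @reindex_continuous I J A f.
Qed.

Section Subshifts.
Variable G : zmodType.

Definition shift (A : Type) (v : G) (x : G -> A) : G -> A := fun g => x (g + v).

Definition subshift (A : pointedType) (Y : set (G -> A)) : Prop :=
  closed (Y : set {ptws G -> discrete_topology A}) /\
  forall v x, Y x -> Y (shift v x).

Definition restr (A : Type) (S : {fset G}) (x : G -> A) : {ffun S -> A} :=
  [ffun g : S => x (val g)].

Definition language (A : Type) (Y : set (G -> A)) (S : {fset G}) :
  set {ffun S -> A} := restr S @` Y.

Definition multichoice (A : finType) (Y : set (G -> A)) : set (G -> hat A) :=
  [set xh : G -> hat A | forall x : G -> A, (forall g, x g \in val (xh g)) -> Y x].

(* S is the carrier F of the pattern w; logarithms are natural. *)
Definition score (R : realType) (A : finType) (S : {fset G})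
    (w : {ffun S -> hat A}) : R :=
  #|` S|%:R^-1 * \sum_(g : S) ln #|val (w g)|%:R.

End Subshifts.
Arguments language {G A} Y S.

(* [fset_set] of an infinite set is empty, whence the finiteness lemmas. *)
Definition window_set (n : nat) : set int := [set m : int | - n%:Z <= m <= n%:Z].

Lemma finite_window_set n : finite_set (window_set n).
Proof.
pose f (k : nat) : int := k%:Z - n%:Z.
apply: (@sub_finite_set _ _ (f @` `I_(n.*2.+1))); last first.
  exact/finite_image/finite_II.
move=> m; rewrite /window_set /= => /andP[nm mn].
by exists (absz (m + n%:Z)); rewrite /f /= -?addnn; lia.
Qed.

Definition window (n : nat) : {fset int} := fset_set (window_set n).

(* The box [-n, n]^n x {0}^infinity, coordinates being numbered from 0. *)
Definition folner_set (n : nat) : set Zinf :=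
  [set g : Zinf | (forall i, (i < n)%N -> - n%:Z <= g i <= n%:Z) /\
                  (forall i, (n <= i)%N -> g i = 0)].

Lemma finite_folner_set n : finite_set (folner_set n).
Proof.
pose f (g : Zinf) : {ffun 'I_n -> 'I_(n.*2.+1)} :=
  [ffun i : 'I_n => inord (absz (g i + n%:Z))].
suff finj : {in folner_set n &, injective f}.
  by rewrite -(eq_finite_set (inj_card_eq finj)); exact: finite_finset.
move=> g h; rewrite !inE => -[g1 g2] [h1 h2] fgh.
apply: val_inj; apply/funext => i /=.
case: (ltnP i n) => [lin|ni]; last by rewrite g2 ?h2.
have /andP[g3 g4] := g1 i lin; have /andP[h3 h4] := h1 i lin.
have := congr1 (fun u : {ffun 'I_n -> 'I_(n.*2.+1)} => val (u (Ordinal lin))) fgh.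
by rewrite !ffunE /= !inordK -?addnn; lia.
Qed.

Definition folner (n : nat) : {fset Zinf} := fset_set (folner_set n).

(* X^(tensor infinity). *)
Definition axial_power (A : Type) (X : set (int -> A)) : set (Zinf -> A) :=
  [set x : Zinf -> A | forall g i, X (fun m => x (g + gen i *~ m))].

Section Entropy.
Variables (R : realType) (A : alphabetType).

Definition top_entropy (Y : set (Zinf -> A)) : R :=
  limn (fun n => #|` folner n|%:R^-1 *
                 ln #|` fset_set (language Y (folner n))|%:R : R).

Definition cylinder (I : Type) (B : Type) (S : set I) (x : I -> B) :
  set (I -> B) := [set y : I -> B | forall g, S g -> y g = x g].

Variable mu : probability (borel Zinf A) R.

Definition block_entropy (S : {fset Zinf}) : R :=
  - \int[mu]_x ln (fine (mu (cylinder [set` S] x))).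

Definition measure_entropy : R :=
  limn (fun n => #|` folner n|%:R^-1 * block_entropy (folner n)).

Definition shift_invariant : Prop :=
  forall (v : Zinf) (E : set (borel Zinf A)),
    measurable E -> mu (shift v @^-1` E) = mu E.

Definition max_entropy_measure (Y : set (Zinf -> A)) : Prop :=
  [/\ mu Y = 1%E, shift_invariant & measure_entropy = top_entropy Y].

End Entropy.

Section Independence.
Variables (R : realType) (A : finType).

Definition h_ind (X : set (int -> A)) : R :=
  limn (fun n => sup ((@score _ R A (window n)) @`
                      language (multichoice X) (window n))).

Definition limsup_score (xh : Zinf -> hat A) : R :=
  limn_sup (fun n => score R (restr (folner n) xh)).

(* Elements of the multi-choice shift of X^(tensor infinity) of maximal score. *)
Definition multichoice_max (X : set (int -> A)) : set (Zinf -> hat A) :=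
  [set xh : Zinf -> hat A | multichoice (axial_power X) xh /\ limsup_score xh = h_ind X].

End Independence.

Record finperm := FinPerm {
  finperm_fun :> nat -> nat;
  finperm_bij : bijective finperm_fun;
  finperm_fin : exists N, forall i, (N <= i)%N -> finperm_fun i = i }.

Lemma finsupp_perm (rho : finperm) (g : Zinf) :
  (fun i => g (rho i)) \in finsupp_seq.
Proof.
have [M hM] := finperm_fin rho; case: g => g /= /asboolP[N hN].
apply/asboolP; exists (maxn M N) => i.
by rewrite geq_max => /andP[/hM -> /hN].
Qed.

Definition permute (rho : finperm) (g : Zinf) : Zinf :=
  MkZinf (finsupp_perm rho g).

Definition perm_invariant (R : realType) (A : alphabetType)
    (mu : probability (borel Zinf A) R) : Prop :=
  forall (rho : finperm) (E : set (borel Zinf A)),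
    measurable E -> mu ((fun (x : Zinf -> A) g => x (permute rho g)) @^-1` E) = mu E.

Section Conditional.
Variables (R : realType) (A : alphabetType) (mu : probability (borel Zinf A) R).
Variable g : Zinf.

(* Restriction to the complement of the site g. *)
Definition off (x : borel Zinf A) : borel {h : Zinf | h != g} A :=
  fun h => x (val h).

Lemma measurable_off : measurable_fun setT off.
Proof. exact: (@measurable_reindex _ _ A (@proj1_sig _ _)). Qed.

HB.instance Definition _ := isMeasurableFun.Build _ _ _ _ off measurable_off.

Variable a : A.

(* The finite measure mu({z : z_g = a} /\ {z : z restricted to g^c in E}); its
   density with respect to the law of z restricted to g^c, evaluated at x
   restricted to g^c, is a version of the conditional probability p_{x,g}(a). *)
Definition site_law (E : set (borel {h : Zinf | h != g} A)) : \bar R :=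
  mu (off @^-1` E `&` [set x | x g = a]).

Lemma measurable_off_site E : measurable E ->
  measurable (off @^-1` E `&` [set x | x g = a]).
Proof.
move=> mE; apply: measurableI; last exact: (@measurable_coord Zinf A g a).
by rewrite -[X in measurable X]setTI; exact: measurable_off.
Qed.

Lemma site_law0 : site_law set0 = 0%E.
Proof. by rewrite /site_law preimage_set0 set0I measure0. Qed.

Lemma site_law_ge0 E : (0 <= site_law E)%E.
Proof. exact: measure_ge0. Qed.

Lemma site_law_sigma_additive : semi_sigma_additive site_law.
Proof.
move=> F mF tF mUF; rewrite /site_law preimage_bigcup setI_bigcupl.
apply: measure_semi_sigma_additive.
- by move=> n; exact: measurable_off_site.
- apply/trivIsetP => /= i j _ _ ij; rewrite setIACA -preimage_setI.
  by move/trivIsetP : tF => /(_ _ _ _ _ ij) ->//; rewrite preimage_set0 set0I.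
- by apply: bigcup_measurable => n _; exact: measurable_off_site.
Qed.

HB.instance Definition _ := isMeasure.Build _ _ _
  site_law site_law0 site_law_ge0 site_law_sigma_additive.

Lemma site_law_fin : fin_num_fun site_law.
Proof. by move=> E mE; apply: fin_num_measure; exact: measurable_off_site. Qed.

HB.instance Definition _ := Measure_isFinite.Build _ _ _ site_law site_law_fin.

Definition cond_prob (x : borel Zinf A) : \bar R :=
  Radon_Nikodym (charge_of_finite_measure site_law) (distribution mu off) (off x).

End Conditional.

(* The default value of [insubd] is taken only where every p_{x,g}(a) vanishes or
   is negative, which is a mu-null set. *)
Definition phi (R : realType) (A : alphabetType)
    (mu : probability (borel Zinf A) R) (x : borel Zinf A) : borel Zinf (hat A) :=
  fun g => insubd (hat1 (x g)) [set a | (0 < cond_prob mu g a x)%E]%SET.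

Section Product.
Variables (R : realType) (A : alphabetType).

Definition is_uniform_product (xh : Zinf -> hat A)
    (m : probability (borel Zinf A) R) : Prop :=
  forall (S : {fset Zinf}) (B : Zinf -> {set A}),
    m [set x : Zinf -> A | forall g, g \in S -> x g \in B g] =
    (\prod_(g <- S) (#|B g :&: val (xh g)|%SET%:R / #|val (xh g)|%:R))%:E.

(* Such an m exists and is unique (Kolmogorov extension), so the Dirac default is
   never reached. *)
Definition uniform_product (xh : Zinf -> hat A) : probability (borel Zinf A) R :=
  if pselect (exists m, is_uniform_product xh m) is left ex
  then sval (cid ex) else dirac point.

(* Meant for the Borel probability measures nu supported on [multichoice_max]. *)
Definition Phi (nu : set (borel Zinf (hat A)) -> \bar R) :
    set (borel Zinf A) -> \bar R :=
  fun E => (\int[nu]_xh uniform_product xh E)%E.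
End Product.

(* Main.v *)
(* Let h be the entropy of mu. Permutation invariance lets any finite context S of a site
   be moved to fresh coordinates, so that H(x_g | x_S) >= h for every finite S not
   containing g, whereas for the lexicographic past H(x_g | x_S) comes arbitrarily close
   to h. By a quantitative form of strict concavity, conditioning on the past therefore
   already approximates the conditional law p_{x,g} given all other sites, and peeling off
   the sites of a finite pattern w in decreasing order gives
   mu[w] = int prod_g p_{x,g}(w_g) dmu(x). Consequently phi_mu(x) is a multi-choice
   configuration almost surely, and
   h <= int H(p_{x,0}) <= int log |phi_mu(x)_0| <= h_ind(X) <= h.
   Equality makes p_{x,g} uniform on phi_mu(x)_g, so that the cylinder formula becomes
   mu = Phi(mu_hat), and it makes the scores of phi_mu(x), which are bounded by scores
   tending to h_ind(X), converge to h_ind(X) in mean. *)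
Require Import Defs.
From HB Require Import structures.
From mathcomp Require Import all_boot all_order all_algebra finmap.
From mathcomp Require Import zify ring lra.
From mathcomp Require Import all_classical all_reals all_analysis measurable_realfun.
Set Implicit Arguments.
Unset Strict Implicit.
Unset Printing Implicit Defensive.
Import Order.TTheory GRing.Theory Num.Theory.
Import numFieldNormedType.Exports.
Local Open Scope classical_set_scope.
Local Open Scope ring_scope.
(* Imported again because MathComp shadows [coord] and [shift]. *)
Require Import Defs.

(** * Finitely determined sets *)

(** The conditional probability [p_{x,g}] is a Radon-Nikodym derivative, fixed only up to null sets
    and separately for each letter and site; no martingale convergence along finite contexts is
    invoked. An entropy budget replaces it. If H(x_g | x_S) <= h + t^2, then no finite enlargement T
    of S avoiding g lowers this entropy by more than t^2, because h bounds every such increment from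
    below. The drop dominates a quarter of the mean squared change of the conditional law, so the
    laws given S and given T differ by O(t) in mean, uniformly in T. Testing against finitely
    determined events off g then compares the law given S with [p_{x,g}] itself. Total mass 1, shift
    equivariance, the entropy bound and the product formula all pass from finite contexts to
    [p_{x,g}] in this way. Decoupling requires the good context to lie in a past, hence the need for
    both a lower bound over all contexts and an upper bound over past ones. The inequality h_ind(X)
    <= h comes from counting: a multi-choice configuration of X read along the sum of the
    coordinates is one of the axial power, and its choices are distinct patterns of the language. *)

Definition det_by (J : eqType) (A : Type) (S : seq J) (C : set (J -> A)) : Prop :=
  forall x y : J -> A, {in S, x =1 y} -> C x -> C y.

Definition fin_det (J : eqType) (A : Type) (C : set (J -> A)) : Prop :=
  exists S : seq J, det_by S C.

(** Reduces quantification over all finite sets of sites to one sequence, so that almost sure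
    statements about finite patterns become countable intersections. [S n] consists of the sites
    numbered below [n] by an injection into [nat]. *)
Lemma cofinal_family (J : choiceType) : countable [set: J] ->
  exists S : nat -> {fset J}, forall T : seq J, exists n, {subset T <= S n}.
Proof.
move=> /countable_injP[e einj].
have fin n : finite_set [set j | (e j < n)%N].
  apply: (@sub_finite_set _ _ (e @^-1` `I_n)) => //.
  by apply: finite_preimage; [move=> ? ? _ _; apply: einj; rewrite inE|exact: finite_II].
exists (fun n => fset_set [set j | (e j < n)%N]) => T; exists (\max_(j <- T) (e j)).+1 => j jT.
rewrite in_fset_set// inE /= ltnS.
by rewrite (big_rem j) //= leq_maxl.
Qed.

Section ProductTopology.
Variables (J : choiceType) (A : pointedType).
Implicit Types (U C : set (J -> A)) (x y : J -> A).

Lemma open_fin_det U x : open (U : set {ptws J -> discrete_topology A}) -> U x ->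
  exists S : seq J, forall y, {in S, x =1 y} -> U y.
Proof.
move=> oU Ux.
(* Agreement with [x] on finite lists generates a filter that converges to [x] in each coordinate,
   hence in the product topology; so it contains every open set around [x]. *)
pose B (S : seq J) : set {ptws J -> discrete_topology A} := [set y | {in S, x =1 y}].
pose F := filter_from [set: seq J] B.
have FF : Filter F.
  apply: filter_from_filter; first by exists [::].
  move=> S T _ _; exists (S ++ T) => // y Sy; split=> j jS; apply: Sy;
    by rewrite mem_cat jS ?orbT.
have : F --> (x : {ptws J -> discrete_topology A}).
  apply/cvg_sup => j D /=.
  rewrite (@nbhsE (initial_topology (fun f : {ptws J -> discrete_topology A} => f j))).
  move=> [_ [[V oV <-] Vx] VD]; exists [:: j] => // y xy; apply: VD => /=.
  by rewrite -xy ?mem_head.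
have Ux' : nbhs (x : {ptws J -> discrete_topology A}) U by exact: open_nbhs_nbhs.
by move=> /(_ U Ux')[S _ SU]; exists S.
Qed.

Lemma open_agree (S : seq J) x :
  open ([set y | {in S, x =1 y}] : set {ptws J -> discrete_topology A}).
Proof.
elim: S => [|j S IH].
  by rewrite (_ : mkset _ = setT); [exact: openT|apply/seteqP; split].
rewrite (_ : mkset _ = (fun y => y j) @^-1` [set x j] `&` [set y | {in S, x =1 y}]).
  apply: openI => //.
  have /continuousP/(_ [set x j] (discrete_open _)) := @coord_continuous J A j.
  exact.
apply/seteqP; split=> y /=.
  by move=> xy; split=> [|i iS]; [rewrite xy ?mem_head|apply: xy; rewrite inE iS orbT].
by move=> [xj xS] i; rewrite inE => /predU1P[->//|/xS].
Qed.

Lemma fin_det_open U :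
  (forall x, U x -> exists S : seq J, forall y, {in S, x =1 y} -> U y) ->
  open (U : set {ptws J -> discrete_topology A}).
Proof.
move=> HU.
rewrite (_ : U = \bigcup_(V in [set V : set {ptws J -> discrete_topology A} |
                                open V /\ V `<=` U]) V).
  by apply: bigcup_open => V [].
apply/seteqP; split=> [x Ux|x [V [_]]]; last exact.
have [S SU] := HU x Ux.
by exists [set y | {in S, x =1 y}] => //; split; [exact: open_agree|move=> y /SU].
Qed.

Lemma closedP U : closed (U : set {ptws J -> discrete_topology A}) <->
  (forall x, (forall S : seq J, exists2 y, U y & {in S, x =1 y}) -> U x).
Proof.
split=> [cU x xU|HU].
  apply: contrapT => nUx; have oU : open (~` U : set {ptws J -> discrete_topology A}).
    exact: closed_openC.
  have [S SU] := open_fin_det oU nUx; have [y Uy xy] := xU S.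
  exact: SU Uy.
rewrite -[U]setCK; apply: open_closedC; apply: fin_det_open => x nUx.
apply: contrapT => /forallNP nS; apply: nUx; apply: HU => S.
have /existsNP[y /not_implyP[xy /contrapT Uy]] := nS S; by exists y.
Qed.

Lemma fin_det_measurable C : fin_det C -> measurable (C : set (borel J A)).
Proof.
move=> [S SC]; apply: measurable_open; apply: fin_det_open => x Cx.
by exists S => y xy; exact: SC Cx.
Qed.

Lemma closed_measurable C : closed (C : set {ptws J -> discrete_topology A}) ->
  measurable (C : set (borel J A)).
Proof.
by move=> cC; rewrite -[C]setCK; apply: measurableC; apply: measurable_open; exact: closed_openC.
Qed.

Lemma fin_detC C : fin_det C -> fin_det (~` C).
Proof. by move=> [S SC]; exists S => x y xy nC /(SC _ _ (fun j jS => esym (xy j jS))). Qed.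

Lemma fin_detI C D : fin_det C -> fin_det D -> fin_det (C `&` D).
Proof.
move=> [S SC] [T TD]; exists (S ++ T) => x y xy [/SC Cy /TD Dy]; split.
  by apply: Cy => j jS; apply: xy; rewrite mem_cat jS.
by apply: Dy => j jS; apply: xy; rewrite mem_cat jS orbT.
Qed.

Lemma fin_detU C D : fin_det C -> fin_det D -> fin_det (C `|` D).
Proof.
by move=> cC cD; rewrite -[_ `|` _]setCK setCU; apply: fin_detC; apply: fin_detI; exact: fin_detC.
Qed.

Lemma fin_det0 : fin_det (set0 : set (J -> A)).
Proof. by exists [::]. Qed.

Hypothesis cJ : countable [set: J].

(* The opens are countable unions of finitely determined sets because the finite
   subsets of a countable index set have a countable cofinal family. *)
Lemma open_bigcup_fin_det U : open (U : set {ptws J -> discrete_topology A}) ->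
  exists2 F : (set (J -> A))^nat, (forall n, fin_det (F n)) & U = \bigcup_n F n.
Proof.
move=> oU; have [S cofS] := cofinal_family cJ.
exists (fun n => [set x : J -> A | forall y : J -> A, {in S n, x =1 y} -> U y]) => [n|].
  by exists (S n) => x y xy Ux z yz; apply: Ux => j jS; rewrite xy ?yz.
apply/seteqP; split=> [x Ux|x [n _]]; last exact.
have [T TU] := open_fin_det oU Ux; have [n Tn] := cofS T.
by exists n => // y xy; apply: TU => j /Tn; exact: xy.
Qed.

Lemma borel_fin_det : @measurable _ (borel J A) = <<s [set C | fin_det C] >>.
Proof.
apply/seteqP; split; last first.
  apply: smallest_sub; first exact: smallest_sigma_algebra.
  by move=> C /fin_det_measurable.
apply: smallest_sub; first exact: smallest_sigma_algebra.
move=> U oU; have [F dF ->] := open_bigcup_fin_det oU.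
have [_ _] := @smallest_sigma_algebra _ [set: J -> A] [set C | fin_det C].
by apply=> n; apply: sub_sigma_algebra; exact: dF.
Qed.

(** Dynkin's lemma: the finitely determined sets are stable under intersection and generate the
    Borel sets. *)
Lemma borel_dynkin_ind (P : set_system (J -> A)) :
  (forall C, fin_det C -> P C) ->
  (forall C, measurable (C : set (borel J A)) -> P C -> P (~` C)) ->
  (forall F : (set (J -> A))^nat, (forall n, measurable (F n : set (borel J A))) ->
     trivIset [set: nat] F -> (forall n, P (F n)) -> P (\bigcup_n F n)) ->
  forall C, measurable (C : set (borel J A)) -> P C.
Proof.
move=> Pd PC PU C mC.
apply: (@dynkin_induction _ (borel J A) [set C | fin_det C]) => //.
- exact: borel_fin_det.
- by move=> B D; exact: fin_detI.
- by apply: Pd; exists [::].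
- by move: mC; rewrite borel_fin_det.
Qed.

End ProductTopology.

Lemma measurable_finite_valued d (T : measurableType d) (W : finType) (g : T -> W)
    (Q : set W) :
  (forall w, measurable [set t | g t = w]) -> measurable [set t | Q (g t)].
Proof.
move=> mg; rewrite (_ : mkset _ = \bigcup_(w in Q) [set t | g t = w]).
  by apply: fin_bigcup_measurable => //; exact: finite_finset.
by apply/seteqP; split=> [t Qt|t [w Qw /= ->]]; first exists (g t).
Qed.

Lemma measurable_to_borel (J : choiceType) (A : alphabetType) d (T : measurableType d)
    (f : T -> borel J A) :
  countable [set: J] -> (forall j a, measurable [set t | f t j = a]) ->
  measurable_fun setT f.
Proof.
move=> cJ mf.
have mag S (w : (size S).-tuple A) : measurable [set t | map_tuple (f t) (in_tuple S) = w].
  rewrite (_ : mkset _ = \bigcap_(i in [set: 'I_(size S)])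
      [set t | f t (tnth (in_tuple S) i) = tnth w i]).
    by apply: fin_bigcap_measurable => //; exact: finite_finset.
  apply/seteqP; split=> [t /= <- i _ /=|t ft]; first by rewrite tnth_map.
  by apply: eq_from_tnth => i; rewrite tnth_map; exact: ft.
apply: (@measurability _ _ T (borel J A) setT f (@open {ptws J -> discrete_topology A})) => //.
move=> _ [U oU <-]; rewrite setTI.
have [F dF ->] := open_bigcup_fin_det cJ oU.
rewrite preimage_bigcup; apply: bigcup_measurable => n _.
have [S SF] := dF n.
pose Q : set ((size S).-tuple A) :=
  [set w | exists2 u, F n u & map_tuple u (in_tuple S) = w].
rewrite (_ : _ @^-1` _ = [set t | Q (map_tuple (f t) (in_tuple S))]).
  by apply: measurable_finite_valued => w; exact: mag.
apply/seteqP; split=> [t Ft|t [u Fu uf]]; first by exists (f t).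
apply: SF Fu => j jS; have /= := congr1 val uf.
by move/eq_in_map; apply.
Qed.

(** * Finite boxes of sites *)

Lemma fset_ind (T : choiceType) (P : {fset T} -> Prop) :
  P fset0 -> (forall a S, a \notin S -> P S -> P (a |` S)%fset) -> forall S, P S.
Proof.
move=> P0 PU S; elim: {S}#|` S| {-2}S (leqnn #|` S|) => [|n IH] S.
  by rewrite leqn0 cardfs_eq0 => /eqP ->.
have [->//|[a aS]] := fset_0Vmem S.
rewrite -(fsetD1K aS) cardfsU1 !inE eqxx /= add1n ltnS => Sn.
by apply: PU; [rewrite !inE eqxx|exact: IH].
Qed.

Section Zinf_lattice.
Implicit Types (g h v : Zinf).

Lemma Zinf_ext g h : (forall i, g i = h i) -> g = h.
Proof. by move=> gh; apply: val_inj; apply/funext. Qed.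

Lemma coordD g h i : (g + h) i = g i + h i.
Proof. by rewrite [coord _](raddfD (val : Zinf -> nat -> int)). Qed.

Lemma coordN g i : (- g) i = - g i.
Proof. by rewrite [coord _](raddfN (val : Zinf -> nat -> int)). Qed.

Lemma coord0 i : (0 : Zinf) i = 0.
Proof. by rewrite [coord _](raddf0 (val : Zinf -> nat -> int)). Qed.

Lemma coordMz g (m : int) i : (g *~ m) i = g i * m.
Proof.
have cMn n : (g *+ n) i = g i * n%:Z.
  by elim: n => [|n IH]; rewrite ?mulr0n ?coord0 ?mulr0// mulrS coordD IH intS mulrDr mulr1.
by case: m => n; rewrite ?NegzE ?mulrNz ?coordN cMn // mulrN.
Qed.

Lemma coord_gen i j m : (gen i *~ m) j = if j == i then m else 0.
Proof. by rewrite coordMz /=; case: eqP => _; rewrite ?mul1r ?mul0r. Qed.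

Lemma finsupp_bound g : exists N : nat, forall i, (N <= i)%N -> g i = 0.
Proof. by case: g => g /= /asboolP. Qed.

Lemma countable_Zinf : countable [set: Zinf].
Proof.
(* The list of values below any bound of the support determines [g], whichever bound was chosen,
   since [nth] defaults to 0 past the end. *)
pose N g := sval (cid (finsupp_bound g)).
pose f g : seq int := mkseq g (N g).
apply/countable_injP.
exists (choice.pickle \o f) => g h _ _ /(pcan_inj choice.pickleK) fgh.
apply: Zinf_ext => i.
have nf (k : Zinf) : k i = nth 0 (f k) i.
  have [iN|Ni] := ltnP i (N k); first by rewrite nth_mkseq.
  rewrite nth_default ?size_mkseq//; exact: (svalP (cid (finsupp_bound k))).
by rewrite (nf g) (nf h) fgh.
Qed.

End Zinf_lattice.

Section Boxes.
Implicit Types (g h v : Zinf) (W V : nat -> {fset int}).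

(** The sides may depend on the direction, which serves both for positions of tiles and for boxes
    confined to fresh directions. *)
Fixpoint pbox W (d : nat) : {fset Zinf} :=
  if d is d'.+1 then [fset (g + gen d' *~ m)%R | g in pbox W d', m in W d']%fset
  else [fset 0%R]%fset.

Lemma mem_pbox W d g :
  reflect ((forall i, (i < d)%N -> g i \in W i) /\ (forall i, (d <= i)%N -> g i = 0))
          (g \in pbox W d).
Proof.
elim: d g => [|d IH] g /=.
  rewrite inE; apply: (iffP eqP) => [->|[_ g0]]; first by split=> // i _; rewrite coord0.
  by apply: Zinf_ext => i; rewrite g0 ?coord0.
apply: (iffP (imfset2P _ _ _ _ _)) => [[h /= /IH[h1 h2]] [m /= mW ->]|[g1 g2]].
  split=> i; rewrite coordD coord_gen; last first.
    by move=> di; rewrite (gtn_eqF di) addr0 h2// ltnW.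
  rewrite ltnS leq_eqVlt => /predU1P[->|id]; first by rewrite eqxx h2// add0r.
  by rewrite (ltn_eqF id) addr0 h1.
exists (g - gen d *~ g d).
  apply/IH; split=> i id; rewrite coordD coordN coord_gen.
    by rewrite (ltn_eqF id) subr0 g1// ltnW.
  by case: eqP => [->|/eqP ni]; rewrite ?subrr// subr0 g2// ltn_neqAle eq_sym ni.
by exists (g d); [exact: g1|rewrite subrK].
Qed.

Lemma big_pboxS (R : Type) (idx : R) (op : Monoid.com_law idx) W d (F : Zinf -> R) :
  \big[op/idx]_(g <- pbox W d.+1) F g =
  \big[op/idx]_(h <- pbox W d) \big[op/idx]_(m <- W d) F (h + gen d *~ m).
Proof.
rewrite [LHS]big_imfset2//= => -[g m] [h n] /=; rewrite !inE /=.
move=> /andP[/mem_pbox[_ gd] _] /andP[/mem_pbox[_ hd] _] ghmn.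
have mn : m = n.
  have := congr1 (fun k : Zinf => k d) ghmn.
  by rewrite !coordD !coord_gen eqxx gd// hd// !add0r.
by move: ghmn; rewrite mn => /addIr ->.
Qed.

Lemma sum_pboxS (U : nmodType) W d (F : Zinf -> U) :
  \sum_(g <- pbox W d.+1) F g = \sum_(h <- pbox W d) \sum_(m <- W d) F (h + gen d *~ m).
Proof. exact: big_pboxS. Qed.

Lemma card_pbox W d : #|` pbox W d| = (\prod_(i < d) #|` W i|)%N.
Proof.
elim: d => [|d IH]; first by rewrite big_ord0 cardfs1.
rewrite big_ord_recr /= -IH -[LHS]sum1_size (@big_pboxS _ _ addn).
under eq_bigr do rewrite sum1_size.
by rewrite big_const_seq count_predT iter_addn_0 mulnC.
Qed.

Lemma mem_window n (m : int) : (m \in window n) = (- n%:Z <= m <= n%:Z).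
Proof.
by rewrite in_fset_set; [apply/idP/idP; rewrite inE|exact: finite_window_set].
Qed.

Lemma card_window n : #|` window n| = n.*2.+1.
Proof.
rewrite -[RHS](size_iota 0) -(size_map (fun i : nat => i%:Z - n%:Z)).
apply/perm_size/uniq_perm; first exact: fset_uniq.
  by rewrite map_inj_uniq ?iota_uniq// => i j; lia.
move=> m; rewrite mem_window; apply/idP/mapP => [/andP[nm mn]|[i]].
  by exists (absz (m + n%:Z)); rewrite ?mem_iota -?addnn; lia.
by rewrite mem_iota -addnn => im ->; lia.
Qed.

Definition box p d := pbox (fun=> window p) d.

Lemma card_box p d : #|` box p d| = (p.*2.+1 ^ d)%N.
Proof. by rewrite card_pbox; under eq_bigr do rewrite card_window; rewrite prod_nat_const card_ord. Qed.

Lemma folnerE n : folner n = box n n.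
Proof.
apply/fsetP => g; rewrite in_fset_set; last exact: finite_folner_set.
apply/idP/mem_pbox; rewrite inE => -[g1 g2]; split=> // i ni; last by rewrite -mem_window g1.
by rewrite mem_window g1.
Qed.

Lemma subset_box (S : {fset Zinf}) : exists p d, (S `<=` box p d)%fset.
Proof.
elim/fset_ind: S => [|g S _ [p [d Spd]]]; first by exists 0%N, 0%N; exact: fsub0set.
have [N gN] := finsupp_bound g.
exists (maxn p (\max_(i < N) absz (g i))), (maxn d N).
apply/fsubsetP => h; rewrite in_fset1U => /predU1P[->|/(fsubsetP Spd)/mem_pbox[h1 h2]].
  apply/mem_pbox; split=> i; last by rewrite geq_max => /andP[_]; exact: gN.
  move=> _; have [Ni|iN] := leqP N i; first by rewrite gN// mem_window; lia.
  have /= := leq_bigmax (F := fun i : 'I_N => absz (g i)) (Ordinal iN).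
  by rewrite mem_window; set M := (\max_(_ < _) _)%N; lia.
apply/mem_pbox; split=> i; last by rewrite geq_max => /andP[/h2].
have [di _|id _] := leqP d i; first by rewrite h2// mem_window; lia.
by have := h1 i id; rewrite !mem_window; set M := (\max_(_ < _) _)%N; lia.
Qed.

(** Positions of translates of [box p d] that cover a large box: multiples of the side [2 p + 1] in
    the first [d] directions, and every value in the others, where the tile is flat. *)
Definition cover_range p d q n (i : nat) : {fset int} :=
  if (i < d)%N then [fset (p.*2.+1%:Z * k)%R | k in window q]%fset else window n.

Lemma folner_cover p d q n : (d <= n)%N -> (n <= q * p.*2.+1 + p)%N ->
  (folner n `<=` [fset (v + g)%R | v in pbox (cover_range p d q n) n, g in box p d])%fset.
Proof.
move=> dn nq; apply/fsubsetP => g; rewrite folnerE => /mem_pbox[g1 g2].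
(* [c] rounds the first [d] coordinates of [g] to the nearest multiple of the side; adding [p]
   before the division centres the remainder in [[-p, p]]. *)
pose c i := if (i < d)%N then p.*2.+1%:Z * divz (g i + p%:Z) p.*2.+1%:Z else g i.
have cfin : c \in finsupp_seq.
  by apply/asboolP; exists n => i ni; rewrite /c ltnNge (leq_trans dn ni)/= g2.
have lp : (0 < p.*2.+1%:Z) by [].
apply/imfset2P; exists (MkZinf cfin) => /=; last first.
  exists (g - MkZinf cfin); last by rewrite addrC subrK.
  apply/mem_pbox; split=> i id; rewrite coordD coordN /= /c; last first.
    by rewrite ltnNge id/= subrr.
  rewrite id mem_window.
  have := divz_eq (g i + p%:Z) p.*2.+1%:Z.
  have := modz_ge0 (g i + p%:Z) (lt0r_neq0 lp).
  have := ltz_pmod (g i + p%:Z) lp.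
  set a := divz _ _; set b := modz _ _; rewrite -mul2n; lia.
apply/mem_pbox; split=> i id /=; rewrite /c /cover_range; last first.
  by rewrite ltnNge (leq_trans dn id)/= g2.
case: ifP => [ltid|_]; last exact: g1.
apply/imfsetP; exists (divz (g i + p%:Z) p.*2.+1%:Z) => //=.
rewrite mem_window.
have := g1 i id; rewrite mem_window.
have := divz_eq (g i + p%:Z) p.*2.+1%:Z.
have := modz_ge0 (g i + p%:Z) (lt0r_neq0 lp).
have := ltz_pmod (g i + p%:Z) lp.
move: nq; set a := divz _ _; set b := modz _ _; rewrite -mul2n => nq *.
nia.
Qed.

End Boxes.

(** * Subadditive set functions *)

Definition translate (v : Zinf) (S : {fset Zinf}) : {fset Zinf} := [fset (v + g)%R | g in S]%fset.

Lemma mem_translate v S g : (g \in translate v S) = (g - v \in S).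
Proof.
apply/imfsetP/idP => [[h /= hS ->]|gS]; first by rewrite addrC addKr.
by exists (g - v) => //; rewrite addrC subrK.
Qed.

Lemma card_cover_range p d q e :
  #|` pbox (cover_range p d q (d + e)) (d + e)| = (q.*2.+1 ^ d * (d + e).*2.+1 ^ e)%N.
Proof.
rewrite card_pbox big_split_ord /=; congr (_ * _)%N.
  under eq_bigr => i _.
    rewrite /cover_range ltn_ord card_imfset; last by move=> k l /mulfI; exact.
    rewrite card_window; over.
  by rewrite prod_nat_const card_ord.
under eq_bigr => i _ do rewrite /cover_range ltnNge leq_addr/= card_window.
by rewrite prod_nat_const card_ord.
Qed.

Section Subadditive.
Variables (R : realType) (K : {fset Zinf} -> R).
Hypothesis K0 : K fset0 = 0.
Hypothesis K_mono : forall S T, (S `<=` T)%fset -> K S <= K T.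
Hypothesis K_subadd : forall S T, K (S `|` T)%fset <= K S + K T.
Hypothesis K_translate : forall v S, K (translate v S) = K S.

Lemma K_ge0 S : 0 <= K S.
Proof. by rewrite -K0 K_mono. Qed.

Lemma K_tiles (V B : {fset Zinf}) :
  K [fset (v + g)%R | v in V, g in B]%fset <= #|` V|%:R * K B.
Proof.
elim/fset_ind: V => [|v V vV IH].
  rewrite cardfs0 mul0r -K0 K_mono//; apply/fsubsetP => g /imfset2P[v /=].
  by rewrite inE.
rewrite cardfsU1 vV natrD mulrDl mul1r; apply: le_trans (lerD (lexx _) IH).
rewrite -(K_translate v B); apply: le_trans (K_subadd _ _); apply: K_mono.
apply/fsubsetP => g /imfset2P[w /=]; rewrite in_fset1U => /predU1P[->|wV] [h /= hB ->].
  by rewrite inE mem_translate addrC addKr hB.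
by rewrite inE (in_imfset2 _ _ wV hB) orbT.
Qed.

(** The [n - d] flat directions are covered without loss, although the dimension grows with [n]. In
    each of the other [d], [q = n / (2 p + 1) + 1] gives [(2 p + 1) (2 q + 1) <= (2 n + 1) + 3 (2 p
    + 1)], a relative loss of at most [3 (2 p + 1) / (n + 1)]. *)
Lemma subadditive_ratio p d n : (d <= n)%N ->
  K (folner n) / #|` folner n|%:R <=
  K (box p d) / #|` box p d|%:R * (1 + (3 * p.*2.+1)%:R * harmonic n) ^+ d.
Proof.
move=> dn; pose q := (n %/ p.*2.+1).+1.
have nq : (n <= q * p.*2.+1 + p)%N.
  by rewrite mulSn {1}(divn_eq n p.*2.+1); have := ltn_pmod n (ltn0Sn p.*2); lia.
have Kn : K (folner n) <= (q.*2.+1 ^ d * n.*2.+1 ^ (n - d))%:R * K (box p d).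
  apply: le_trans (K_mono (folner_cover dn nq)) _.
  by apply: le_trans (K_tiles _ _) _; rewrite -{1 2}(subnKC dn) card_cover_range subnKC.
rewrite folnerE !card_box.
set L : R := p.*2.+1%:R; set N : R := n.*2.+1%:R; set Q : R := q.*2.+1%:R.
set X : R := 1 + _.
have L0 : 0 < L by rewrite ltr0n.
have N0 : 0 < N by rewrite ltr0n.
have h0 : 0 < @harmonic R n by rewrite harmonic_gt0.
have X0 : 0 <= X by rewrite addr_ge0// mulr_ge0// ltW.
have LQ : L * Q <= N + 3 * L.
  rewrite /L /Q /N -!natrM -natrD ler_nat /q.
  by have := leq_divM n p.*2.+1; rewrite -!mul2n; set a := (n %/ _)%N; nia.
have NX : N + 3 * L <= X * N.
  have -> : X * N = N + 3 * L * (@harmonic R n * N) by rewrite /X natrM; ring.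
  rewrite lerD2l ler_peMr//; first by rewrite mulr_ge0// ltW.
  by rewrite /harmonic /= ler_pdivlMl ?ltr0n// mulr1 ler_nat -mul2n; lia.
have QLX : Q <= L^-1 * X * N.
  by rewrite -mulrA ler_pdivlMl//; exact: le_trans LQ NX.
have Qd : Q ^+ d <= (L ^+ d)^-1 * X ^+ d * N ^+ d.
  by rewrite -exprVn -!exprMn lerXn2r// nnegrE ?mulr_ge0 ?invr_ge0// ltW.
rewrite !natrX -/N -/L ler_pdivrMr ?exprn_gt0//.
rewrite -[n in X in _ <= _ * X](subnKC dn) exprD.
move: Kn; rewrite -folnerE natrM !natrX => /le_trans; apply.
rewrite -/N -/Q.
have -> : K (box p d) / L ^+ d * X ^+ d * (N ^+ d * N ^+ (n - d)) =
   (L ^+ d)^-1 * X ^+ d * N ^+ d * (N ^+ (n - d) * K (box p d)).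
  by move: (L ^+ d)^-1 => l; ring.
by rewrite -mulrA ler_wpM2r// mulr_ge0 ?K_ge0// exprn_ge0// ltW.
Qed.

(** For fixed [d] the error factor tends to 1, so each box ratio eventually bounds the Følner ratios
    up to any [e]. Applied to the Følner boxes themselves, this forces convergence to their
    infimum. *)
Lemma subadditive_limit : exists h : R,
  (fun n => K (folner n) / #|` folner n|%:R) @ \oo --> h /\
  forall p d, h <= K (box p d) / #|` box p d|%:R.
Proof.
pose u n := K (folner n) / #|` folner n|%:R.
have box_bound p d (e : R) : 0 < e ->
    \forall n \near \oo, u n <= K (box p d) / #|` box p d|%:R + e.
  move=> e0; set c := _ / _.
  have : (fun n => c * (1 + (3 * p.*2.+1)%:R * @harmonic R n) ^+ d) @ \oo --> c * (1 + (3 * p.*2.+1)%:R * 0) ^+ d.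
    apply: cvgMr; apply: (@cvg_comp _ _ _ _ (fun x : R => x ^+ d)); last exact: exprn_continuous.
    by apply: cvgD; [exact: cvg_cst|apply: cvgMr; exact: cvg_harmonic].
  rewrite mulr0 addr0 expr1n mulr1 => cc.
  near=> n; apply: le_trans (subadditive_ratio p _) _; first by near: n; exact: nbhs_infty_ge.
  by near: n; apply: (cvgr_le _ cc); rewrite ltrDl.
have u0 n : 0 <= u n by rewrite divr_ge0// K_ge0.
have hiu : has_inf (range u).
  by split; [exists (u 0%N), 0%N|exists 0 => _ [n _ <-]].
have uh : u @ \oo --> inf (range u).
  apply/cvgrPdist_le => e e0.
  have [_ [n0 _ <-] un0] := inf_adherent (divr_gt0 e0 (ltr0n _ 2)) hiu.
  have := box_bound n0 n0 (e / 2) (divr_gt0 e0 (ltr0n _ 2)); rewrite -folnerE -/(u n0) => un0b.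
  near=> n.
  have iu : inf (range u) <= u n by apply: ge_inf; [exact: hiu.2|exists n].
  have : u n <= u n0 + e / 2.
    by near: n.
  by rewrite ler_norml; lra.
exists (inf (range u)); split=> // p d.
apply/ler_addgt0Pr => e e0; apply: (cvgr_to_le uh); exact: box_bound.
Unshelve. all: by end_near.
Qed.

End Subadditive.

(** * Submodular set functions and the lexicographic past *)

(** The most significant coordinate is the last one where the two sites differ; it exists by finite
    support, which makes the order total and translation invariant. *)
Definition lexlt (g k : Zinf) : Prop :=
  exists i, g i < k i /\ forall j, (i < j)%N -> g j = k j.

Lemma lexlt_irrefl g : ~ lexlt g g.
Proof. by case=> i []; rewrite ltxx. Qed.

Lemma lexlt_trans g k l : lexlt g k -> lexlt k l -> lexlt g l.
Proof.
move=> [i [gki gk]] [j [klj kl]]; case: (ltngtP i j) => ij.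
- by exists j; rewrite gk//; split=> // n jn; rewrite gk ?kl// (ltn_trans ij).
- by exists i; rewrite -(kl i)//; split=> // n jn; rewrite gk ?kl// (ltn_trans ij).
- by exists i; rewrite -ij in klj kl; split=> [|n jn]; rewrite ?(lt_trans gki)// gk ?kl.
Qed.

Lemma lexlt_total g k : g <> k -> lexlt g k \/ lexlt k g.
Proof.
move=> gk; have [N gN] := finsupp_bound g; have [M kM] := finsupp_bound k.
have ex : exists i, g i != k i.
  apply: contrapT => /forallNP h; apply: gk; apply: Zinf_ext => i.
  by apply/eqP; have /negP := h i; rewrite negbK.
have bd i : g i != k i -> (i <= maxn N M)%N.
  by apply: contraNT; rewrite -ltnNge gtn_max => /andP[/ltnW/gN -> /ltnW/kM ->].
case: (ex_maxnP ex bd) => i gki mi.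
have eqi j : (i < j)%N -> g j = k j.
  by move=> ij; apply/eqP; apply: contraTT ij => /mi; rewrite -leqNgt.
by case/orP: (lt_total gki) => ?; [left|right]; exists i; split=> // j /eqi.
Qed.

Lemma lexltBr g k : lexlt (g - k) 0 <-> lexlt g k.
Proof.
split=> -[i [gki gk]]; exists i; move: gki; rewrite coordD coordN coord0 subr_lt0;
  split=> // j /gk; rewrite coordD coordN coord0; first by move/eqP; rewrite subr_eq0 => /eqP.
by move=> ->; rewrite subrr.
Qed.

Lemma lexlt_max (S : {fset Zinf}) : S != fset0 ->
  exists2 m, m \in S & forall g, g \in S -> g != m -> lexlt g m.
Proof.
elim/fset_ind: S => [|g S gS IH _]; first by rewrite eqxx.
have [->|S0] := eqVneq (S : {fset Zinf}) fset0.
  by exists g; rewrite ?in_fset1U ?eqxx// => k; rewrite in_fset1U inE orbF => ->.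
have [m mS mmax] := IH S0.
have gm : g != m by apply: contraNneq gS => ->.
have [gltm|mltg] := lexlt_total (elimN eqP gm).
  exists m; rewrite ?in_fset1U ?mS ?orbT// => k.
  by rewrite in_fset1U => /predU1P[->//|]; exact: mmax.
exists g; rewrite ?in_fset1U ?eqxx// => k; rewrite in_fset1U => /predU1P[->|kS _].
  by rewrite eqxx.
by have [->//|km] := eqVneq k m; apply: lexlt_trans mltg; exact: mmax.
Qed.

Definition swap_blocks (d j i : nat) : nat :=
  if (i < j)%N then (i + d)%N else if (d <= i < d + j)%N then (i - d)%N else i.

Lemma swap_blocksK d j : (j <= d)%N -> involutive (swap_blocks d j).
Proof.
by move=> jd i; rewrite /swap_blocks; do ?case: ifP; lia.
Qed.

Lemma swap_blocks_fin d j : exists N, forall i, (N <= i)%N -> swap_blocks d j i = i.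
Proof.
exists (d + j)%N => i dji; rewrite /swap_blocks ltnNge (leq_trans (leq_addl d j) dji)/=.
by rewrite ltnNge dji andbF.
Qed.

Definition swap_perm d j (jd : (j <= d)%N) : finperm :=
  FinPerm (inv_bij (swap_blocksK jd)) (swap_blocks_fin d j).

Section Submodular.
Variables (R : realType) (K : {fset Zinf} -> R).
Hypothesis K0 : K fset0 = 0.
Hypothesis K_mono : forall S T, (S `<=` T)%fset -> K S <= K T.
Hypothesis K_subadd : forall S T, K (S `|` T)%fset <= K S + K T.
Hypothesis K_translate : forall v S, K (translate v S) = K S.
Let incr g S := K (g |` S)%fset - K S.
Hypothesis K_submod : forall g S T, (S `<=` T)%fset -> incr g T <= incr g S.
Hypothesis K_permute : forall rho S, K [fset permute rho g | g in S]%fset = K S.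
Variable h : R.
Hypothesis K_lim : (fun n => K (folner n) / #|` folner n|%:R) @ \oo --> h.
Hypothesis K_box : forall p d, h <= K (box p d) / #|` box p d|%:R.

Lemma incr_translate v g S : incr (v + g) (translate v S) = incr g S.
Proof.
rewrite /incr K_translate -(K_translate v (g |` S)%fset); congr (K _ - _).
apply/fsetP => k; rewrite in_fset1U !mem_translate in_fset1U.
by congr (_ || _); apply/eqP/eqP => [->|<-]; rewrite addrC ?subrK ?addKr.
Qed.

(** The points of [E] are added one at a time: each sees its own translate of [S] in [G], so by
    submodularity and translation invariance it costs at most [incr 0 S]. *)
Lemma K_add_translates (E G S : {fset Zinf}) :
  (forall e, e \in E -> (translate e S `<=` G)%fset) ->
  K (E `|` G)%fset <= K G + #|` E|%:R * incr 0 S.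
Proof.
elim/fset_ind: E => [_|e E eE IH EG]; first by rewrite fset0U mul0r addr0.
rewrite cardfsU1 eE natrD mulrDl mul1r addrCA -fsetUA.
have SG : (translate e S `<=` E `|` G)%fset.
  by apply: fsubset_trans (fsubsetUr _ _); apply: EG; rewrite fset1U1.
have := K_submod e SG; rewrite -[e in incr e (translate _ _)]addr0 incr_translate.
have := IH (fun k kE => EG k (fset1Ur e kE)).
by rewrite /incr; lra.
Qed.

(* If S has coordinates in [-p, p]^j, let P = (2p+1)^j and move S to j coordinates that
   the box B in the first d coordinates does not use. The box in d + j coordinates is
   then B together with P - 1 translates G of it, where G contains every translate of
   S by a point of B; hence adding B to G costs at most |B| incr 0 S. *)
Lemma le_incr0 S : 0 \notin S -> h <= incr 0 S.
Proof.
move=> S0; have [p [j Spj]] := subset_box S.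
pose P := (p.*2.+1 ^ j)%N.
have P0 : (0 < P)%N by rewrite expn_gt0.
pose a d := K (box p d) / #|` box p d|%:R.
have card0 d : 0 < #|` box p d|%:R :> R by rewrite ltr0n card_box expn_gt0.
have step d : (j <= d)%N -> P%:R * a (d + j)%N <= (P.-1)%:R * a d + incr 0 S.
  move=> jd; pose rho := swap_perm jd.
  pose S' := [fset permute rho g | g in S]%fset.
  (* [pbox W (d + j)] is the set of [P] displacements in the fresh directions; [V] drops the zero
     one, which would give the box itself. *)
  pose W i := if (i < d)%N then [fset 0%R]%fset else window p.
  pose V := (pbox W (d + j) `\ 0)%fset.
  pose G := [fset (v + g)%R | v in V, g in box p d]%fset.
  have incrS' : incr 0 S' = incr 0 S.
    rewrite /incr K_permute -(K_permute rho (0 |` S)%fset); congr (K _ - _).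
    have p0 : permute rho 0 = 0 by apply: Zinf_ext => i; rewrite coord0; exact: coord0.
    apply/fsetP => k; rewrite in_fset1U; apply/orP/imfsetP => [[/eqP ->|/imfsetP[s /= sS ->]]|].
    - by exists 0; rewrite /= ?p0// fset1U1.
    - by exists s => //=; exact: fset1Ur.
    - move=> [s /=]; rewrite in_fset1U => /predU1P[->|sS] ->; first by left; rewrite p0.
      by right; apply/imfsetP; exists s.
  have cV : #|` V| = P.-1.
    have W0 : 0 \in pbox W (d + j).
      apply/mem_pbox; split=> i _; rewrite coord0// /W.
      by case: ifP => _; rewrite ?inE// mem_window; lia.
    have := cardfsD1 0 (pbox W (d + j)); rewrite W0 add1n -/V card_pbox big_split_ord /=.
    rewrite big1 ?mul1n; last by move=> i _; rewrite /W ltn_ord cardfs1.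
    under eq_bigr => i _ do rewrite /W ltnNge leq_addr/= card_window.
    by rewrite prod_nat_const card_ord -/P => ->.
  have EG e : e \in box p d -> (translate e S' `<=` G)%fset.
    move=> eE; apply/fsubsetP => k; rewrite mem_translate => /imfsetP[s /= sS kes].
    rewrite -(subrK e k); apply: in_imfset2 => //=; rewrite kes !inE; apply/andP; split.
      apply: contraNneq S0 => s0; rewrite (_ : 0 = s)//; apply: Zinf_ext => i.
      have := congr1 (fun k : Zinf => k (swap_blocks d j i)) s0.
      by rewrite /= swap_blocksK// coord0.
    have /mem_pbox[s1 s2] := fsubsetP Spj _ sS.
    apply/mem_pbox; split=> i id /=; rewrite /swap_blocks /W.
      have [ltid|leid] := ltnP i d; first by rewrite inE; apply/eqP; apply: s2; do ?case: ifP; lia.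
      by rewrite ifN ?id ?s1// -?leqNgt; lia.
    by rewrite !ifN ?s2//; lia.
  have boxU : (box p (d + j) `<=` box p d `|` G)%fset.
    apply/fsubsetP => g /mem_pbox[g1 g2].
    pose c i := if (i < d)%N then 0 else g i.
    have cfin : c \in finsupp_seq.
      by apply/asboolP; exists (d + j)%N => i ni; rewrite /c ltnNge (leq_trans (leq_addr _ _) ni)/= g2.
    pose w := MkZinf cfin.
    have gw : g - w \in box p d.
      apply/mem_pbox; split=> i id; rewrite coordD coordN /= /c.
        by rewrite id subr0 g1// (leq_trans id)// leq_addr.
      by rewrite ltnNge id/= subrr.
    have [w0|w0] := eqVneq w 0; first by rewrite inE -[g]subr0 -w0 gw.
    rewrite inE -[in X in _ || X](subrK w g) addrC; apply/orP; right.
    apply: in_imfset2 => //=; rewrite !inE w0; apply/mem_pbox; split=> i id /=; rewrite /c /W.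
      by case: ifP => _; rewrite ?inE// g1.
    by rewrite g2// if_same.
  have := le_trans (K_mono boxU) (K_add_translates EG).
  have := K_tiles K0 K_mono K_subadd K_translate V (box p d); rewrite cV incrS' -/G.
  rewrite /a (card_box p (d + j)) expnD -/P -card_box natrM => KG Kbox.
  set b : R := #|` box p d|%:R; have b0 : b != 0 by rewrite gt_eqF ?card0.
  have P0' : P%:R != 0 :> R by rewrite pnatr_eq0 -lt0n.
  have -> : P%:R * (K (box p (d + j)) / (b * P%:R)) = K (box p (d + j)) / b by rewrite mulrC invfM mulrA divfK.
  rewrite ler_pdivrMr ?card0//.
  have -> : ((P.-1)%:R * (K (box p d) / b) + incr 0 S) * b = (P.-1)%:R * K (box p d) + b * incr 0 S.
    by field.
  by lra.
(* If [a (d + j)] is within [e / P] of the infimum of [I], then [step] gives [P inf I <= (P - 1)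
   (inf I + e / P) + incr 0 S], hence [inf I <= incr 0 S + e]. The shift by [j] secures the side
   condition of [step]. *)
pose I := range (fun d => a (d + j)%N).
have Iinf : has_inf I by split; [exists (a j), 0%N; rewrite ?add0n//|exists h => _ [d _ <-]; exact: K_box].
have hI : h <= inf I by apply: lb_le_inf; [exact: Iinf.1|move=> _ [d _ <-]; exact: K_box].
apply: le_trans hI _; apply/ler_addgt0Pr => e e0.
have eP : 0 < e / P%:R by rewrite divr_gt0// ltr0n.
have [_ [d _ <-] ad] := inf_adherent eP Iinf.
have := step (d + j)%N (leq_addl _ _).
have Ia : inf I <= a (d + j + j)%N by apply: ge_inf; [exact: Iinf.2|exists (d + j)%N].
have h1 := ler_wpM2l (ler0n R P) Ia.
have h2 := ler_wpM2l (ler0n R P.-1) (ltW ad).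
have : e / P%:R * P%:R = e by rewrite divfK// pnatr_eq0 -lt0n.
move: eP h1 h2; set r := e / _.
have -> : P%:R = (P.-1)%:R + 1 :> R by rewrite -{1}(prednK P0) -natr1.
by lra.
Qed.

Lemma le_incr g S : g \notin S -> h <= incr g S.
Proof.
move=> gS; rewrite -[g in incr g](addr0 g) -[S](_ : translate g (translate (- g) S) = S).
  by rewrite incr_translate le_incr0// mem_translate opprK add0r.
by apply/fsetP => k; rewrite !mem_translate opprK subrK.
Qed.

(** Chain rule along the order: the largest site of [S] has all the others in its past, so removing
    it lowers [K] by at least [c]. *)
Lemma K_past (c : R) :
  (forall S, (forall s, s \in S -> lexlt s 0) -> c <= incr 0 S) ->
  forall S : {fset Zinf}, #|` S|%:R * c <= K S.
Proof.
move=> cS S; move: {2}#|` S| (erefl #|` S|) => n; elim: n S => [|n IH] S cardS; rewrite cardS.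
  by rewrite mul0r -K0 K_mono// fsub0set.
have S0 : (S : {fset Zinf}) != fset0 by rewrite -cardfs_eq0 cardS.
have [m mS mmax] := lexlt_max S0.
have cardS' : #|` (S `\ m)%fset| = n by have := cardfsD1 m S; rewrite mS cardS add1n => -[].
have := IH _ cardS'; rewrite cardS'; have : c <= incr m (S `\ m)%fset.
  rewrite -[m in incr m](addr0 m) -[X in incr _ X](_ : translate m (translate (- m) (S `\ m)%fset) = _).
    rewrite incr_translate; apply: cS => s; rewrite mem_translate opprK !inE => /andP[sm sS].
    by have /lexltBr := mmax _ sS sm; rewrite addrK.
  by apply/fsetP => k; rewrite !mem_translate opprK subrK.
by rewrite /incr fsetD1K// -natr1 mulrDl mul1r; lra.
Qed.

(** Were every past context to leave at least [h + e], the chain rule would keep all Følner ratios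
    at or above [h + e], against their limit [h]. *)
Lemma past_incr (e : R) : 0 < e ->
  exists2 S : {fset Zinf}, (forall s, s \in S -> lexlt s 0) & incr 0 S < h + e.
Proof.
move=> e0; apply: contrapT => nS.
have /K_past le_he : forall S, (forall s, s \in S -> lexlt s 0) -> h + e <= incr 0 S.
  by move=> S Sp; rewrite leNgt; apply/negP => Se; apply: nS; exists S.
suff : h + e <= h by lra.
apply: (cvgr_to_ge K_lim); near=> n.
by rewrite ler_pdivlMr ?ltr0n ?folnerE ?card_box ?expn_gt0// mulrC -card_box -folnerE.
Unshelve. all: by end_near.
Qed.

End Submodular.

(** * Entropy *)

Section RealInequalities.
Variable R : realType.
Implicit Types (p q s t : R).

Lemma ln_le_subr1 s : 0 < s -> ln s <= s - 1.
Proof. by move=> s0; have := @le_ln1Dx R (s - 1); rewrite addrCA subrr addr0; apply; lra. Qed.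

(* ln (q/p) = 2 ln (sqrt (q/p)) and ln s <= s - 1 give (sqrt p - sqrt q)^2 as a lower bound. *)
Lemma kl_term p q : 0 <= p <= 1 -> 0 <= q <= 1 -> (q = 0 -> p = 0) ->
  (p - q) ^+ 2 / 4 <= p * (ln p - ln q) - p + q.
Proof.
move=> /andP[p0 p1] /andP[q0 q1] qp.
have [->|pn0] := eqVneq p 0; first by rewrite mul0r; nra.
have qn0 : q != 0 by apply: contra_neq pn0.
set s := Num.sqrt q; set t := Num.sqrt p.
have s0 : 0 < s by rewrite sqrtr_gt0 lt_neqAle eq_sym qn0.
have t0 : 0 < t by rewrite sqrtr_gt0 lt_neqAle eq_sym pn0.
have qE : q = s ^+ 2 by rewrite sqr_sqrtr.
have pE : p = t ^+ 2 by rewrite sqr_sqrtr.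
have s1 : s <= 1 by rewrite -sqrtr1 ler_sqrt.
have t1 : t <= 1 by rewrite -sqrtr1 ler_sqrt.
have lnst : ln s - ln t <= s / t - 1 by rewrite -ln_div ?posrE// ln_le_subr1// divr_gt0.
rewrite qE pE !lnXn//.
have h : t ^+ 2 * (ln t *+ 2 - ln s *+ 2) >= 2 * t ^+ 2 - 2 * (s * t).
  have -> : 2 * t ^+ 2 - 2 * (s * t) = t ^+ 2 * (- ((s / t - 1) *+ 2)) by field; rewrite gt_eqF.
  by rewrite ler_pM2l ?exprn_gt0//; lra.
(* The 4 comes from [(t + s) ^+ 2 <= 4], as both square roots are at most 1. *)
have : (t ^+ 2 - s ^+ 2) ^+ 2 / 4 <= (t - s) ^+ 2.
  have -> : (t ^+ 2 - s ^+ 2) ^+ 2 = (t - s) ^+ 2 * (t + s) ^+ 2 by ring.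
  have : 0 <= (t - s) ^+ 2 by exact: sqr_ge0.
  have : (t + s) ^+ 2 <= 4 by nra.
  nra.
nra.
Qed.

(** A weak Pinsker inequality: in the sum of the bounds [kl_term] the corrections [- p + q] cancel,
    both masses being 1. *)
Lemma kl_ge (I : finType) (p q : I -> R) :
  (forall i, 0 <= p i) -> (forall i, 0 <= q i) ->
  \sum_i p i = 1 -> \sum_i q i = 1 -> (forall i, q i = 0 -> p i = 0) ->
  (\sum_i (p i - q i) ^+ 2) / 4 <= \sum_i p i * (ln (p i) - ln (q i)).
Proof.
move=> p0 q0 p1 q1 qp.
have le1 (f : I -> R) i : (forall i, 0 <= f i) -> \sum_i f i = 1 -> f i <= 1.
  by move=> f0 <-; rewrite (bigD1 i)//= lerDl sumr_ge0.
have -> : \sum_i p i * (ln (p i) - ln (q i)) =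
    \sum_i (p i * (ln (p i) - ln (q i)) - p i + q i).
  by rewrite big_split/= sumrB p1 q1; ring.
rewrite mulr_suml; apply: ler_sum => i _.
by apply: kl_term; rewrite ?p0 ?q0 ?le1//; exact: qp.
Qed.

(** The right-hand side is the mutual information of [i] and [j] given [l], that is, the mean
    divergence of the law of [i] given [(j, l)] from its law given [l]. [kl_ge] is applied for each
    [(j, l)] of positive mass. *)
Lemma cond_mutual_info_ge (I J L : finType) (P : I -> J -> L -> R)
    (PJL : J -> L -> R) (PIL : I -> L -> R) (PL : L -> R) :
  (forall i j l, 0 <= P i j l) ->
  (forall j l, PJL j l = \sum_i P i j l) ->
  (forall i l, PIL i l = \sum_j P i j l) ->
  (forall l, PL l = \sum_j PJL j l) ->
  (\sum_l \sum_j PJL j l * \sum_i (P i j l / PJL j l - PIL i l / PL l) ^+ 2) / 4 <=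
  \sum_l \sum_j \sum_i P i j l *
    (ln (P i j l) + ln (PL l) - ln (PIL i l) - ln (PJL j l)).
Proof.
move=> P0 PJLE PILE PLE.
have J0 j l : 0 <= PJL j l by rewrite PJLE sumr_ge0.
have I0 i l : 0 <= PIL i l by rewrite PILE sumr_ge0.
have PleJ i j l : P i j l <= PJL j l by rewrite PJLE (bigD1 i)//= lerDl sumr_ge0.
have PleI i j l : P i j l <= PIL i l by rewrite PILE (bigD1 j)//= lerDl sumr_ge0.
have JleL j l : PJL j l <= PL l by rewrite PLE (bigD1 j)//= lerDl sumr_ge0.
rewrite mulr_suml; apply: ler_sum => l _; rewrite mulr_suml; apply: ler_sum => j _.
have [z|JN] := eqVneq (PJL j l) 0.
  rewrite z !mul0r big1// => i _.
  by have := PleJ i j l; have := P0 i j l; rewrite z => ? ?; rewrite (_ : P i j l = 0) ?mul0r//; lra.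
have Jgt : 0 < PJL j l by rewrite lt_neqAle eq_sym JN J0.
have Lgt : 0 < PL l := lt_le_trans Jgt (JleL j l).
have kl := @kl_ge I (fun i => P i j l / PJL j l) (fun i => PIL i l / PL l).
have {}kl : (\sum_i (P i j l / PJL j l - PIL i l / PL l) ^+ 2) / 4 <=
    \sum_i (P i j l / PJL j l) * (ln (P i j l / PJL j l) - ln (PIL i l / PL l)).
  apply: kl => [i|i|||i /eqP]; rewrite ?divr_ge0 ?P0 ?J0 ?I0 ?(ltW Lgt)//.
  - by rewrite /= -mulr_suml -PJLE divff.
  - rewrite -mulr_suml (_ : \sum_i PIL i l = PL l) ?divff ?gt_eqF//.
    by rewrite PLE; under eq_bigr do rewrite PILE; under [RHS]eq_bigr do rewrite PJLE; exact: exchange_big.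
  - rewrite mulf_eq0 invr_eq0 (gt_eqF Lgt) orbF => /eqP z.
    by have := PleI i j l; have := P0 i j l; rewrite z => ? ?; rewrite (_ : P i j l = 0) ?mul0r//; lra.
rewrite -mulrA; apply: le_trans (ler_wpM2l (ltW Jgt) kl) _.
rewrite mulr_sumr; apply: ler_sum => i _.
have [->|PN] := eqVneq (P i j l) 0; first by rewrite !mul0r mulr0.
have Pgt : 0 < P i j l by rewrite lt_neqAle eq_sym PN P0.
have Igt : 0 < PIL i l := lt_le_trans Pgt (PleI i j l).
rewrite mulrA mulrCA divff// mulr1 !ln_div ?posrE// ler_pM2l//; lra.
Qed.

Definition eta s : R := - (s * ln s).

Lemma eta_ge0 s : 0 <= s <= 1 -> 0 <= eta s.
Proof. by move=> /andP[s0 s1]; rewrite /eta -mulrN mulr_ge0// oppr_ge0 ln_le0. Qed.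

Lemma eta_le1 s : 0 <= s <= 1 -> eta s <= 1.
Proof.
move=> /andP[s0 s1]; have [->|sn0] := eqVneq s 0; first by rewrite /eta mul0r oppr0.
have sp : 0 < s by rewrite lt_neqAle eq_sym sn0.
have := @ln_le_subr1 s^-1; rewrite invr_gt0 lnV ?posrE// => /(_ sp)/(ler_wpM2l s0).
by rewrite mulrBr divff// mulr1 /eta; lra.
Qed.

(* Tangent line of the concave function [eta] at [max t (d ^+ 2)]. *)
Lemma eta_modulus d s t : 0 < d <= 1 -> 0 <= s <= 1 -> 0 <= t <= 1 ->
  eta s <= eta t + (d ^+ 2 + 4 * d) + (1 + 2 / d) * `|s - t|.
Proof.
move=> /andP[d0 d1] /andP[s0 s1] /andP[t0 t1].
have lnd : - (2 / d) <= ln (d ^+ 2).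
  have := @ln_le_subr1 d^-1; rewrite invr_gt0 lnV ?posrE// => /(_ d0).
  by rewrite lnXn//; lra.
have tangent u : d ^+ 2 <= u <= 1 -> eta s <= eta u + (1 + 2 / d) * `|s - u|.
  move=> /andP[du u1]; have u0 : 0 < u by rewrite (lt_le_trans _ du)// exprn_gt0.
  have lnu : - (2 / d) <= ln u <= 0.
    by rewrite ln_le0// andbT (le_trans lnd)// ler_ln ?posrE// exprn_gt0.
  have e1 : eta s <= - (s * ln u) + (u - s).
    have [->|sn0] := eqVneq s 0; first by rewrite /eta !mul0r; lra.
    have sp : 0 < s by rewrite lt_neqAle eq_sym sn0.
    have := @ln_le_subr1 (u / s) (divr_gt0 u0 sp); rewrite ln_div ?posrE// => h.
    have := ler_wpM2l s0 h; rewrite mulrBr mulrBr mulr1 mulrCA divff// mulr1 /eta; lra.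
  apply: le_trans e1 _; rewrite /eta.
  have -> : - (s * ln u) + (u - s) = - (u * ln u) + (u - s) * (1 + ln u) by ring.
  rewrite lerD2l; apply: le_trans (ler_norm _) _; rewrite normrM mulrC distrC ler_wpM2r//.
  have d2 : 0 <= 2 / d by rewrite divr_ge0// ltW.
  by move: lnu => /andP[? ?]; rewrite ler_norml; apply/andP; split; lra.
have c0 : 0 <= 1 + 2 / d by rewrite addr_ge0// divr_ge0// ltW.
have [dt|td] := leP (d ^+ 2) t.
  have := tangent t; rewrite dt t1 => /(_ isT); nra.
(* For [t < d ^+ 2], passing from [t] to [d ^+ 2] costs [(1 + 2 / d) * d ^+ 2 = d ^+ 2 + 2 * d], and
   [eta (d ^+ 2) <= 2 * d]; together these make the modulus [d ^+ 2 + 4 * d]. *)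
have := tangent (d ^+ 2); rewrite lexx exprn_ile1// ?(ltW d0)// => /(_ isT).
have etad : eta (d ^+ 2) <= 2 * d.
  rewrite /eta; have := ler_wpM2l (sqr_ge0 d) lnd.
  have -> : d ^+ 2 * - (2 / d) = - (2 * d) by field; rewrite gt_eqF.
  lra.
have : `|s - d ^+ 2| <= `|s - t| + d ^+ 2.
  have := ler_distD t s (d ^+ 2); rewrite (ltr0_norm (x := t - _)); last by rewrite subr_lt0.
  lra.
move=> /(ler_wpM2l c0); rewrite [X in _ <= X]mulrDr.
have -> : (1 + 2 / d) * d ^+ 2 = d ^+ 2 + 2 * d by field; rewrite gt_eqF.
have := @eta_ge0 t; rewrite t0 t1 => /(_ isT).
lra.
Qed.

End RealInequalities.

Section FiniteValued.
Context d (T : measurableType d) (R : realType) (mu : probability T R).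
Implicit Types (E F : set T).

Definition pr E : R := fine (mu E).

Lemma prE E : measurable E -> mu E = (pr E)%:E.
Proof. by move=> mE; rewrite fineK// fin_num_measure. Qed.

Lemma pr_ge0 E : 0 <= pr E. Proof. by rewrite fine_ge0. Qed.

Lemma pr_setT : pr setT = 1. Proof. by rewrite /pr probability_setT. Qed.

Lemma pr_set0 : pr set0 = 0. Proof. by rewrite /pr measure0. Qed.

Lemma le_pr E F : measurable E -> measurable F -> E `<=` F -> pr E <= pr F.
Proof. by move=> mE mF EF; rewrite -lee_fin -!prE// le_measure ?inE. Qed.

Lemma pr_partition (W : finType) (U : T -> W) E : measurable E ->
  (forall w, measurable [set t | U t = w]) ->
  pr E = \sum_w pr (E `&` [set t | U t = w]).
Proof.
move=> mE mU; have mEU w : measurable (E `&` [set t | U t = w]) by exact: measurableI.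
apply: EFin_inj; rewrite -prE// -sumEFin.
under eq_bigr => w _ do rewrite -prE//.
rewrite fsbig_seq ?index_enum_uniq// -measure_fin_bigcup//=.
- congr (mu _); apply/seteqP; split=> [t Et|t [w _ []]//].
  by exists (U t) => //=; exact: mem_index_enum.
- by move=> v w _ _ [t [[_ /= <-] [_ /= <-]]].
Qed.

Lemma Rintegral_sum (I : Type) (s : seq I) (f : I -> T -> R) :
  (forall i, mu.-integrable setT (EFin \o f i)) ->
  \int[mu]_t (\sum_(i <- s) f i t) = \sum_(i <- s) \int[mu]_t f i t.
Proof.
move=> intf; elim: s => [|i s IH].
  rewrite big_nil; under eq_Rintegral do rewrite big_nil.
  by rewrite Rintegral_cst// mul0r.
rewrite big_cons -IH -RintegralD//.
  by apply: eq_Rintegral => t _; rewrite big_cons.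
rewrite (_ : EFin \o _ = fun t => (\sum_(j <- s) (f j t)%:E)%E).
  by apply: integrable_sum => // j _; exact: intf.
by apply/funext => t /=; rewrite sumEFin.
Qed.

Lemma bounded_integrable (f : T -> R) (M : R) : measurable_fun setT f ->
  (forall t, `|f t| <= M) -> mu.-integrable setT (EFin \o f).
Proof.
move=> mf fM; apply: measurable_bounded_integrable => //.
  by rewrite (le_lt_trans (probability_le1 mu measurableT))// ltry.
by exists M; split; [exact: num_real|move=> N MN t _; exact: le_trans (fM t) (ltW MN)].
Qed.

Lemma Rintegral_indic E : measurable E -> \int[mu]_t (\1_E t : R) = pr E.
Proof. by move=> mE; rewrite /Rintegral integral_indic// setIT. Qed.

Lemma measurable_fun_finite_valued (W : finType) (U : T -> W) (G : W -> R) :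
  (forall w, measurable [set t | U t = w]) -> measurable_fun setT (G \o U).
Proof.
move=> mU _ B mB; rewrite setTI.
by have := measurable_finite_valued (G @^-1` B) mU.
Qed.

Lemma integrable_finite_valued (W : finType) (U : T -> W) (G : W -> R) :
  (forall w, measurable [set t | U t = w]) ->
  mu.-integrable setT (EFin \o (fun t => G (U t))).
Proof.
move=> mU; apply: (@bounded_integrable _ (\sum_w `|G w|)).
  exact: measurable_fun_finite_valued.
by move=> t; rewrite (bigD1 (U t))//= lerDl sumr_ge0.
Qed.

Lemma Rintegral_finite_valued (W : finType) (U : T -> W) (G : W -> R) :
  (forall w, measurable [set t | U t = w]) ->
  \int[mu]_t G (U t) = \sum_w pr [set t | U t = w] * G w.
Proof.
move=> mU.
have iU w : mu.-integrable setT (EFin \o (fun t => G w * \1_[set t | U t = w] t)).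
  rewrite (_ : EFin \o _ = fun t => ((G w)%:E * (\1_[set t | U t = w] t)%:E)%E)//.
  by apply: integrableZl => //; exact: integrable_indic.
transitivity (\int[mu]_t \sum_w G w * \1_[set t | U t = w] t).
  apply: eq_Rintegral => t _; rewrite (bigD1 (U t))//= indicE mem_set// mulr1 big1 ?addr0//.
  by move=> w wU; rewrite indicE memNset ?mulr0// => /= Uw; rewrite -Uw eqxx in wU.
rewrite Rintegral_sum//; apply: eq_bigr => w _.
rewrite RintegralZl//; last exact: integrable_indic.
by rewrite Rintegral_indic// mulrC.
Qed.

End FiniteValued.

(** * Block entropy, conditional entropy and its strict submodularity *)

Section BlockEntropy.
Variables (R : realType) (A : alphabetType) (mu : probability (borel Zinf A) R).
Implicit Types (S T : {fset Zinf}) (g v : Zinf) (x y : Zinf -> A).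

Lemma restrP S x y : restr S y = restr S x <-> cylinder [set` S] x y.
Proof.
split=> [/ffunP xy g /= gS|xy]; last by apply/ffunP => g; rewrite !ffunE; apply: xy; exact: fsvalP.
by have := xy [` gS]%fset; rewrite !ffunE.
Qed.

Lemma cylinderE S x : cylinder [set` S] x = [set y | restr S y = restr S x].
Proof. by apply/seteqP; split=> y /restrP. Qed.

Lemma det_by_cylinder S x : det_by S (cylinder [set` S] x).
Proof. by move=> y z yz xy g gS; rewrite -yz// xy. Qed.

Lemma measurable_cylinder S x : measurable (cylinder [set` S] x : set (borel Zinf A)).
Proof. by apply: fin_det_measurable; exists S; exact: det_by_cylinder. Qed.

Lemma measurable_restr S w : measurable ([set x | restr S x = w] : set (borel Zinf A)).
Proof.
apply: fin_det_measurable; exists S => x y xy /= <-.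
by apply/ffunP => g; rewrite !ffunE xy//; exact: fsvalP.
Qed.

Let H := block_entropy mu.

Lemma block_entropyE S :
  H S = - \sum_w pr mu [set x | restr S x = w] * ln (pr mu [set x | restr S x = w]).
Proof.
rewrite /H /block_entropy; congr (- _).
rewrite -(@Rintegral_finite_valued _ _ _ mu _ (restr S) (fun w => ln (pr mu [set x | restr S x = w])));
  last exact: measurable_restr.
by apply: eq_Rintegral => x _; rewrite cylinderE.
Qed.

Lemma block_entropy0 : H fset0 = 0.
Proof.
rewrite /H /block_entropy (_ : cylinder _ = fun=> setT); last first.
  by apply/funext => x; apply/seteqP; split=> // y _ g.
by rewrite probability_setT ln1 Rintegral_cst// mul0r oppr0.
Qed.

Definition reindex (f : Zinf -> Zinf) (x : Zinf -> A) : Zinf -> A := fun g => x (f g).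

Lemma cylinder_reindex f S x :
  cylinder [set` [fset f g | g in S]%fset] x = reindex f @^-1` (cylinder [set` S] (reindex f x)).
Proof.
apply/seteqP; split=> y xy g /= gS; first by apply: xy => /=; exact: in_imfset.
by move: gS => /imfsetP[k /= kS ->]; exact: xy.
Qed.

Lemma block_entropy_reindex f S :
  (forall E : set (borel Zinf A), measurable E -> mu (reindex f @^-1` E) = mu E) ->
  H [fset f g | g in S]%fset = H S.
Proof.
move=> muf; rewrite [RHS]block_entropyE /H /block_entropy; congr (- _).
pose m w := pr mu [set x | restr S x = w].
transitivity (\int[mu]_x ln (m (restr S (reindex f x)))).
  by apply: eq_Rintegral => x _; rewrite cylinder_reindex muf ?cylinderE//; exact: measurable_restr.
have mre w : measurable ([set x | restr S (reindex f x) = w] : set (borel Zinf A)).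
  have := @measurable_reindex _ _ A f measurableT _ (@measurable_restr S w).
  by rewrite setTI.
rewrite (@Rintegral_finite_valued _ _ _ mu _ (restr S \o reindex f) (fun w => ln (m w)))//.
apply: eq_bigr => w _; congr (_ * _); rewrite /pr -[in RHS]muf//; exact: measurable_restr.
Qed.

(** By the chain rule this is the conditional entropy H(x_g | x_S), which vanishes when [g] belongs
    to [S]. *)
Definition incr_entropy g S := H (g |` S)%fset - H S.

(* Conditional probability of a at g given the pattern of x on S (0 on null patterns). *)
Definition cp S g (a : A) x : R :=
  pr mu (cylinder [set` S] x `&` [set y | y g = a]) / pr mu (cylinder [set` S] x).

Let mcoord (g : Zinf) (a : A) : measurable ([set x | x g = a] : set (borel Zinf A)) := measurable_coord g a.

Lemma incr_entropyE g S :
  incr_entropy g S = \int[mu]_x \sum_a eta (cp S g a x).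
Proof.
pose P (i : A) (l : {ffun S -> A}) := pr mu ([set x | restr S x = l] `&` [set x | x g = i]).
pose PL l := pr mu [set x | restr S x = l].
have mP i l : measurable ([set x | restr S x = l] `&` [set x | x g = i] : set (borel Zinf A)).
  by apply: measurableI; [exact: measurable_restr|exact: mcoord].
have PleL i l : P i l <= PL l by apply: le_pr; [exact: mP|exact: measurable_restr|exact: subIsetl].
pose U (x : Zinf -> A) := (restr S x, x g).
have mU w : measurable ([set x | U x = w] : set (borel Zinf A)).
  rewrite (_ : mkset _ = [set x | restr S x = w.1] `&` [set x | x g = w.2]); first exact: mP.
  by apply/seteqP; split=> [x /= <-//|x []]; case: w => l i /= <- <-.
transitivity (\int[mu]_x (ln (PL (restr S x)) - ln (P (x g) (restr S x)))).
  rewrite RintegralB//; last 2 first.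
  - exact: (integrable_finite_valued mu (fun w => ln (PL w)) (@measurable_restr S)).
  - exact: (integrable_finite_valued mu (fun w => ln (P w.2 w.1)) mU).
  rewrite /incr_entropy /H /block_entropy opprK addrC; congr (_ - _).
    by apply: eq_Rintegral => x _; rewrite cylinderE.
  apply: eq_Rintegral => x _; congr (ln (pr mu _)); apply/seteqP; split=> y.
    move=> xy; split; last by apply: xy; rewrite /= fset1U1.
    by apply/restrP => k kS; apply: xy; rewrite /= fset1Ur.
  by move=> [/restrP xy /= yx] k /=; rewrite in_fset1U => /predU1P[->//|/xy].
rewrite (Rintegral_finite_valued mu (fun w => ln (PL w.1) - ln (P w.2 w.1)) mU).
transitivity (\sum_l PL l * \sum_i eta (P i l / PL l)); last first.
  rewrite -(Rintegral_finite_valued mu (fun l => \sum_i eta (P i l / PL l)) (@measurable_restr S)).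
  by apply: eq_Rintegral => x _; apply: eq_bigr => a _; rewrite /cp cylinderE.
under [RHS]eq_bigr do rewrite mulr_sumr.
rewrite pair_bigA; apply: eq_bigr => -[l i] _ /=.
have -> : pr mu [set x | U x = (l, i)] = P i l.
  by congr (pr mu _); apply/seteqP; split=> x; [case=> /= <- <-|case=> /= <- <-].
have [z|nz] := eqVneq (P i l) 0; first by rewrite z /eta !mul0r ?oppr0 ?mulr0.
have P0 : 0 < P i l by rewrite lt_neqAle eq_sym nz pr_ge0.
have L0 : 0 < PL l := lt_le_trans P0 (PleL i l).
by rewrite /eta ln_div ?posrE//; field; rewrite gt_eqF.
Qed.

(** The drop of entropy is the mutual information of [x g] and the pattern on [T], given the pattern
    on [S]. Besides submodularity this controls how far the conditional law itself moves when the
    context grows. *)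
Lemma entropy_gap g S T : (S `<=` T)%fset ->
  (\int[mu]_x \sum_a (cp T g a x - cp S g a x) ^+ 2) / 4 <= incr_entropy g S - incr_entropy g T.
Proof.
move=> ST.
(* The pattern [j] on [T] already determines [l] on [S]; keeping [l] as a separate index gives the
   shape of [cond_mutual_info_ge], with incompatible pairs of mass 0. *)
pose E (i : A) (j : {ffun T -> A}) (l : {ffun S -> A}) : set (borel Zinf A) :=
  [set x | restr T x = j] `&` [set x | restr S x = l] `&` [set x | x g = i].
have mE2 j l : measurable ([set x | restr T x = j] `&` [set x | restr S x = l] : set (borel Zinf A)).
  by apply: measurableI; exact: measurable_restr.
have mE i j l : measurable (E i j l) by apply: measurableI; [exact: mE2|exact: mcoord].
have mIL i l : measurable ([set x | restr S x = l] `&` [set x | x g = i] : set (borel Zinf A)).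
  by apply: measurableI; [exact: measurable_restr|exact: mcoord].
pose P i j l := pr mu (E i j l).
pose PJL j l := pr mu ([set x | restr T x = j] `&` [set x | restr S x = l]).
pose PIL i l := pr mu ([set x | restr S x = l] `&` [set x | x g = i]).
pose PL l := pr mu [set x | restr S x = l].
have PJLE j l : PJL j l = \sum_i P i j l by exact: (pr_partition mu (mE2 j l) (@mcoord g)).
have PILE i l : PIL i l = \sum_j P i j l.
  rewrite [LHS](pr_partition mu (mIL i l) (@measurable_restr T)).
  by apply: eq_bigr => j _; congr (pr mu _); rewrite setIC setIA.
have PLE l : PL l = \sum_j PJL j l.
  rewrite [LHS](pr_partition mu (@measurable_restr S l) (@measurable_restr T)).
  by apply: eq_bigr => j _; congr (pr mu _); rewrite setIC.
have := cond_mutual_info_ge (fun i j l => pr_ge0 mu (E i j l)) PJLE PILE PLE.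
pose U (x : Zinf -> A) := (restr S x, (restr T x, x g)).
have mU w : measurable ([set x | U x = w] : set (borel Zinf A)).
  rewrite (_ : mkset _ = E w.2.2 w.2.1 w.1); first exact: mE.
  by apply/seteqP; split=> [x /= <-//|x [[]]]; case: w => l [j i] /= <- <- <-.
have sumE (G : A -> {ffun T -> A} -> {ffun S -> A} -> R) :
    \sum_l \sum_j \sum_i P i j l * G i j l = \int[mu]_x G (x g) (restr T x) (restr S x).
  rewrite (@Rintegral_finite_valued _ _ _ mu _ U (fun w => G w.2.2 w.2.1 w.1))//.
  under eq_bigr => l _ do rewrite pair_bigA.
  rewrite pair_bigA; apply: eq_bigr => -[l [j i]] _ /=; congr (_ * _); congr (pr mu _).
  by apply/seteqP; split=> x; [case=> -[/= <- <- <-]|case=> /= <- <- <-].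
have restrT x y : restr T y = restr T x -> restr S y = restr S x.
  by move=> /restrP xy; apply/restrP => k /(fsubsetP ST); exact: xy.
have cylT x : cylinder [set` T] x = [set y | restr T y = restr T x] `&` [set y | restr S y = restr S x].
  by rewrite cylinderE; apply/seteqP; split=> y; [move=> /= yx; split=> //; exact: restrT|case].
have cylU V x : cylinder [set` (g |` V)%fset] x = cylinder [set` V] x `&` [set y | y g = x g].
  apply/seteqP; split=> y.
    by move=> xy; split; [move=> k kV; apply: xy; rewrite /= fset1Ur|apply: xy; rewrite /= fset1U1].
  by move=> [xy yx] k /=; rewrite in_fset1U => /predU1P[->//|/xy].
have -> : \sum_l \sum_j \sum_i P i j l *
      (ln (P i j l) + ln (PL l) - ln (PIL i l) - ln (PJL j l)) =
    incr_entropy g S - incr_entropy g T.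
  rewrite sumE.
  have iU (G : A -> {ffun T -> A} -> {ffun S -> A} -> R) :
      mu.-integrable setT (EFin \o fun x => G (x g) (restr T x) (restr S x)).
    exact: (integrable_finite_valued mu (fun w => G w.2.2 w.2.1 w.1) mU).
  rewrite (RintegralB _ (iU (fun i j l => ln (P i j l) + ln (PL l) - ln (PIL i l))) (iU (fun i j l => ln (PJL j l))))//.
  rewrite (RintegralB _ (iU (fun i j l => ln (P i j l) + ln (PL l))) (iU (fun i j l => ln (PIL i l))))//.
  rewrite (RintegralD _ (iU (fun i j l => ln (P i j l))) (iU (fun i j l => ln (PL l))))//.
  rewrite /incr_entropy /H /block_entropy.
  under [in RHS]eq_Rintegral => x _ do rewrite cylU.
  rewrite [X in _ = _ - (- X + _)](_ : _ = \int[mu]_x ln (P (x g) (restr T x) (restr S x))); last first.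
    by apply: eq_Rintegral => x _; rewrite cylU cylT.
  rewrite [X in _ = _ - (_ - - X)](_ : _ = \int[mu]_x ln (PJL (restr T x) (restr S x))); last first.
    by apply: eq_Rintegral => x _; rewrite cylT.
  rewrite [X in _ = - X + _ - _](_ : _ = \int[mu]_x ln (PIL (x g) (restr S x))); last first.
    by apply: eq_Rintegral => x _; rewrite cylinderE.
  rewrite [X in _ = _ - - X - _](_ : _ = \int[mu]_x ln (PL (restr S x))); last first.
    by apply: eq_Rintegral => x _; rewrite cylinderE.
  by ring.
apply: le_trans; rewrite ler_pM2r ?invr_gt0//.
rewrite le_eqVlt; apply/orP; left; apply/eqP.
pose Q j l := \sum_a (P a j l / PJL j l - PIL a l / PL l) ^+ 2.
transitivity (\sum_l \sum_j \sum_i P i j l * Q j l); last first.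
  by apply: eq_bigr => l _; apply: eq_bigr => j _; rewrite -/(Q j l) PJLE mulr_suml.
rewrite (sumE (fun _ j l => Q j l)).
apply: eq_Rintegral => x _; apply: eq_bigr => a _.
by rewrite /cp cylT cylinderE.
Qed.

Lemma measurable_cp S g a x :
  measurable (cylinder [set` S] x `&` [set y | y g = a] : set (borel Zinf A)).
Proof. by apply: measurableI; [exact: measurable_cylinder|exact: mcoord]. Qed.

Lemma cp_ge0 S g a x : 0 <= cp S g a x.
Proof. by rewrite divr_ge0// pr_ge0. Qed.

Lemma cp_le1 S g a x : cp S g a x <= 1.
Proof.
have le : pr mu (cylinder [set` S] x `&` [set y | y g = a]) <= pr mu (cylinder [set` S] x).
  by apply: le_pr => //; [exact: measurable_cp|exact: measurable_cylinder].
have [z|nz] := eqVneq (pr mu (cylinder [set` S] x)) 0; first by rewrite /cp z invr0 mulr0.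
by rewrite ler_pdivrMr ?mul1r// lt_neqAle eq_sym nz pr_ge0.
Qed.

Lemma cp_restr S g a x y : restr S x = restr S y -> cp S g a x = cp S g a y.
Proof. by move=> xy; rewrite /cp !cylinderE xy. Qed.

Lemma incr_entropy_ge0 g S : 0 <= incr_entropy g S.
Proof.
rewrite incr_entropyE; apply: Rintegral_ge0 => x _; apply: sumr_ge0 => a _.
by apply: eta_ge0; rewrite cp_ge0 cp_le1.
Qed.

Lemma block_entropy_submod g S T : (S `<=` T)%fset ->
  incr_entropy g T <= incr_entropy g S.
Proof.
move=> ST; rewrite -subr_ge0; apply: le_trans (entropy_gap g ST).
by rewrite divr_ge0// Rintegral_ge0// => x _; apply: sumr_ge0 => a _; exact: sqr_ge0.
Qed.

Lemma block_entropy_mono S T : (S `<=` T)%fset -> H S <= H T.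
Proof.
move=> ST; rewrite -(fsetUidPr _ _ ST) fsetUC; elim/fset_ind: T {ST} => [|g T _ IH].
  by rewrite fset0U.
apply: le_trans IH _; rewrite -subr_ge0 -fsetUA; exact: incr_entropy_ge0.
Qed.

Lemma block_entropy_subadd S T : H (S `|` T)%fset <= H S + H T.
Proof.
elim/fset_ind: S => [|g S _ IH]; first by rewrite fset0U block_entropy0 add0r.
have := @block_entropy_submod g S (S `|` T)%fset (fsubsetUl _ _).
by rewrite /incr_entropy fsetUA; move: IH; lra.
Qed.

End BlockEntropy.

Section EntropyRate.
Variables (R : realType) (A : alphabetType) (mu : probability (borel Zinf A) R).
Hypothesis mu_shift : shift_invariant mu.
Hypothesis mu_perm : perm_invariant mu.

Lemma block_entropy_translate v S : block_entropy mu (translate v S) = block_entropy mu S.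
Proof.
apply: block_entropy_reindex => E mE; rewrite -[RHS](mu_shift v mE); congr (mu (_ @^-1` E)).
by apply/funext => x; apply/funext => g; rewrite /reindex /shift addrC.
Qed.

Lemma block_entropy_permute rho (S : {fset Zinf}) :
  block_entropy mu [fset permute rho g | g in S]%fset = block_entropy mu S.
Proof. by apply: block_entropy_reindex => E mE; exact: mu_perm. Qed.

(** The lower bound for arbitrary contexts uses permutation invariance; the upper bound for past
    contexts comes from the chain rule and shift invariance. *)
Lemma entropy_rate : exists h : R,
  [/\ (fun n => #|` folner n|%:R^-1 * block_entropy mu (folner n)) @ \oo --> h,
      forall g S, g \notin S -> h <= incr_entropy mu g S &
      forall g (e : R), 0 < e -> exists2 S : {fset Zinf},
        (forall s, s \in S -> lexlt s g) & incr_entropy mu g S < h + e].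
Proof.
have K0 := block_entropy0 mu.
have Km S T (ST : (S `<=` T)%fset) := block_entropy_mono mu ST.
have Ks := block_entropy_subadd mu; have Kt := block_entropy_translate.
have Ksm g S T (ST : (S `<=` T)%fset) := block_entropy_submod mu g ST.
have [h [hlim hbox]] := subadditive_limit K0 Km Ks Kt.
exists h; split.
- by under eq_fun do rewrite mulrC.
- exact: (le_incr K0 Km Ks Kt Ksm block_entropy_permute hbox).
- move=> g e e0; have [S Sp Se] := past_incr K0 Km Kt hlim e0.
  exists (translate g S); first by move=> s; rewrite mem_translate => /Sp/lexltBr.
  by have := incr_translate Kt g 0 S; rewrite addr0 /incr_entropy => ->.
Qed.

End EntropyRate.

Lemma card_fsetM (K L : choiceType) (S : {fset K}) (T : {fset L}) :
  #|` (S `*` T)%fset| = (#|` S| * #|` T|)%N.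
Proof.
rewrite -[LHS]sum1_size [LHS]big_imfset2 /=; last by move=> [a b] [c d] _ _ /= [-> ->].
under eq_bigr do rewrite sum1_size.
by rewrite big_const_seq count_predT iter_addn_0 mulnC.
Qed.

(** * Convergence of the topological entropy *)

Section LanguageGrowth.

(** On [Y] the map [g] factors through [f], so representatives of the fibres of [f] carry one image
    onto the other. *)
Lemma card_image_kernel (X : Type) (I J : choiceType) (Y : set X) (f : X -> I) (g : X -> J) :
  finite_set (f @` Y) ->
  (forall x y, Y x -> Y y -> f x = f y -> g x = g y) ->
  (#|` fset_set (g @` Y)| <= #|` fset_set (f @` Y)|)%N.
Proof.
move=> finf fg.
have [->|/set0P[x0 Yx0]] := eqVneq Y set0; first by rewrite !image_set0 !fset_set0 !cardfs0.
have /choice[rep repE] : forall i, exists x, (f @` Y) i -> Y x /\ f x = i.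
  move=> i; have [[x Yx fxi]|nYi] := pselect ((f @` Y) i); first by exists x.
  by exists x0.
have repP x : Y x -> Y (rep (f x)) /\ f (rep (f x)) = f x.
  by move=> Yx; apply: repE; exists x.
have -> : g @` Y = (g \o rep) @` (f @` Y).
  apply/seteqP; split=> [_ [x Yx <-]|_ [_ [x Yx <-] <-]].
    have [Yr fr] := repP x Yx.
    by exists (f x); [exists x|exact: fg].
  by exists (rep (f x)) => //; have [] := repP x Yx.
by rewrite fset_set_image//; exact: leq_imfset_card.
Qed.

Variables (R : realType) (A : alphabetType) (Y : set (Zinf -> A)).
Hypothesis Y0 : Y !=set0.
Hypothesis Y_shift : forall v x, Y x -> Y (shift v x).

Let N (S : {fset Zinf}) := #|` fset_set (language Y S)|.

Let finL S : finite_set (language Y S).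
Proof. exact: finite_finset. Qed.

Lemma card_language_gt0 S : (0 < N S)%N.
Proof.
have [y Yy] := Y0; rewrite cardfs_gt0; apply/fset0Pn; exists (restr S y).
by rewrite (in_fset_set (finL S)); apply/mem_set; exists y.
Qed.

(** The logarithm of the number of patterns is monotone, subadditive and translation invariant.
    Existence of the limit matters because [top_entropy] is a [limn], whose value means something
    only under convergence. *)
Lemma language_growth : exists h : R,
  (fun n => #|` folner n|%:R^-1 * ln (N (folner n))%:R : R) @ \oo --> h.
Proof.
pose K S : R := ln (N S)%:R.
have eq_restr (S : {fset Zinf}) (x y : Zinf -> A) : restr S x = restr S y <-> {in S, x =1 y}.
  by rewrite restrP; split=> xy g gS; rewrite xy.
have lnN S T : (N S <= N T)%N -> K S <= K T.
  by move=> ST; rewrite ler_ln ?ler_nat// posrE ltr0n card_language_gt0.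
have K0 : K fset0 = 0.
  rewrite /K (_ : N fset0 = 1%N) ?ln1//; apply/eqP; rewrite eqn_leq card_language_gt0 andbT.
  apply: leq_trans (@card_image_kernel _ _ _ Y (fun=> tt) (restr fset0) _ _) _.
  - exact: finite_finset.
  - by move=> x y _ _ _; apply/eq_restr.
  - by rewrite -(cardfs1 tt) fsubset_leq_card//; apply/fsubsetP => -[]; rewrite inE.
have Km S T : (S `<=` T)%fset -> K S <= K T.
  move=> /fsubsetP ST; apply: lnN; apply: card_image_kernel; first exact: finL.
  move=> x y _ _ /eq_restr xy.
  by apply/eq_restr => g /ST; exact: xy.
have Ks S T : K (S `|` T)%fset <= K S + K T.
  rewrite -lnM ?posrE ?ltr0n ?card_language_gt0// -natrM ler_ln ?posrE ?ltr0n ?muln_gt0 ?card_language_gt0//.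
  rewrite ler_nat; apply: leq_trans (card_image_kernel (f := fun x => (restr S x, restr T x)) _ _) _.
  - exact: finite_finset.
  - move=> x y _ _ [/eq_restr Sxy /eq_restr Txy]; apply/eq_restr => g.
    by rewrite inE => /orP[/Sxy|/Txy].
  - rewrite -[X in (_ <= X)%N]card_fsetM fsubset_leq_card//; apply/fsubsetP => -[u w].
    rewrite in_fset_set; last exact: finite_finset.
    move=> /set_mem[x Yx [<- <-]]; rewrite in_fsetM/= !(in_fset_set (finL _)).
    by rewrite !mem_set//; exists x.
have Kt v S : K (translate v S) = K S.
  rewrite /K; congr (ln _%:R).
  have -> : N S = #|` fset_set ((restr S \o shift v) @` Y)|.
    congr (#|` fset_set _|); apply/seteqP; split=> [_ [x Yx <-]|_ [x Yx <-]].
      exists (shift (- v) x); first exact: Y_shift.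
      by congr restr; apply/funext => g; rewrite /shift -addrA subrr addr0.
    by exists (shift v x); first exact: Y_shift.
  apply/eqP; rewrite eqn_leq; apply/andP; split; apply: card_image_kernel; try exact: finite_finset.
    move=> x y _ _ /eq_restr xy; apply/eq_restr => g; rewrite mem_translate => /xy.
    by rewrite /shift subrK.
  move=> x y _ _ /eq_restr xy; apply/eq_restr => g gS; apply: xy.
  by rewrite mem_translate addrK.
have [h [hlim _]] := subadditive_limit K0 Km Ks Kt.
by exists h; under eq_fun do rewrite mulrC.
Qed.

End LanguageGrowth.

(** * Independence score *)

Lemma ln_prod (R : realType) (I : Type) (s : seq I) (f : I -> R) :
  (forall i, 0 < f i) -> ln (\prod_(i <- s) f i) = \sum_(i <- s) ln (f i).
Proof.
move=> f0; elim: s => [|i s IH]; first by rewrite !big_nil ln1.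
by rewrite !big_cons lnM ?IH// posrE// prodr_gt0.
Qed.

Section LetterChoice.
Variables (R : realType) (A : finType).

Definition lnc (s : hat A) : R := ln #|val s|%:R.

Lemma hat_card_gt0 (s : hat A) : (0 < #|val s|)%N.
Proof. by rewrite card_gt0 (valP s). Qed.

Lemma lnc_ge0 s : 0 <= lnc s.
Proof. by rewrite ln_ge0// ler1n hat_card_gt0. Qed.

Lemma lnc_le s : lnc s <= ln #|A|%:R.
Proof.
have A0 : (0 < #|A|)%N := leq_trans (hat_card_gt0 s) (max_card _).
by rewrite ler_ln ?posrE ?ltr0n ?hat_card_gt0// ler_nat max_card.
Qed.

Definition hpick (s : hat A) : A := xchoose (set0Pn _ (valP s)).

Lemma hpickP s : hpick s \in val s.
Proof. exact: (xchooseP (set0Pn _ (valP s))). Qed.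

Variable G : zmodType.

Lemma score_restr (S : {fset G}) (xh : G -> hat A) :
  score R (restr S xh) = #|` S|%:R^-1 * \sum_(g <- S) lnc (xh g).
Proof.
by rewrite /score big_seq_fsetE /=; congr (_ * _); apply: eq_bigr => g _; rewrite ffunE.
Qed.

Lemma score_restr_le (S : {fset G}) (xh : G -> hat A) (M : R) :
  (0 < #|` S|)%N -> (\sum_(g <- S) lnc (xh g) <= #|` S|%:R * M) -> score R (restr S xh) <= M.
Proof. by move=> S0 le; rewrite score_restr ler_pdivrMl ?ltr0n. Qed.

Lemma sum_const_seq (I : Type) (s : seq I) (M : R) : \sum_(i <- s) M = (size s)%:R * M.
Proof. by rewrite big_const_seq count_predT iter_addr_0 mulr_natl. Qed.

Lemma sum_lnc_le (S : {fset G}) (xh : G -> hat A) :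
  \sum_(g <- S) lnc (xh g) <= #|` S|%:R * ln #|A|%:R.
Proof. by rewrite -sum_const_seq; apply: ler_sum => g _; exact: lnc_le. Qed.

End LetterChoice.

Section CoordinateSum.

(** The sum of all coordinates. A step along any axis changes it by exactly that step, so a sequence
    composed with [csum] has only translates of itself as rows. *)
Definition csum (g : Zinf) : int := \sum_(i < sval (cid (finsupp_bound g))) g i.

Lemma csumE (g : Zinf) (N : nat) : (forall i, (N <= i)%N -> g i = 0) -> csum g = \sum_(i < N) g i.
Proof.
have wid (M K : nat) : (forall i, (M <= i)%N -> g i = 0) -> (M <= K)%N ->
    \sum_(i < K) g i = \sum_(i < M) g i.
  move=> gM MK; rewrite -!(big_mkord predT (fun i => g i)) (big_cat_nat _ MK)//=.
  rewrite [X in _ + X = _](_ : _ = 0) ?addr0//.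
  by rewrite big_nat_cond big1// => i /andP[/andP[/gM]].
move=> gN; rewrite /csum; case: cid => M /= gM.
have [MN|/ltnW NM] := leqP M N; [symmetry|]; exact: wid.
Qed.

Lemma csum_gen g i (m : int) : csum (g + gen i *~ m) = csum g + m.
Proof.
have [N gN] := finsupp_bound g.
have gN' j : (maxn N i.+1 <= j)%N -> g j = 0 by rewrite geq_max => /andP[/gN].
rewrite (csumE gN') (csumE (N := maxn N i.+1)); last first.
  by move=> j jN; rewrite coordD coord_gen gN'//; move: jN; rewrite geq_max => /andP[_ ij]; rewrite gtn_eqF.
under eq_bigr do rewrite coordD coord_gen.
have iN : (i < maxn N i.+1)%N by rewrite leq_max leqnn orbT.
rewrite big_split/=; congr (_ + _).
rewrite (bigD1 (Ordinal iN))//= eqxx big1 ?addr0// => j ji.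
by rewrite ifN//; apply: contra ji => /eqP ji; apply/eqP/val_inj.
Qed.

Lemma csum_folner n g : g \in folner n -> - (n * n)%:Z <= csum g <= (n * n)%:Z.
Proof.
rewrite folnerE => /mem_pbox[g1 g2]; rewrite (csumE g2) -ler_norml.
apply: le_trans (ler_norm_sum _ _ _) _.
apply: (@le_trans _ _ (\sum_(i < n) n%:Z)).
  by apply: ler_sum => i _; rewrite ler_norml -mem_window; exact: g1.
by rewrite sumr_const card_ord PoszM -mulr_natr natz.
Qed.

End CoordinateSum.

Lemma ler_sum_fsubset (R : numDomainType) (I : choiceType) (S T : {fset I}) (f : I -> R) :
  (S `<=` T)%fset -> (forall i, 0 <= f i) -> \sum_(i <- S) f i <= \sum_(i <- T) f i.
Proof.
move=> ST f0; rewrite [X in _ <= X](big_fsetID _ (mem S)) /=.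
have -> : [fset x in T | x \in S]%fset = S.
  by apply/fsetP => i; rewrite !inE/= andbC; case: (boolP (i \in S)) => //= /(fsubsetP ST) ->.
by rewrite lerDl sumr_ge0.
Qed.

Lemma window_shift_sum (R : numDomainType) (M K : nat) (k : int) (f : int -> R) :
  (forall m, 0 <= f m) -> - K%:Z <= k <= K%:Z ->
  \sum_(m <- window M) f m <= \sum_(c <- window (M + K)) f (k + c).
Proof.
move=> f0 kK; apply: (@le_trans _ _ (\sum_(c <- [fset (m - k)%R | m in window M]%fset) f (k + c))).
  rewrite big_imfset/=; last by move=> m l _ _ /addIr.
  by under [X in _ <= X]eq_bigr do rewrite addrC subrK.
apply: ler_sum_fsubset => //; apply/fsubsetP => c /imfsetP[m /=].
by rewrite !mem_window => mM ->; lia.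
Qed.

(** * Independence entropy compared with scores and language on the lattice *)

Section IndependenceEntropy.
Variables (R : realType) (A : alphabetType) (X : set (int -> A)).
Hypothesis X_subshift : subshift X.

Let lncR : hat A -> R := @lnc R A.

Definition window_score (n : nat) : R :=
  sup ((@score _ R A (window n)) @` language (multichoice X) (window n)).

Lemma window_card_gt0 n : (0 < #|` window n|)%N.
Proof. by rewrite card_window. Qed.

Lemma window_score_has_ub n :
  has_ubound ((@score _ R A (window n)) @` language (multichoice X) (window n)).
Proof.
exists (ln #|A|%:R) => _ [_ [xh _ <-] <-].
by apply: score_restr_le; [exact: window_card_gt0|exact: sum_lnc_le].
Qed.

Lemma le_window_score n xh : multichoice X xh ->
  \sum_(m <- window n) lncR (xh m) <= #|` window n|%:R * window_score n.
Proof.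
move=> Xxh; rewrite -ler_pdivrMl ?ltr0n ?window_card_gt0// -score_restr.
apply: ub_le_sup; first exact: window_score_has_ub.
by exists (restr (window n) xh) => //; exists xh.
Qed.

(** A choice [y] along one row extends to a choice on the whole lattice by picking arbitrary letters
    elsewhere; the row of that extension lies in [X]. The test in [z] recognizes the sites of the
    row. *)
Lemma multichoice_row xh g i : multichoice (axial_power X) xh ->
  multichoice X (fun m => xh (g + gen i *~ m)).
Proof.
move=> Yxh y yxh.
pose z h := if h - g == gen i *~ (h i - g i) then y (h i - g i) else hpick (xh h).
have zy m : z (g + gen i *~ m) = y m.
  rewrite /z coordD coord_gen eqxx.
  have -> : g i + m - g i = m by rewrite addrC addKr.
  by rewrite [g + _]addrC addrK eqxx.
have /Yxh/(_ g i) : forall h, z h \in val (xh h).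
  move=> h; rewrite /z; case: eqP => [e|_]; last exact: hpickP.
  by have := yxh (h i - g i); rewrite -e [g + _]addrC subrK.
by congr X; apply/funext => m; exact: zy.
Qed.

(** The box is a disjoint union of rows in its last direction, each of them a window of a
    multi-choice configuration of [X]. The successor ensures that there is a direction to slice
    along. *)
Lemma folner_score_le n xh : multichoice (axial_power X) xh ->
  score R (restr (folner n.+1) xh) <= window_score n.+1.
Proof.
move=> Yxh; rewrite folnerE; apply: score_restr_le; first by rewrite card_box expn_gt0.
rewrite [X in X <= _]sum_pboxS.
apply: (@le_trans _ _ (\sum_(h <- pbox (fun=> window n.+1) n) (#|` window n.+1|%:R * window_score n.+1))).
  by apply: ler_sum => h _; exact: (le_window_score n.+1 (@multichoice_row xh h n Yxh)).
by rewrite sum_const_seq mulrA -natrM !card_pbox big_ord_recr.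
Qed.

(* Spreading xh along the sum of the coordinates shows h_ind X <= h (axial_power X). *)
Lemma multichoice_diagonal xh c : multichoice X xh ->
  multichoice (axial_power X) (fun g => xh (csum g + c)).
Proof.
move=> Xxh z zxh g i; have [_ Xshift] := X_subshift.
pose k := csum g + c.
have /Xxh/(Xshift k) : forall m, z (g + gen i *~ (m - k)) \in val (xh m).
  by move=> m; have := zxh (g + gen i *~ (m - k)); rewrite csum_gen (_ : _ + c = m)//; rewrite /k; ring.
by congr X; apply/funext => m; rewrite /shift addrK.
Qed.

(** Averaging over the offset [c]: for each [g] in the box [|csum g| <= n * n], so as [c] runs
    through [window (M + n * n)] the site reads all of [window M]. Some offset does at least as well
    as the average. *)
Lemma diagonal_score n M xh : multichoice X xh -> exists2 yh,
  multichoice (axial_power X) yh &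
  \sum_(m <- window M) lncR (xh m) <=
  #|` window (M + n * n)|%:R * score R (restr (folner n) yh).
Proof.
move=> Xxh; set sM := \sum_(m <- _) _.
pose y c := fun g => xh (csum g + c).
have F0 : 0 < #|` folner n|%:R :> R by rewrite ltr0n folnerE card_box expn_gt0.
have [c cP] : exists c, #|` folner n|%:R * sM <=
    #|` window (M + n * n)|%:R * \sum_(g <- folner n) lncR (y c g).
  apply: contrapT => /forallNP nc.
  pose W := #|` window (M + n * n)|%:R : R.
  have W0 : 0 < W by rewrite ltr0n window_card_gt0.
  have lt c : \sum_(g <- folner n) lncR (y c g) < W^-1 * (#|` folner n|%:R * sM).
    by rewrite ltr_pdivlMl// ltNge; exact/negP/nc.
  have : \sum_(c <- window (M + n * n)) \sum_(g <- folner n) lncR (y c g) < #|` folner n|%:R * sM.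
    have -> : #|` folner n|%:R * sM = \sum_(c <- window (M + n * n)) W^-1 * (#|` folner n|%:R * sM).
      by rewrite sum_const_seq mulrA divff ?mul1r// gt_eqF.
    apply: ltr_sum => //.
    by apply/hasP; exists 0 => //; rewrite mem_window; lia.
  apply/negP; rewrite -leNgt exchange_big/= -sum_const_seq big_seq [X in _ <= X]big_seq.
  apply: ler_sum => g /csum_folner gn.
  by apply: window_shift_sum => // m; exact: lnc_ge0.
exists (y c); first exact: multichoice_diagonal.
rewrite score_restr mulrCA ler_pdivlMl//.
Qed.

Hypothesis X_choice : exists xh, multichoice X xh.

(** Enlarging the window by [k] on both sides adds [2 k] sites, an excess of at most
    [2 k t / (M + 1)] after normalization. *)
Lemma window_score_bound (t : R) k : 0 <= t ->
  (forall M xh, multichoice X xh ->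
    \sum_(m <- window M) lncR (xh m) <= #|` window (M + k)|%:R * t) ->
  forall e, 0 < e -> \forall M \near \oo, window_score M <= t + e.
Proof.
move=> t0 tM e e0.
have le M : window_score M <= t + (2 * k)%:R * t * @harmonic R M.
  apply: ge_sup; first by have [xh Xxh] := X_choice; exists (score R (restr (window M) xh)), (restr (window M) xh) => //; exists xh.
  move=> _ [_ [xh Xxh <-] <-]; apply: score_restr_le; first exact: window_card_gt0.
  apply: le_trans (tM M xh Xxh) _; rewrite !card_window.
  have hM : 1 <= M.*2.+1%:R * @harmonic R M.
    by rewrite /harmonic /= mulrC ler_pdivlMl ?ltr0n// mulr1 ler_nat -mul2n; lia.
  have -> : (M + k).*2.+1%:R = M.*2.+1%:R + (2 * k)%:R :> R by rewrite -natrD; congr _%:R; lia.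
  rewrite mulrDl mulrDr lerD2l.
  have -> : M.*2.+1%:R * ((2 * k)%:R * t * @harmonic R M) =
    ((2 * k)%:R * t) * (M.*2.+1%:R * @harmonic R M) by ring.
  by rewrite ler_peMr// mulr_ge0.
near=> M; apply: le_trans (le M) _; rewrite lerD2l.
near: M; apply: (cvgr_le ((2 * k)%:R * t * 0)); last by rewrite mulr0.
by apply: cvgMr; exact: cvg_harmonic.
Unshelve. all: by end_near.
Qed.

Lemma window_score_ge0 n : 0 <= window_score n.
Proof.
have [xh Xxh] := X_choice; have := le_window_score n Xxh.
move=> /(le_trans (sumr_ge0 _ (fun m _ => lnc_ge0 R (xh m)))).
by rewrite pmulr_rge0// ltr0n window_card_gt0.
Qed.

(** A detour through the lattice: spreading a sequence diagonally over a fixed box and slicing that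
    box into rows bounds all late window scores by any fixed one, up to [e]. The scores therefore
    converge to their infimum. *)
Lemma cvg_window_score : window_score @ \oo --> h_ind R X.
Proof.
suff [h wh] : exists h : R, window_score @ \oo --> h.
  by rewrite (_ : h_ind R X = h)//; apply: cvg_lim.
pose I := range (fun n => window_score n.+1).
have hiI : has_inf I.
  by split; [exists (window_score 1), 0%N|exists 0 => _ [n _ <-]; exact: window_score_ge0].
exists (inf I); apply/cvgrPdist_le => e e0.
have [_ [n _ <-] nI] := inf_adherent (divr_gt0 e0 (ltr0n _ 2)) hiI.
have : \forall M \near \oo, window_score M <= window_score n.+1 + e / 2.
  apply: (@window_score_bound _ (n.+1 * n.+1)) => //; first exact: window_score_ge0.
    move=> M xh /(diagonal_score n.+1 M)[yh Yyh]; move=> /le_trans; apply.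
    by rewrite ler_pM2l ?ltr0n ?window_card_gt0// folner_score_le.
  by rewrite divr_gt0.
move=> nb; near=> M.
have M0 : (0 < M)%N by near: M; exact: nbhs_infty_gt.
have IM : inf I <= window_score M by apply: ge_inf; [exact: hiI.2|exists M.-1; rewrite ?prednK].
have : window_score M <= window_score n.+1 + e / 2 by near: M.
by rewrite ler_norml; lra.
Unshelve. all: by end_near.
Qed.

(** Each of the choices that [xh] allows on the box extends to a point of the axial power, so their
    number, a product of cardinals, bounds the language from below. *)
Lemma score_le_language n xh : multichoice (axial_power X) xh ->
  score R (restr (folner n) xh) <=
  #|` folner n|%:R^-1 * ln #|` fset_set (language (axial_power X) (folner n))|%:R.
Proof.
move=> Yxh; set S := folner n; rewrite score_restr ler_wpM2l ?invr_ge0//.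
pose F (g : S) : {set A} := val (xh (val g)).
have -> : \sum_(g <- S) lnc R (xh g) = ln (\prod_(g : S) #|F g|)%:R.
  rewrite big_seq_fsetE /= natr_prod ln_prod// => g.
  by rewrite ltr0n hat_card_gt0.
have F0 : (0 < \prod_(g : S) #|F g|)%N by apply: prodn_gt0 => g; exact: hat_card_gt0.
suff le : (\prod_(g : S) #|F g| <= #|` fset_set (language (axial_power X) S)|)%N.
  by rewrite ler_ln ?posrE ?ltr0n ?ler_nat// (leq_trans F0).
have -> : (\prod_(g : S) #|F g|)%N = #|(family (fun g => mem (F g)) : simpl_pred {ffun S -> A})|.
  by rewrite card_family foldrE big_image.
rewrite cardE; apply: uniq_leq_size; first exact: enum_uniq.
move=> w; rewrite mem_enum => /familyP wF.
rewrite in_fset_set; last exact: finite_finset.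
pose z g := if insub g is Some g' then w g' else hpick (xh g).
apply/mem_set; exists z; last by apply/ffunP => g; rewrite ffunE /z valK.
by apply: Yxh => g; rewrite /z; case: insubP => [g' _ <-|_]; [exact: wF|exact: hpickP].
Qed.

(** The bound holds in every box, being obtained with [n] fixed while the window grows, so it passes
    to the topological entropy. *)
Lemma h_ind_le_language n :
  h_ind R X <= #|` folner n|%:R^-1 * ln #|` fset_set (language (axial_power X) (folner n))|%:R.
Proof.
have [xh0 Xxh0] := X_choice.
set t := _ * _; have t0 : 0 <= t.
  apply: le_trans (score_le_language n (@multichoice_diagonal _ 0 Xxh0)).
  by rewrite score_restr mulr_ge0 ?invr_ge0// sumr_ge0// => g _; exact: lnc_ge0.
apply/ler_addgt0Pr => e e0; apply: (cvgr_to_le cvg_window_score).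
apply: (@window_score_bound _ (n * n)) => // M xh /(diagonal_score n M)[yh Yyh].
move=> /le_trans; apply.
by rewrite ler_pM2l ?ltr0n ?window_card_gt0// score_le_language.
Qed.

End IndependenceEntropy.

(** * Conditional probabilities at a site *)

Section FinProb.
Context d (T : measurableType d) (R : realType) (mu : probability T R).

Lemma pr_setU E F : measurable E -> measurable F -> pr mu (E `|` F) <= pr mu E + pr mu F.
Proof.
move=> mE mF; rewrite -lee_fin EFinD -!prE//; last exact: measurableU.
exact: measureU2.
Qed.

Lemma pr_setD E F : measurable E -> measurable F -> F `<=` E -> pr mu (E `\` F) = pr mu E - pr mu F.
Proof.
move=> mE mF FE; apply: EFin_inj; rewrite EFinB -!prE//; last exact: measurableD.
by rewrite measureD// ?setIidr// (le_lt_trans (probability_le1 mu mE))// ltry.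
Qed.

End FinProb.

Section Density.
Variables (R : realType) (J : choiceType) (A : pointedType).
Hypothesis cJ : countable [set: J].
Variable nu : probability (borel J A) R.

(** The approximable events form a Dynkin class. A countable union is truncated by continuity of the
    measure, and its finitely many pieces are approximated with errors halved at each stage. *)
Lemma fin_det_dense (E : set (borel J A)) (e : R) : measurable E -> 0 < e ->
  exists C : set (borel J A), [/\ fin_det C, pr nu (E `\` C) < e & pr nu (C `\` E) < e].
Proof.
move=> mE e0; move: E mE e e0.
apply: (borel_dynkin_ind cJ) => [C dC|C mC IH|F mF tF IH] e e0.
- by exists C; split=> //; rewrite setDv pr_set0.
- have [D [dD CD DC]] := IH e e0; exists (~` D).
  have setDCC (B B' : set (J -> A)) : ~` B `\` ~` B' = B' `\` B by rewrite !setDE setCK setIC.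
  by split; [exact: fin_detC|rewrite setDCC|rewrite setDCC].
have mU : measurable (\bigcup_n F n : set (borel J A)) by exact: bigcupT_measurable.
pose P n := \big[setU/set0]_(i < n) F i.
have mP n : measurable (P n : set (borel J A)) by apply: bigsetU_measurable.
have PU n : P n `<=` \bigcup_n F n by rewrite /P -bigcup_mkord => x [i _ Fx]; exists i.
have e2 : 0 < e / 2 by rewrite divr_gt0.
have [n nP] : exists n, pr nu (\bigcup_n F n `\` P n) < e / 2.
  have : (pr nu \o (P \o S)) @ \oo --> pr nu (\bigcup_n F n).
    apply: fine_cvg; rewrite -/(pr _ _) -prE// -bigcup_bigsetU_bigcup.
    apply: (@nondecreasing_cvg_mu _ _ _ nu (P \o S)) => [n|| ].
    - exact: mP.
    - by apply: bigcupT_measurable => n; exact: mP.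
    - by move=> a b ab; exact/subsetPset/subset_bigsetU.
  move=> /cvgrPdist_lt/(_ _ e2)[n _ /(_ n (leqnn n))] /= h.
  exists n.+1; rewrite pr_setD//; exact: le_lt_trans (ler_norm _) h.
have [C [dC PC CP]] : exists C : set (borel J A),
    [/\ fin_det C, pr nu (P n `\` C) < e / 2 & pr nu (C `\` P n) < e / 2].
  rewrite /P; elim: n {nP} (e / 2) e2 => [|n IHn] d d0.
    by exists set0; split; rewrite ?big_ord0 ?set0D ?pr_set0//; exact: fin_det0.
  have d2 : 0 < d / 2 by rewrite divr_gt0.
  have [C [dC nC Cn]] := IHn _ d2; have [D [dD FD DF]] := IH n _ d2.
  have mC : measurable (C : set (borel J A)) by exact: fin_det_measurable.
  have mD : measurable (D : set (borel J A)) by exact: fin_det_measurable.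
  have mPn := mP n.
  exists (C `|` D); rewrite big_ord_recr /= -/(P n); split; first exact: fin_detU.
  - apply: (@le_lt_trans _ _ (pr nu (P n `\` C) + pr nu (F n `\` D))); last by rewrite (splitr d) ltrD.
    apply: le_trans (pr_setU _ _ _); [|exact: measurableD..].
    apply: le_pr; [|by apply: measurableU; exact: measurableD|].
      by apply: measurableD; exact: measurableU.
    by move=> x [[Px|Fx] /not_orP[nCx nDx]]; [left|right].
  - apply: (@le_lt_trans _ _ (pr nu (C `\` P n) + pr nu (D `\` F n))); last by rewrite (splitr d) ltrD.
    apply: le_trans (pr_setU _ _ _); [|exact: measurableD..].
    apply: le_pr; [|by apply: measurableU; exact: measurableD|].
      by apply: measurableD; exact: measurableU.
    by move=> x [[Px|Fx] /not_orP[nCx nDx]]; [left|right].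
have mC : measurable (C : set (borel J A)) by exact: fin_det_measurable.
exists C; split=> //; last first.
  apply: le_lt_trans (lt_trans CP _); last by rewrite gtr_pMr// invf_lt1// ltr1n.
  by apply: le_pr; [exact: measurableD..|move=> x [Cx nU]; split=> // /PU].
apply: (@le_lt_trans _ _ (pr nu (\bigcup_n F n `\` P n) + pr nu (P n `\` C))).
  apply: le_trans (pr_setU _ _ _); [|exact: measurableD..].
  apply: le_pr; [exact: measurableD|by apply: measurableU; exact: measurableD|].
  by move=> x [Ux nCx]; have [Px|nPx] := pselect (P n x); [right|left].
by rewrite (splitr e) ltrD.
Qed.

End Density.

Section ConditionalProbability.
Variables (R : realType) (A : alphabetType) (mu : probability (borel Zinf A) R).
Variables (g : Zinf).

Let J := {h : Zinf | h != g}.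
Let nu := distribution mu (@off A g).

Lemma countable_off : countable [set: J].
Proof.
apply/countable_injP; have /countable_injP[f finj] := countable_Zinf.
exists (f \o val) => x y _ _ /= /finj => /(_ (in_setT _) (in_setT _)) xy.
by apply: eq_sig_hprop xy => h p q; exact: bool_irrelevance.
Qed.

Lemma site_law_dominated a : charge_of_finite_measure (@site_law R A mu g a) `<< nu.
Proof.
apply/null_content_dominatesP => E mE /= nuE0.
apply/eqP; rewrite eq_le measure_ge0 andbT -nuE0.
apply: le_measure; rewrite ?inE; [exact: measurable_off_site| |exact: subIsetl].
by rewrite -[X in measurable X]setTI; exact: measurable_off.
Qed.

Let rn a : borel J A -> \bar R := Radon_Nikodym (charge_of_finite_measure (@site_law R A mu g a)) nu.

Definition Pc (a : A) (x : borel Zinf A) : R := fine (cond_prob mu g a x).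

Lemma PcE a x : cond_prob mu g a x = (Pc a x)%:E.
Proof. by rewrite fineK// Radon_Nikodym_fin_num//; exact: site_law_dominated. Qed.

Let irn a : nu.-integrable setT (rn a).
Proof. exact/Radon_Nikodym_integrable/site_law_dominated. Qed.

(** Exhibits [Pc] as a function of the configuration off [g], so that its level sets are legitimate
    test events for conditioning. *)
Definition Pc_off a (u : borel J A) : R := fine (rn a u).

Lemma measurable_Pc_off a : measurable_fun setT (Pc_off a).
Proof.
have /integrableP[mrn _] := irn a.
by apply/measurable_EFinP; rewrite (_ : EFin \o _ = rn a)//; apply/funext => u /=;
  rewrite fineK// Radon_Nikodym_fin_num//; exact: site_law_dominated.
Qed.

Lemma Pc_offE a x : Pc a x = Pc_off a (@off A g x).
Proof. by []. Qed.

Lemma measurable_Pc a : measurable_fun setT (Pc a).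
Proof. exact: (measurableT_comp (measurable_Pc_off a) (@measurable_off A g)). Qed.

Lemma integrable_Pc a : mu.-integrable setT (EFin \o Pc a).
Proof.
apply/integrableP; split; first by apply/measurable_EFinP; exact: measurable_Pc.
have /integrableP[mrn] := irn a.
rewrite ge0_integral_distribution//; last first.
  by apply: (@measurableT_comp _ _ _ _ _ _ abse _ (rn a)) => //; exact: abse_measurable.
congr (_ < _)%E; apply: eq_integral => x _; by rewrite /comp -PcE.
Qed.

Lemma Rintegral_Pc a (E : set (borel J A)) : measurable E ->
  \int[mu]_x (Pc a x * \1_(@off A g @^-1` E) x) =
  pr mu (@off A g @^-1` E `&` [set x | x g = a]).
Proof.
move=> mE; rewrite /pr -[mu _]/(charge_of_finite_measure (@site_law R A mu g a) E).
rewrite (Radon_Nikodym_integral (site_law_dominated a) mE).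
have mE' : measurable (@off A g @^-1` E).
  by rewrite -[X in measurable X]setTI; exact: measurable_off.
rewrite (integral_pushforward (measurable_off (g := g)) _ _ mE); first last.
- apply: (integrableS measurableT) => //.
  by have := integrable_Pc a; congr (_.-integrable _ _); apply/funext => x; rewrite /= -PcE.
- by have /integrableP[] := irn a.
rewrite /Rintegral [in RHS]integral_mkcond; congr fine; apply: eq_integral => x _.
rewrite patchE indicE; case: ifP => _; rewrite ?mulr1 ?mulr0//.
exact: esym (PcE a x).
Qed.

End ConditionalProbability.

Section Expectation.
Context d (T : measurableType d) (R : realType) (mu : probability T R).
Implicit Types (f : T -> R).

Lemma integrable_mul_indic f E : measurable E -> mu.-integrable setT (EFin \o f) ->
  mu.-integrable setT (EFin \o (fun t => f t * \1_E t)).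
Proof.
move=> mE intf; rewrite (_ : EFin \o _ = (EFin \o f) \_ E).
  by rewrite -integrable_mkcond//; exact: integrableS intf.
by apply/funext => t; rewrite patchE /= indicE; case: ifP => _; rewrite ?mulr1 ?mulr0.
Qed.

Lemma integrable_norm f : mu.-integrable setT (EFin \o f) ->
  mu.-integrable setT (EFin \o (fun t => `|f t|)).
Proof. exact: integrable_norm. Qed.

Lemma integrable_sub f1 f2 : mu.-integrable setT (EFin \o f1) -> mu.-integrable setT (EFin \o f2) ->
  mu.-integrable setT (EFin \o (fun t => f1 t - f2 t)).
Proof. by move=> i1 i2; exact: (integrableB measurableT i1 i2). Qed.

Lemma integrable_add f1 f2 : mu.-integrable setT (EFin \o f1) -> mu.-integrable setT (EFin \o f2) ->
  mu.-integrable setT (EFin \o (fun t => f1 t + f2 t)).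
Proof. by move=> i1 i2; exact: (integrableD measurableT i1 i2). Qed.

(* [0 <= f <= 1] makes [E |-> int_E f] 1-Lipschitz for the measure of symmetric differences. *)
Lemma Rintegral_indic_near f E C : measurable E -> measurable C -> measurable_fun setT f ->
  (forall t, 0 <= f t <= 1) ->
  `|\int[mu]_t (f t * \1_E t) - \int[mu]_t (f t * \1_C t)| <= pr mu (E `\` C) + pr mu (C `\` E).
Proof.
move=> mE mC mf f01.
have intf : mu.-integrable setT (EFin \o f).
  by apply: (@bounded_integrable _ _ _ mu _ 1) => // t; have /andP[? ?] := f01 t; rewrite ger0_norm.
have iE := integrable_mul_indic mE intf; have iC := integrable_mul_indic mC intf.
have mEC : measurable (E `\` C) by exact: measurableD.
have mCE : measurable (C `\` E) by exact: measurableD.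
rewrite -RintegralB//; apply: le_trans (le_normr_Rintegral _ _) _ => //; first exact: integrable_sub.
rewrite -!Rintegral_indic// -RintegralD//; [|exact: integrable_indic..].
apply: le_Rintegral => //.
- exact/integrable_norm/integrable_sub.
- by apply: integrable_add; exact: integrable_indic.
move=> t _; have /andP[f0 f1] := f01 t; rewrite !indicE !in_setD.
by case: (t \in E); case: (t \in C) => /=; rewrite ?mulr1 ?mulr0 ?subrr ?subr0 ?sub0r ?normrN ?normr0 ?addr0 ?add0r// ger0_norm.
Qed.

End Expectation.

Lemma near_triangle (R : realFieldType) (p q r s d1 d2 b e : R) :
  `|p - q| <= d1 + d2 -> `|r - s| <= d1 + d2 -> `|q - s| <= b ->
  d1 < e / 4 -> d2 < e / 4 -> `|p - r| <= b + e.
Proof. by rewrite !ler_norml => /andP[? ?] /andP[? ?] /andP[? ?] ? ?; apply/andP; split; lra. Qed.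

(** * Conditional probabilities approximated by finite contexts *)

Section Approximation.
Variables (R : realType) (A : alphabetType) (mu : probability (borel Zinf A) R).
Implicit Types (S T U : {fset Zinf}) (g : Zinf) (a : A).

Lemma measurable_fun_cp S g a : measurable_fun setT (cp mu S g a : borel Zinf A -> R).
Proof.
pose G w := pr mu ([set y | restr S y = w] `&` [set y | y g = a]) / pr mu [set y | restr S y = w].
rewrite (_ : cp mu S g a = G \o restr S).
  by apply: measurable_fun_finite_valued; exact: measurable_restr.
by apply/funext => x; rewrite /cp cylinderE.
Qed.

Lemma cp01 S g a x : 0 <= cp mu S g a x <= 1.
Proof. by rewrite cp_ge0 cp_le1. Qed.

Lemma integrable_cp S g a : mu.-integrable setT (EFin \o (cp mu S g a)).
Proof.
apply: (@bounded_integrable _ _ _ mu _ 1); first exact: measurable_fun_cp.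
by move=> x; rewrite ger0_norm ?cp_ge0// cp_le1.
Qed.

Let mcoord (g : Zinf) a : measurable ([set x | x g = a] : set (borel Zinf A)) := measurable_coord g a.

(** [cp mu U g a] is the conditional expectation of the indicator of [x g = a] given the pattern on
    [U]. The value 0 on null patterns is harmless since the indicator has no mass there either. *)
Lemma Rintegral_cp_fun U g a (F : {ffun U -> A} -> R) :
  \int[mu]_x (cp mu U g a x * F (restr U x)) =
  \int[mu]_x (\1_[set x | x g = a] x * F (restr U x)).
Proof.
have mw := @measurable_restr A U.
have mwa w : measurable ([set y | restr U y = w] `&` [set y | y g = a] : set (borel Zinf A)).
  exact: measurableI.
pose p w := pr mu ([set y | restr U y = w] `&` [set y | y g = a]).
pose G w := p w / pr mu [set y | restr U y = w] * F w.
transitivity (\int[mu]_x G (restr U x)).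
  by apply: eq_Rintegral => x _; rewrite /G /p /cp cylinderE.
have iF w : mu.-integrable setT (EFin \o fun x =>
    F w * \1_([set y | restr U y = w] `&` [set y | y g = a]) x).
  rewrite (_ : EFin \o _ = fun x => ((F w)%:E * (\1_([set y | restr U y = w] `&` [set y | y g = a]) x)%:E)%E)//.
  by apply: integrableZl => //; exact: integrable_indic.
rewrite (Rintegral_finite_valued mu G mw).
transitivity (\int[mu]_x \sum_w F w * \1_([set y | restr U y = w] `&` [set y | y g = a]) x).
  rewrite Rintegral_sum//; apply: eq_bigr => w _.
  rewrite RintegralZl//; last exact: integrable_indic.
  rewrite Rintegral_indic// -/(p w) /G.
  have [z|nz] := eqVneq (pr mu [set y | restr U y = w]) 0; last by rewrite mulrA mulrCA divff// mulr1 mulrC.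
  rewrite z mul0r (_ : p w = 0) ?mulr0//; apply/eqP; rewrite eq_le pr_ge0 andbT -z.
  by apply: le_pr => //; exact: subIsetl.
apply: eq_Rintegral => x _; rewrite (bigD1 (restr U x))//= big1 ?addr0.
  by rewrite mulrC indicI /= [\1_[set y | restr U y = _] x]indicE mem_set// mul1r.
move=> w wx; rewrite indicI /= [\1_[set y | restr U y = _] x]indicE memNset ?mul0r ?mulr0//.
by move=> /= xw; rewrite xw eqxx in wx.
Qed.

Lemma Rintegral_cp U g a (C : set (borel Zinf A)) : det_by U C ->
  \int[mu]_x (cp mu U g a x * \1_C x) = pr mu (C `&` [set x | x g = a]).
Proof.
move=> UC; have mC : measurable C by apply: fin_det_measurable; exists U.
have mCa : measurable (C `&` [set x | x g = a]) by exact: measurableI.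
pose C' : set {ffun U -> A} := restr U @` C.
have CC' x : (x \in C) = (restr U x \in C').
  apply/idP/idP => /set_mem; first by move=> Cx; apply/mem_set; exists x.
  move=> [y Cy /restrP xy]; apply/mem_set; apply: UC Cy => k kU.
  by rewrite (xy k kU).
transitivity (\int[mu]_x (cp mu U g a x * \1_C' (restr U x))).
  by apply: eq_Rintegral => x _; rewrite !indicE CC'.
rewrite Rintegral_cp_fun -Rintegral_indic//.
by apply: eq_Rintegral => x _; rewrite setIC indicI /= [\1_C x]indicE CC'.
Qed.

(** [entropy_gap] bounds the mean square by [4 t ^+ 2], and [|u| <= u ^+ 2 / (2 t) + t / 2] turns it
    into a mean: [2 t + t / 2 = 5 / 2 * t]. *)
Lemma cp_close S T g a (t : R) : (S `<=` T)%fset -> 0 < t ->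
  incr_entropy mu g S - incr_entropy mu g T <= t ^+ 2 ->
  \int[mu]_x `|cp mu T g a x - cp mu S g a x| <= 5 / 2 * t.
Proof.
move=> ST t0 gap; have := le_trans (entropy_gap mu g ST) gap.
set I2 := \int[mu]_x _ => I2t.
pose f x := \sum_b (cp mu T g b x - cp mu S g b x) ^+ 2.
have f0 x : 0 <= f x by apply: sumr_ge0 => b _; exact: sqr_ge0.
have intf : mu.-integrable setT (EFin \o f).
  apply: (@bounded_integrable _ _ _ mu _ (\sum_(b : A) 1)).
    apply: measurable_sum => b; apply: measurable_funX.
    by apply: measurable_funB; exact: measurable_fun_cp.
  move=> x; rewrite ger0_norm//; apply: ler_sum => b _.
  by have /andP[] := cp01 T g b x; have /andP[] := cp01 S g b x; nra.
have : \int[mu]_x `|cp mu T g a x - cp mu S g a x| <= \int[mu]_x ((2 * t)^-1 * f x + t / 2).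
  apply: le_Rintegral => //.
  - by apply/integrable_norm/integrable_sub; exact: integrable_cp.
  - apply: integrable_add; last exact: finite_measure_integrable_cst.
    rewrite (_ : EFin \o _ = fun x => ((2 * t)^-1%:E * (f x)%:E)%E)//.
    exact: integrableZl.
  move=> x _; set u := _ - _.
  have uf : u ^+ 2 <= f x by rewrite /f (bigD1 a)//= lerDl sumr_ge0// => b _; exact: sqr_ge0.
  apply: (@le_trans _ _ ((2 * t)^-1 * u ^+ 2 + t / 2)); last first.
    by rewrite lerD2r ler_wpM2l// invr_ge0 mulr_ge0// ltW.
  rewrite -[u ^+ 2]real_normK ?num_real//; set v := `|u|.
  have -> : (2 * t)^-1 * v ^+ 2 + t / 2 = v + (v - t) ^+ 2 / (2 * t) by field; rewrite gt_eqF.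
  by rewrite lerDl divr_ge0 ?sqr_ge0// mulr_ge0// ltW.
move=> /le_trans; apply.
rewrite RintegralD//; last 2 first.
- rewrite (_ : EFin \o _ = fun x => ((2 * t)^-1%:E * (f x)%:E)%E)//.
  exact: integrableZl.
- exact: finite_measure_integrable_cst.
have -> : \int[mu]_x ((2 * t)^-1 * f x) = (2 * t)^-1 * I2 by rewrite RintegralZl.
have -> : \int[mu]_(x in setT) (t / 2) = t / 2.
  by have := @Rintegral_cst _ _ _ mu setT measurableT (t / 2); rewrite -/(pr mu setT) pr_setT mulr1.
have -> : 5 / 2 * t = (2 * t)^-1 * (4 * t ^+ 2) + t / 2 by field; rewrite gt_eqF.
have t20 : 0 <= (2 * t)^-1 by rewrite invr_ge0 mulr_ge0// ltW.
by rewrite lerD2r ler_wpM2l//; move: I2t; lra.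
Qed.

Variable h : R.
Hypothesis le_h : forall g S, g \notin S -> h <= incr_entropy mu g S.

(** Over an event determined by a context [U], both [Pc] and [cp mu U g a] integrate to the mass of
    the event with [x g = a]. The distance from [cp mu U g a] to [cp mu S g a] is at most
    [5 / 2 * t] whatever [U] is, so the bound survives approximation of [E] by such events. *)
Lemma cp_approx_event S g a (t : R) (E : set (borel {k : Zinf | k != g} A)) :
  g \notin S -> 0 < t -> incr_entropy mu g S <= h + t ^+ 2 -> measurable E ->
  `|\int[mu]_x ((cp mu S g a x - Pc mu g a x) * \1_(@off A g @^-1` E) x)| <= 5 / 2 * t.
Proof.
move=> gS t0 St mE; pose o (C : set (borel {k : Zinf | k != g} A)) := @off A g @^-1` C.
have mo C : measurable C -> measurable (o C).
  by move=> mC; rewrite -[X in measurable X]setTI; exact: measurable_off.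
have icp S' C : measurable C -> mu.-integrable setT (EFin \o (fun x => cp mu S' g a x * \1_(o C) x)).
  by move=> mC; apply: integrable_mul_indic; [exact: mo|exact: integrable_cp].
under eq_Rintegral do rewrite mulrBl.
rewrite (RintegralB _ (icp _ _ mE))//; last first.
  by apply: integrable_mul_indic; [exact: mo|exact: integrable_Pc].
rewrite Rintegral_Pc//; apply/ler_addgt0Pr => e e0.
have e4 : 0 < e / 4 by rewrite divr_gt0.
have [C [dC EC CE]] := @fin_det_dense R _ A (@countable_off g) (distribution mu (@off A g)) E _ mE e4.
have mC : measurable C by exact: fin_det_measurable.
have near1 := @Rintegral_indic_near _ _ _ mu _ _ _ (mo _ mE) (mo _ mC) (@measurable_fun_cp S g a) (cp01 S g a).
pose ia x : R := \1_[set x : borel Zinf A | x g = a] x.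
have mia : measurable_fun setT ia by exact: measurable_indic.
have ia01 x : 0 <= ia x <= 1 by rewrite /ia indicE; case: (_ \in _); rewrite /= ler01 lexx.
have near2 := @Rintegral_indic_near _ _ _ mu _ _ _ (mo _ mE) (mo _ mC) mia ia01.
have iaE D : measurable D -> \int[mu]_x (ia x * \1_(o D) x) = pr mu (o D `&` [set x | x g = a]).
  move=> mD; rewrite -Rintegral_indic; last by apply: measurableI; [exact: mo|exact: mcoord].
  by apply: eq_Rintegral => x _; rewrite indicI mulrC.
rewrite !iaE// in near2.
have CS : `|\int[mu]_x (cp mu S g a x * \1_(o C) x) - pr mu (o C `&` [set x | x g = a])| <= 5 / 2 * t.
  have [T TC] := dC.
  pose U := (S `|` [fset k in map val T])%fset.
  have gU : g \notin U.
    rewrite inE negb_or gS /=; rewrite inE; apply/mapP => -[[k kg] _ /= gk].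
    by rewrite gk eqxx in kg.
  have UC : det_by U (o C).
    move=> x y xy; apply: TC => k kT; apply: xy; rewrite !inE; apply/orP; right.
    by apply/mapP; exists k.
  have SU : (S `<=` U)%fset by exact: fsubsetUl.
  have gap : incr_entropy mu g S - incr_entropy mu g U <= t ^+ 2.
    by have := le_h gU; move: St; lra.
  rewrite -(Rintegral_cp _ _ UC) -(RintegralB _ (icp _ _ mC) (icp _ _ mC))//.
  apply: le_trans (le_normr_Rintegral _ _) _ => //.
    by apply: integrable_sub; exact: icp.
  apply: le_trans (cp_close a SU t0 gap).
  apply: le_Rintegral => //.
  - by apply: integrable_norm; apply: integrable_sub; exact: icp.
  - by apply: integrable_norm; apply: integrable_sub; exact: integrable_cp.
  by move=> x _; rewrite -mulrBl normrM distrC ler_piMr// indicE; case: (_ \in _); rewrite ?normr1 ?normr0.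
exact: (near_triangle near1 near2 CS EC CE).
Qed.

(* The context S is enlarged until it approximates events of the full complement of g;
   by [entropy_gap] this barely changes [cp] since the increments are at least h. *)
Lemma cp_approx S g a (t : R) :
  g \notin S -> 0 < t -> incr_entropy mu g S <= h + t ^+ 2 ->
  \int[mu]_x `|cp mu S g a x - Pc mu g a x| <= 5 * t.
Proof.
move=> gS t0 St.
(* Completes a configuration off [g] by an arbitrary letter at [g]. As [S] avoids [g], this makes
   [cp mu S g a] a function of the configuration off [g]. *)
pose ext (u : borel {k : Zinf | k != g} A) : Zinf -> A :=
  fun k => if insub k is Some k' then u k' else point.
have extoff x : restr S (ext (@off A g x)) = restr S x.
  apply/restrP => k /= kS; rewrite /ext /off; case: insubP => [k' _ ->//|].
  by rewrite negbK => /eqP kg; rewrite -kg kS in gS.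
pose c u := cp mu S g a (ext u).
have mc : measurable_fun setT c.
  pose G w := pr mu ([set y | restr S y = w] `&` [set y | y g = a]) / pr mu [set y | restr S y = w].
  rewrite (_ : c = G \o (restr S \o ext)); last by apply/funext => u; rewrite /c /cp cylinderE.
  apply: measurable_fun_finite_valued => w.
  apply: fin_det_measurable; exists (pmap insub (enum_fset S)) => u v uv /= <-.
  apply/ffunP => k; rewrite !ffunE /ext; case: insubP => // k' _ kk'; rewrite uv//.
  by rewrite mem_pmap_sub kk'; exact: fsvalP.
(* The sign of the difference is an event off [g]; its positive and negative parts contribute at
   most [5 / 2 * t] each, which gives [5 * t]. *)
pose E := [set u | Pc_off mu a u < c u].
have mE : measurable E.
  by rewrite -[E]setTI; apply: measurable_fun_ltr => //; exact: measurable_Pc_off.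
have mo C : measurable C -> measurable (@off A g @^-1` C).
  by move=> mC; rewrite -[X in measurable X]setTI; exact: measurable_off.
have iD C : measurable C -> mu.-integrable setT
    (EFin \o fun x => (cp mu S g a x - Pc mu g a x) * \1_(@off A g @^-1` C) x).
  by move=> mC; apply: integrable_mul_indic; [exact: mo|apply: integrable_sub; [exact: integrable_cp|exact: integrable_Pc]].
have := cp_approx_event a gS t0 St mE.
have := cp_approx_event a gS t0 St (measurableC mE).
have -> : \int[mu]_x `|cp mu S g a x - Pc mu g a x| =
   \int[mu]_x ((cp mu S g a x - Pc mu g a x) * \1_(@off A g @^-1` E) x) -
   \int[mu]_x ((cp mu S g a x - Pc mu g a x) * \1_(@off A g @^-1` (~` E)) x).
  rewrite -RintegralB//; [|exact: iD|exact/iD/measurableC].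
  apply: eq_Rintegral => x _; rewrite preimage_setC !indicE in_setC.
  have cE : c (@off A g x) = cp mu S g a x by exact/cp_restr/extoff.
  have [/set_mem/=|/negP nE] := boolP (x \in @off A g @^-1` E) => /=.
    by rewrite /E /= cE -Pc_offE mulr1 mulr0 subr0 => lt; rewrite ger0_norm// subr_ge0 ltW.
  rewrite mulr0 mulr1 sub0r ler0_norm// subr_le0 leNgt; apply/negP => lt; apply: nE.
  by apply/mem_set; rewrite /E /= cE -Pc_offE.
by rewrite !ler_norml; lra.
Qed.

End Approximation.

Section AlmostEverywhere.
Context d (T : measurableType d) (R : realType) (mu : probability T R).

Lemma ae_mono (P Q : T -> Prop) :
  (forall t, P t -> Q t) -> {ae mu, forall t, P t} -> {ae mu, forall t, Q t}.
Proof. exact: filterS. Qed.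

Lemma ae_mono2 (P P' Q : T -> Prop) : (forall t, P t -> P' t -> Q t) ->
  {ae mu, forall t, P t} -> {ae mu, forall t, P' t} -> {ae mu, forall t, Q t}.
Proof. exact: filterS2. Qed.

Lemma Rintegral_le0_ae (f : T -> R) : mu.-integrable setT (EFin \o f) ->
  (forall t, 0 <= f t) -> \int[mu]_t f t <= 0 -> {ae mu, forall t, f t = 0}.
Proof.
move=> intf f0 If; have /integrableP[mf _] := intf.
have I0 : (\int[mu]_t (f t)%:E = 0)%E.
  have fin : (\int[mu]_t (f t)%:E)%E \is a fin_num by exact: (integrable_fin_num measurableT intf).
  rewrite -(fineK fin); congr (_%:E); apply/eqP; rewrite eq_le If /=.
  exact: Rintegral_ge0.
have /(ae_eq_integral_abs mu measurableT mf) : (\int[mu]_(t in setT) `|(EFin \o f) t| = 0)%E.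
  by rewrite -[RHS]I0; apply: eq_integral => t _; rewrite /= ger0_norm.
by apply: filterS => t /(_ I) /= [].
Qed.

Lemma Rintegral_small_ae (f : T -> R) (c : R) : mu.-integrable setT (EFin \o f) ->
  (forall t, 0 <= f t) -> (forall e, 0 < e -> \int[mu]_t f t <= c * e) ->
  {ae mu, forall t, f t = 0}.
Proof.
move=> intf f0 small; apply: Rintegral_le0_ae => //; apply/ler_addgt0Pr => e e0; rewrite add0r.
have c1 : 0 < `|c| + 1 by rewrite ltr_pwDr.
apply: le_trans (small (e / (`|c| + 1)) (divr_gt0 e0 c1)) _.
rewrite mulrCA ger_pMr// ler_pdivrMr// mul1r.
by apply: le_trans (ler_norm _) _; rewrite lerDl.
Qed.

End AlmostEverywhere.

Section Clip.
Variable R : realType.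
Implicit Types (t c : R).

Definition clip01 t : R := Num.min 1 (Num.max 0 t).

Lemma clip01P t : 0 <= clip01 t <= 1.
Proof. by rewrite /clip01 le_min ler01 le_max lexx ge_min lexx. Qed.

Lemma clip01_gt0 t : (0 < clip01 t) = (0 < t).
Proof. by rewrite /clip01 lt_min ltr01 lt_max ltxx. Qed.

Lemma clip01_dist c t : 0 <= c <= 1 -> `|c - clip01 t| <= `|c - t|.
Proof.
move=> /andP[c0 c1]; rewrite /clip01.
have [t0|t0] := leP t 0; first by rewrite (min_idPr ler01) subr0 !ger0_norm//; lra.
by have [t1|t1] := leP 1 t; rewrite ?lexx// !ler0_norm//; lra.
Qed.

Lemma prod01 (I : Type) (s : seq I) (p : I -> R) :
  (forall i, 0 <= p i <= 1) -> 0 <= \prod_(i <- s) p i <= 1.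
Proof.
move=> p01; apply/andP; split; last by apply: prodr_ile1 => i _; exact: p01.
by apply: prodr_ge0 => i _; case/andP: (p01 i).
Qed.

Lemma dist_prod_le (I : Type) (s : seq I) (p q : I -> R) :
  (forall i, 0 <= p i <= 1) -> (forall i, 0 <= q i <= 1) ->
  `|\prod_(i <- s) p i - \prod_(i <- s) q i| <= \sum_(i <- s) `|p i - q i|.
Proof.
move=> p01 q01; elim: s => [|i s IH]; first by rewrite !big_nil subrr normr0.
rewrite !big_cons; have /andP[pi0 pi1] := p01 i.
have /andP[Q0 Q1] := prod01 s q01.
have -> : p i * \prod_(j <- s) p j - q i * \prod_(j <- s) q j =
  (p i - q i) * \prod_(j <- s) q j + p i * (\prod_(j <- s) p j - \prod_(j <- s) q j) by ring.
apply: le_trans (ler_normD _ _) _; apply: lerD; rewrite normrM.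
  by rewrite (ger0_norm Q0) ler_piMr.
by rewrite (ger0_norm pi0) (le_trans _ IH)// ler_piMl.
Qed.

End Clip.

(** * Clipped conditional probabilities and decoupling of sites *)

Section SiteProbability.
Variables (R : realType) (A : alphabetType) (mu : probability (borel Zinf A) R).
Implicit Types (S T F : {fset Zinf}) (g : Zinf) (a : A).

(* The conditional probability p_{x,g}(a) clipped to [0, 1], with the same support. *)
Definition site_prob g a (x : Zinf -> A) : R := clip01 (Pc mu g a x).

Lemma site_prob01 g a x : 0 <= site_prob g a x <= 1.
Proof. exact: clip01P. Qed.

Lemma measurable_site_prob g a : measurable_fun setT (site_prob g a : borel Zinf A -> R).
Proof.
apply: measurable_minr; first exact: measurable_cst.
apply: measurable_maxr; [exact: measurable_cst|exact: measurable_Pc].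
Qed.

Lemma integrable_site_prob g a : mu.-integrable setT (EFin \o (site_prob g a)).
Proof.
apply: (@bounded_integrable _ _ _ mu _ 1); first exact: measurable_site_prob.
by move=> x; have /andP[? ?] := site_prob01 g a x; rewrite ger0_norm.
Qed.

Lemma indic_coord g a (x : Zinf -> A) : \1_[set x | x g = a] x = (x g == a)%:R :> R.
Proof.
by rewrite indicE; congr (nat_of_bool _)%:R; apply/idP/eqP => [/set_mem|xa]; last exact/mem_set.
Qed.

Definition ffun_ext (T : {fset Zinf}) (w : {ffun T -> A}) : Zinf -> A :=
  fun k => if insub k is Some k' then w k' else point.

Lemma ffun_ext_restr T (x : Zinf -> A) g : g \in T -> ffun_ext (restr T x) g = x g.
Proof. by move=> gT; rewrite /ffun_ext (insubT (mem T) gT) ffunE. Qed.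

Lemma restr_ffun_ext T (w : {ffun T -> A}) : restr T (ffun_ext w) = w.
Proof. by apply/ffunP => g; rewrite ffunE /ffun_ext valK. Qed.

Lemma det_fun_restr T (G : (Zinf -> A) -> R) :
  (forall x y, {in T, x =1 y} -> G x = G y) ->
  exists F : {ffun T -> A} -> R, forall x, G x = F (restr T x).
Proof.
move=> GT; exists (G \o @ffun_ext T) => x; apply: GT => k kT /=.
by rewrite ffun_ext_restr.
Qed.

Lemma measurable_det_fun T (G : (Zinf -> A) -> R) :
  (forall x y, {in T, x =1 y} -> G x = G y) -> measurable_fun setT (G : borel Zinf A -> R).
Proof.
move=> /det_fun_restr[F GF]; rewrite (_ : G = F \o restr T); last exact/funext.
by apply: measurable_fun_finite_valued; exact: measurable_restr.
Qed.

Variable h : R.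
Hypothesis le_h : forall g S, g \notin S -> h <= incr_entropy mu g S.

Lemma site_prob_approx S g a (t : R) :
  g \notin S -> 0 < t -> incr_entropy mu g S <= h + t ^+ 2 ->
  \int[mu]_x `|cp mu S g a x - site_prob g a x| <= 5 * t.
Proof.
move=> gS t0 St; apply: le_trans (cp_approx le_h a gS t0 St).
apply: le_Rintegral => //.
- by apply: integrable_norm; apply: integrable_sub; [exact: integrable_cp|exact: integrable_site_prob].
- by apply: integrable_norm; apply: integrable_sub; [exact: integrable_cp|exact: integrable_Pc].
by move=> x _; apply: clip01_dist; exact: cp01.
Qed.

(** With the larger context [S] united with [T], which sees all that [G] depends on, replacing the
    indicator by its conditional probability is exact. Returning to [S] costs at most [5 / 2 * t] by
    the entropy budget. *)
Lemma cp_replace S T g a (t : R) (G : (Zinf -> A) -> R) :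
  g \notin S -> 0 < t -> incr_entropy mu g S <= h + t ^+ 2 ->
  g \notin T -> (forall x y, {in T, x =1 y} -> G x = G y) -> (forall x, 0 <= G x <= 1) ->
  `|\int[mu]_x (\1_[set x | x g = a] x * G x) - \int[mu]_x (cp mu S g a x * G x)| <= 5 / 2 * t.
Proof.
move=> gS t0 St gT GT G01; pose U := (S `|` T)%fset.
have gU : g \notin U by rewrite inE negb_or gS.
have GU x y : {in U, x =1 y} -> G x = G y.
  by move=> xy; apply: GT => k kT; apply: xy; rewrite inE kT orbT.
have [F GF] := det_fun_restr GU.
have mG := measurable_det_fun GT.
have intG (f : (Zinf -> A) -> R) : measurable_fun setT (f : borel Zinf A -> R) ->
    (forall x, 0 <= f x <= 1) -> mu.-integrable setT (EFin \o (fun x => f x * G x)).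
  move=> mf f01; apply: (@bounded_integrable _ _ _ mu _ 1); first exact: measurable_funM.
  move=> x; have /andP[? ?] := f01 x; have /andP[? ?] := G01 x.
  by rewrite ger0_norm ?mulr_ge0// mulr_ile1.
have iS := intG _ (@measurable_fun_cp _ _ mu S g a) (cp01 mu S g a).
have iU := intG _ (@measurable_fun_cp _ _ mu U g a) (cp01 mu U g a).
have -> : \int[mu]_x (\1_[set x | x g = a] x * G x) = \int[mu]_x (cp mu U g a x * G x).
  under eq_Rintegral do rewrite GF; rewrite -Rintegral_cp_fun.
  by under [RHS]eq_Rintegral do rewrite GF.
have SU : (S `<=` U)%fset by exact: fsubsetUl.
have gap : incr_entropy mu g S - incr_entropy mu g U <= t ^+ 2.
  by have := le_h gU; move: St; lra.
rewrite -RintegralB//; apply: le_trans (le_normr_Rintegral _ _) _ => //; first exact: integrable_sub.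
apply: le_trans (cp_close a SU t0 gap); apply: le_Rintegral => //.
- by apply: integrable_norm; exact: integrable_sub.
- by apply: integrable_norm; apply: integrable_sub; exact: integrable_cp.
move=> x _; rewrite -mulrBl normrM; have /andP[G0 G1] := G01 x.
by rewrite (ger0_norm G0) ler_piMr.
Qed.

Hypothesis past : forall g (e : R), 0 < e -> exists2 S : {fset Zinf},
  (forall s, s \in S -> lexlt s g) & incr_entropy mu g S < h + e.

Lemma past_notin S g : (forall s, s \in S -> lexlt s g) -> g \notin S.
Proof. by move=> Sg; apply/negP => /Sg; exact: lexlt_irrefl. Qed.

(* Sites are decoupled one at a time, the largest first: the contexts of the other
   sites are in their pasts, hence do not see it. *)
Lemma decouple (t : R) (S : Zinf -> {fset Zinf}) (w : Zinf -> A) : 0 < t ->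
  (forall g, (forall s, s \in S g -> lexlt s g)) ->
  (forall g, incr_entropy mu g (S g) <= h + t ^+ 2) ->
  forall F T (G : (Zinf -> A) -> R), (forall g, g \in F -> g \notin T) ->
    (forall x y, {in T, x =1 y} -> G x = G y) -> (forall x, 0 <= G x <= 1) ->
  `|\int[mu]_x ((\prod_(g <- F) \1_[set x | x g = w g] x) * G x) -
    \int[mu]_x ((\prod_(g <- F) cp mu (S g) g (w g) x) * G x)| <= #|` F|%:R * (5 / 2 * t).
Proof.
move=> t0 Spast St F; move: {2}#|` F| (erefl #|` F|) => n.
elim: n F => [|n IH] F cardF T G FT GT G01.
  have -> : F = fset0 by apply/eqP; rewrite -cardfs_eq0 cardF.
  have e (p : Zinf -> (Zinf -> A) -> R) :
      \int[mu]_x ((\prod_(g <- fset0) p g x) * G x) = \int[mu]_x G x.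
    by apply: eq_Rintegral => x _; rewrite big_seq_fset0 mul1r.
  by rewrite (e (fun g => \1_[set x | x g = w g])) e subrr normr0 cardfs0 mul0r.
have F0 : (F : {fset Zinf}) != fset0 by rewrite -cardfs_eq0 cardF.
have [m mF mmax] := lexlt_max F0.
pose F' := (F `\ m)%fset.
have cardF' : #|` F'| = n by have := cardfsD1 m F; rewrite mF cardF add1n => -[].
have mF' : m \notin F' by rewrite !inE eqxx.
have FE : F = (m |` F')%fset by rewrite fsetD1K.
pose ind g x : R := \1_[set x : Zinf -> A | x g = w g] x.
have ind01 g x : 0 <= ind g x <= 1 by rewrite /ind indicE; case: (_ \in _); rewrite /= ler01 lexx.
have step1 := IH F' cardF' (m |` T)%fset (fun x => ind m x * G x).
(* The remaining factors see only [T] and the contexts of [F']; [m] is larger than every site of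
   [F'], so it occurs in none of these contexts. *)
have step2 := @cp_replace (S m) ((\bigcup_(g <- F') S g) `|` T)%fset m (w m) t
  (fun x => (\prod_(g <- F') cp mu (S g) g (w g) x) * G x) (past_notin (Spast m)) t0 (St m).
rewrite cardF -natr1 mulrDl mul1r.
apply: le_trans (ler_distD (\int[mu]_x ((\prod_(g <- F') cp mu (S g) g (w g) x) * (ind m x * G x))) _ _) _.
apply: lerD.
  rewrite -cardF'; apply: le_trans (step1 _ _ _).
  - rewrite le_eqVlt; apply/orP; left; apply/eqP; congr (`|_ - _|).
    by apply: eq_Rintegral => x _; rewrite FE big_fsetU1//= -/(ind m x); ring.
  - move=> g gF'; rewrite in_fset1U negb_or FT; last by move: gF'; rewrite !inE => /andP[].
    by rewrite andbT; apply: contraNneq mF' => <-.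
  - move=> x y xy; rewrite (GT x y); last by move=> k kT; apply: xy; rewrite fset1Ur.
    by rewrite /ind !indic_coord xy ?fset1U1.
  - by move=> x; have /andP[? ?] := ind01 m x; have /andP[? ?] := G01 x; rewrite mulr_ge0// mulr_ile1.
apply: le_trans (step2 _ _ _).
- rewrite le_eqVlt; apply/orP; left; apply/eqP; congr (`|_ - _|).
    by apply: eq_Rintegral => x _; rewrite -/(ind m x); ring.
  by apply: eq_Rintegral => x _; rewrite FE big_fsetU1//=; ring.
- rewrite inE negb_or FT// andbT; apply/negP => /bigfcupP[g].
  rewrite andbT => gF' /(Spast g) mg; have gF : g \in F by move: gF'; rewrite !inE => /andP[].
  have gm : g != m by apply: contraNneq mF' => <-.
  exact: lexlt_irrefl (lexlt_trans mg (mmax g gF gm)).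
- move=> x y xy; rewrite (GT x y); last by move=> k kT; apply: xy; rewrite inE kT orbT.
  congr (_ * _); rewrite big_seq [RHS]big_seq; apply: eq_bigr => g gF'.
  apply: cp_restr; apply/restrP => k kS; apply: xy.
  by rewrite inE; apply/orP; left; apply/bigfcupP; exists g; rewrite ?andbT.
- move=> x; have /andP[? ?] := G01 x.
  have /andP[? ?] := prod01 F' (fun g => cp01 mu (S g) g (w g) x).
  by rewrite mulr_ge0// mulr_ile1.
Qed.

End SiteProbability.

(** * The cylinder formula *)

Lemma ae_forall_countable d (T : measurableType d) (R : realType)
    (mu : probability T R) (I : Type) (P : I -> T -> Prop) : countable [set: I] ->
  (forall i, {ae mu, forall t, P i t}) -> {ae mu, forall t, forall i, P i t}.
Proof.
move=> /countable_injP[e einj] aeP.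
have : {ae mu, forall t, forall n : nat, forall i, e i = n -> P i t}.
  apply: ae_foralln => n; have [[i ein]|ne] := pselect (exists i, e i = n).
    apply: filterS (aeP i) => t Pit j ejn; rewrite (einj j i) ?inE//.
    by rewrite ejn ein.
  by apply: aeW => t i ein; exfalso; apply: ne; exists i.
by apply: filterS => t Pt i; exact: Pt.
Qed.

Lemma le_of_linear (R : realType) (x y c : R) :
  (forall t, 0 < t -> t <= 1 -> x <= y + c * t) -> x <= y.
Proof.
move=> xy; rewrite leNgt; apply/negP => yx.
pose t := Num.min 1 ((x - y) / (2 * (`|c| + 1))).
have c1 : 0 < 2 * (`|c| + 1) by rewrite mulr_gt0// ltr_wpDl.
have t0 : 0 < t by rewrite lt_min ltr01 divr_gt0// subr_gt0.
have t1 : t <= 1 by rewrite ge_min lexx.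
have : t * (2 * (`|c| + 1)) <= x - y by rewrite -ler_pdivlMr// ge_min lexx orbT.
have : c * t <= `|c| * t by rewrite ler_pM2r// ler_norm.
have := xy t t0 t1.
nra.
Qed.

Section UniformGap.
Variables (R : realType) (A : finType).

(** The right-hand side is the divergence of [p] from the uniform law on its support, to which
    [kl_ge] applies. *)
Lemma uniform_gap (p : A -> R) (N : R) : (forall a, 0 <= p a) -> \sum_a p a = 1 ->
  N = #|[set a | (0 < p a)%R]%SET|%:R ->
  (\sum_a (p a - (if 0 < p a then N^-1 else 0)) ^+ 2) / 4 <= ln N - \sum_a eta (p a).
Proof.
move=> p0 p1 NE; pose u a := if 0 < p a then N^-1 else 0.
have pE a : ~~ (0 < p a) -> p a = 0.
  by rewrite -leNgt => pa; apply/eqP; rewrite eq_le pa p0.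
have N0 : 0 < N.
  rewrite NE ltr0n card_gt0; apply/eqP => N0; have : \sum_a p a = 0.
    apply: big1 => a _; apply: pE; apply/negP => pa.
    by have := finset.in_set0 a; rewrite -N0 inE pa.
  by rewrite p1 => /eqP; rewrite oner_eq0.
have u1 : \sum_a u a = 1.
  rewrite /u -big_mkcond /= sumr_const -[RHS](divff (lt0r_neq0 N0)) -mulr_natl; congr (_ * _).
  by rewrite NE; congr _%:R; apply: eq_card => a; rewrite inE.
have up a : u a = 0 -> p a = 0.
  rewrite /u; case: ifPn => [_ /eqP|/pE//]; by rewrite invr_eq0 (gt_eqF N0).
have u0 a : 0 <= u a by rewrite /u; case: ifP => // _; rewrite invr_ge0 ltW.
have := @kl_ge R A p u p0 u0 p1 u1 up.
move=> /le_trans; apply.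
rewrite le_eqVlt; apply/orP; left; apply/eqP.
have -> : ln N = \sum_a p a * ln N by rewrite -mulr_suml p1 mul1r.
rewrite -sumrB; apply: eq_bigr => a _; rewrite /eta /u.
by case: ifPn => [pa|/pE ->]; [rewrite lnV ?posrE//; ring|rewrite !mul0r oppr0 subrr].
Qed.

End UniformGap.

Lemma sum_const_fin (R : realType) (A : finType) (c : R) : \sum_(a : A) c = #|A|%:R * c.
Proof. by rewrite sumr_const mulr_natl. Qed.

Section AeIntegral.
Context d (T : measurableType d) (R : realType) (mu : probability T R).

Lemma eq_ae_Rintegral (f g : T -> R) : mu.-integrable setT (EFin \o f) ->
  mu.-integrable setT (EFin \o g) -> {ae mu, forall t, f t = g t} ->
  \int[mu]_t f t = \int[mu]_t g t.
Proof.
move=> /integrableP[mf _] /integrableP[mg _] fg; congr fine.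
by apply: ae_eq_integral => //; apply: ae_mono fg => t -> _.
Qed.

Lemma Rintegral_ae_ge0 (f : T -> R) : mu.-integrable setT (EFin \o f) ->
  {ae mu, forall t, 0 <= f t} -> 0 <= \int[mu]_t f t.
Proof.
move=> intf f0; rewrite (@eq_ae_Rintegral f (fun t => `|f t|))//; first exact: Rintegral_ge0.
  exact: integrable_norm.
by apply: ae_mono f0 => t f0; rewrite ger0_norm.
Qed.

End AeIntegral.

Section SiteProbabilityLaw.
Variables (R : realType) (A : alphabetType) (mu : probability (borel Zinf A) R).
Implicit Types (S T F : {fset Zinf}) (g : Zinf) (a : A).
Variable h : R.
Hypothesis le_h : forall g S, g \notin S -> h <= incr_entropy mu g S.
Hypothesis past : forall g (e : R), 0 < e -> exists2 S : {fset Zinf},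
  (forall s, s \in S -> lexlt s g) & incr_entropy mu g S < h + e.

Let q := site_prob mu.

Lemma past_family (t : R) : 0 < t -> exists S : Zinf -> {fset Zinf}, forall g,
  [/\ (forall s, s \in S g -> lexlt s g), g \notin S g &
      incr_entropy mu g (S g) <= h + t ^+ 2].
Proof.
move=> t0; have /choice[S SP] : forall g, exists S : {fset Zinf},
    [/\ (forall s, s \in S -> lexlt s g), g \notin S & incr_entropy mu g S <= h + t ^+ 2].
  move=> g; have [S Sg St] := past g (exprn_gt0 2 t0).
  by exists S; split=> //; [exact: past_notin|exact: ltW].
by exists S.
Qed.

(** The identity holds only in mean: on a null pattern every [cp] is 0, and so is their sum. *)
Lemma cp_sum1 S g : \int[mu]_x `|\sum_a cp mu S g a x - 1| = 0.
Proof.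
pose G w : R := `|\sum_a pr mu ([set y | restr S y = w] `&` [set y | y g = a]) /
   pr mu [set y | restr S y = w] - 1|.
transitivity (\int[mu]_x G (restr S x)).
  by apply: eq_Rintegral => x _; rewrite /G /cp cylinderE.
rewrite (Rintegral_finite_valued mu G (@measurable_restr A S)) big1// => w _.
have [z|nz] := eqVneq (pr mu [set y | restr S y = w]) 0; first by rewrite z mul0r.
rewrite /G -mulr_suml -(pr_partition mu (@measurable_restr A S w)); last first.
  by move=> a; exact: (@measurable_coord Zinf A g a).
by rewrite divff// subrr normr0 mulr0.
Qed.

(** Radon-Nikodym derivatives are taken letter by letter, and nothing relates them pointwise. The
    sum is 1 almost surely because it is a limit in mean of the sums of [cp]. *)
Lemma site_prob_sum1 g : {ae mu, forall x, \sum_a q g a x = 1}.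
Proof.
have iq : mu.-integrable setT (EFin \o fun x => `|\sum_a q g a x - 1|).
  apply: integrable_norm; apply: integrable_sub; last exact: finite_measure_integrable_cst.
  rewrite (_ : EFin \o _ = fun x => (\sum_a (q g a x)%:E)%E).
    by apply: integrable_sum => // a _; exact: integrable_site_prob.
  by apply/funext => x /=; rewrite sumEFin.
have : {ae mu, forall x, `|\sum_a q g a x - 1| = 0}.
  apply: (@Rintegral_small_ae _ _ _ _ _ (#|A|%:R * 5)) => // t t0.
  have [S Sg St] := past g (exprn_gt0 2 t0).
  have gS := past_notin Sg.
  have id1 a : mu.-integrable setT (EFin \o fun x => `|cp mu S g a x - q g a x|).
    by apply: integrable_norm; apply: integrable_sub; [exact: integrable_cp|exact: integrable_site_prob].
  have isum : mu.-integrable setT (EFin \o fun x => \sum_a `|cp mu S g a x - q g a x|).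
    rewrite (_ : EFin \o _ = fun x => (\sum_a (`|cp mu S g a x - q g a x|)%:E)%E).
      by apply: integrable_sum => // a _; exact: id1.
    by apply/funext => x /=; rewrite sumEFin.
  have icp : mu.-integrable setT (EFin \o fun x => `|\sum_a cp mu S g a x - 1|).
    apply: integrable_norm; apply: integrable_sub; last exact: finite_measure_integrable_cst.
    rewrite (_ : EFin \o _ = fun x => (\sum_a (cp mu S g a x)%:E)%E).
      by apply: integrable_sum => // a _; exact: integrable_cp.
    by apply/funext => x /=; rewrite sumEFin.
  apply: (@le_trans _ _ (\int[mu]_x (\sum_a `|cp mu S g a x - q g a x| + `|\sum_a cp mu S g a x - 1|))).
    apply: le_Rintegral => //; first exact: integrable_add.
    move=> x _; have -> : \sum_a q g a x - 1 =
        - \sum_a (cp mu S g a x - q g a x) + (\sum_a cp mu S g a x - 1) by rewrite sumrB; ring.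
    by apply: le_trans (ler_normD _ _) _; rewrite lerD2r normrN; exact: ler_norm_sum.
  rewrite RintegralD// cp_sum1 addr0 Rintegral_sum//.
  rewrite -mulrA mulr_natl -sumr_const; apply: ler_sum => a _.
  by apply: (site_prob_approx le_h a gS t0); exact: ltW.
by apply: ae_mono => x /eqP; rewrite normr_eq0 subr_eq0 => /eqP.
Qed.

Lemma cylinder_site_prob F (w : Zinf -> A) :
  pr mu (cylinder [set` F] w) = \int[mu]_x \prod_(g <- F) q g (w g) x.
Proof.
have q01 x g : 0 <= q g (w g) x <= 1 by exact: site_prob01.
have iprod (p : Zinf -> (Zinf -> A) -> R) :
    (forall g, measurable_fun setT (p g : borel Zinf A -> R)) -> (forall x g, 0 <= p g x <= 1) ->
    mu.-integrable setT (EFin \o fun x => \prod_(g <- F) p g x).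
  move=> mp p01; apply: (@bounded_integrable _ _ _ mu _ 1); first exact: measurable_prod.
  by move=> x; have /andP[? ?] := prod01 F (p01 x); rewrite ger0_norm.
apply/eqP; rewrite -subr_eq0 -normr_eq0 eq_le normr_ge0 andbT.
apply/ler_addgt0Pr => e e0; rewrite add0r.
(* Per site, [5 / 2] pays for decoupling and [5] for passing from [cp] to the conditional
   probability; the final 1 keeps [c] positive when [F] is empty. *)
pose c : R := #|` F|%:R * (5 / 2 + 5) + 1.
have c0 : 0 < c by rewrite ltr_wpDl// mulr_ge0//; lra.
pose t := e / c; have t0 : 0 < t by rewrite divr_gt0.
have [S SP] := past_family t0.
have Spast g s : s \in S g -> lexlt s g by case: (SP g) => + _ _; apply.
have St g : incr_entropy mu g (S g) <= h + t ^+ 2 by case: (SP g).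
have gS g : g \notin S g by case: (SP g).
have := @decouple _ _ _ h le_h t S w t0 Spast St F fset0 (fun=> 1) _ _ _.
under eq_Rintegral do rewrite mulr1.
under [X in `|_ - X|]eq_Rintegral do rewrite mulr1.
have -> : \int[mu]_x \prod_(g <- F) \1_[set x | x g = w g] x = pr mu (cylinder [set` F] w).
  rewrite -Rintegral_indic; last exact: measurable_cylinder.
  apply: eq_Rintegral => x _.
  have [/set_mem wx|/negP nwx] := boolP (x \in cylinder [set` F] w).
    rewrite [RHS]indicE mem_set// big_seq big1// => g gF.
    by rewrite indic_coord wx ?eqxx.
  rewrite [RHS]indicE memNset; last by move=> wx; apply: nwx; exact/mem_set.
  have /existsNP[g /not_implyP[gF /eqP/negbTE xg]] : ~ forall g, [set` F] g -> x g = w g.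
    by move=> wx; apply: nwx; exact/mem_set.
  by rewrite (big_fsetD1 g)//= indic_coord xg mul0r.
move=> /(_ _ _ _) dec.
have {}dec : `|pr mu (cylinder [set` F] w) - \int[mu]_x \prod_(g <- F) cp mu (S g) g (w g) x| <=
    #|` F|%:R * (5 / 2 * t).
  by apply: dec => // x; rewrite ler01 lexx.
have cq : `|\int[mu]_x \prod_(g <- F) cp mu (S g) g (w g) x - \int[mu]_x \prod_(g <- F) q g (w g) x| <=
    #|` F|%:R * (5 * t).
  have icp := iprod (fun g => cp mu (S g) g (w g)) (fun g => @measurable_fun_cp _ _ mu (S g) g (w g))
    (fun x g => cp01 mu (S g) g (w g) x).
  have iq := iprod (fun g => q g (w g)) (fun g => @measurable_site_prob _ _ mu g (w g)) q01.
  have id1 g : mu.-integrable setT (EFin \o fun x => `|cp mu (S g) g (w g) x - q g (w g) x|).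
    by apply: integrable_norm; apply: integrable_sub; [exact: integrable_cp|exact: integrable_site_prob].
  rewrite -RintegralB//; apply: le_trans (le_normr_Rintegral _ _) _ => //; first exact: integrable_sub.
  apply: (@le_trans _ _ (\int[mu]_x \sum_(g <- F) `|cp mu (S g) g (w g) x - q g (w g) x|)).
    apply: le_Rintegral => //; first by apply: integrable_norm; exact: integrable_sub.
      rewrite (_ : EFin \o _ = fun x => (\sum_(g <- F) (`|cp mu (S g) g (w g) x - q g (w g) x|)%:E)%E).
        by apply: integrable_sum => // g _; exact: id1.
      by apply/funext => x /=; rewrite sumEFin.
    by move=> x _; apply: dist_prod_le => // g; exact: cp01.
  rewrite Rintegral_sum// -sum_const_seq; apply: ler_sum => g _.
  exact: (site_prob_approx le_h (w g) (gS g) t0 (St g)).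
apply: le_trans (ler_distD (\int[mu]_x \prod_(g <- F) cp mu (S g) g (w g) x) _ _) _.
apply: le_trans (lerD dec cq) _.
have -> : #|` F|%:R * (5 / 2 * t) + #|` F|%:R * (5 * t) = (c - 1) * t by rewrite /c; ring.
have -> : e = c * t by rewrite /t mulrC divfK// gt_eqF.
by rewrite ler_pM2r//; lra.
Qed.

Lemma integrable_eta (f : (Zinf -> A) -> R) : measurable_fun setT (f : borel Zinf A -> R) ->
  (forall x, 0 <= f x <= 1) -> mu.-integrable setT (EFin \o (fun x => eta (f x))).
Proof.
move=> mf f01; apply: (@bounded_integrable _ _ _ mu _ 1).
  apply: measurable_funN; apply: measurable_funM => //.
  by apply: (@measurableT_comp _ _ _ _ _ _ (@ln R)) => //; exact: measurable_ln.
by move=> x; rewrite ger0_norm ?eta_ge0// eta_le1.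
Qed.

Lemma integrable_sum_eta (f : A -> (Zinf -> A) -> R) :
  (forall a, measurable_fun setT (f a : borel Zinf A -> R)) ->
  (forall a x, 0 <= f a x <= 1) -> mu.-integrable setT (EFin \o (fun x => \sum_a eta (f a x))).
Proof.
move=> mf f01; rewrite (_ : EFin \o _ = fun x => (\sum_a (eta (f a x))%:E)%E).
  by apply: integrable_sum => // a _; exact: integrable_eta.
by apply/funext => x /=; rewrite sumEFin.
Qed.

Lemma le_site_entropy g : h <= \int[mu]_x \sum_a eta (q g a x).
Proof.
have iq := integrable_sum_eta (@measurable_site_prob _ _ mu g) (site_prob01 mu g).
(* Two successive limits: [t] tends to 0 with [d] fixed, since the slope [1 + 2 / d] blows up, and
   then [d] tends to 0, using [d ^+ 2 + 4 * d <= 5 * d]. *)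
apply: (@le_of_linear _ _ _ (#|A|%:R * 5)) => d d0 d1.
apply: (@le_of_linear _ _ _ (#|A|%:R * ((1 + 2 / d) * 5))) => t t0 t1.
have [S Sg St] := past g (exprn_gt0 2 t0).
have gS := past_notin Sg.
apply: le_trans (le_h gS) _; rewrite incr_entropyE.
have id1 a : mu.-integrable setT (EFin \o fun x => `|cp mu S g a x - q g a x|).
  by apply: integrable_norm; apply: integrable_sub; [exact: integrable_cp|exact: integrable_site_prob].
have id2 a : mu.-integrable setT (EFin \o fun x => (1 + 2 / d) * `|cp mu S g a x - q g a x|).
  rewrite (_ : EFin \o _ = fun x => ((1 + 2 / d)%:E * (`|cp mu S g a x - q g a x|)%:E)%E)//.
  by apply: integrableZl => //; exact: id1.
have isum : mu.-integrable setT (EFin \o fun x => \sum_a ((1 + 2 / d) * `|cp mu S g a x - q g a x|)).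
  rewrite (_ : EFin \o _ = fun x => (\sum_a ((1 + 2 / d) * `|cp mu S g a x - q g a x|)%:E)%E).
    by apply: integrable_sum => // a _; exact: id2.
  by apply/funext => x /=; rewrite sumEFin.
have ic : mu.-integrable setT (EFin \o fun x : borel Zinf A => #|A|%:R * 5 * d : R).
  exact: finite_measure_integrable_cst.
apply: (@le_trans _ _ (\int[mu]_x (\sum_a eta (q g a x) + #|A|%:R * 5 * d +
    \sum_a ((1 + 2 / d) * `|cp mu S g a x - q g a x|)))).
  apply: le_Rintegral => //.
  - exact: integrable_sum_eta (@measurable_fun_cp _ _ mu S g) (cp01 mu S g).
  - by apply: integrable_add => //; exact: integrable_add.
  move=> x _; rewrite -mulrA -(sum_const_fin A) -!big_split/=; apply: ler_sum => a _.
  have dd : 0 < d <= 1 by rewrite d0.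
  apply: le_trans (eta_modulus dd (cp01 mu S g a x) (site_prob01 mu g a x)) _.
  rewrite lerD2r lerD2l; nra.
rewrite RintegralD//; last exact: integrable_add.
rewrite RintegralD//.
have -> : \int[mu]_(x in setT) (#|A|%:R * 5 * d) = #|A|%:R * 5 * d :> R.
  by have := @Rintegral_cst _ _ _ mu setT measurableT (#|A|%:R * 5 * d); rewrite -/(pr mu setT) pr_setT mulr1.
rewrite lerD2l Rintegral_sum// -mulrA -(sum_const_fin A); apply: ler_sum => a _.
have c0 : 0 <= 1 + 2 / d by rewrite addr_ge0// divr_ge0// ltW.
rewrite RintegralZl// -mulrA ler_wpM2l//.
by apply: (site_prob_approx le_h a gS t0); exact: ltW.
Qed.

Definition site_supp g (x : Zinf -> A) : {set A} := [set a | (0 < q g a x)%R]%SET.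

Lemma measurable_site_supp g s :
  measurable ([set x | site_supp g x = s] : set (borel Zinf A)).
Proof.
rewrite (_ : mkset _ = \bigcap_(a in [set: A]) [set x | (0 < q g a x) = (a \in s)]).
  apply: fin_bigcap_measurable => [|a _]; first exact: finite_finset.
  have mpos : measurable ([set x | 0 < q g a x] : set (borel Zinf A)).
    rewrite -[mkset _]setTI; apply: measurable_fun_ltr => //; exact: measurable_site_prob.
  case: (a \in s); first by rewrite (_ : mkset _ = [set x | 0 < q g a x]).
  rewrite (_ : mkset _ = ~` [set x | 0 < q g a x]); first exact: measurableC.
  by apply/seteqP; split=> x /=; [move=> ->|move/negP/negbTE].
apply/seteqP; split=> x /=; first by move=> <- a _ /=; rewrite inE.
by move=> xs; apply/setP => a; rewrite inE; exact: xs.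
Qed.

Lemma integrable_supp g (G : {set A} -> R) :
  mu.-integrable setT (EFin \o (fun x => G (site_supp g x))).
Proof. exact: (integrable_finite_valued mu G (@measurable_site_supp g)). Qed.

Let lnN g x : R := ln #|site_supp g x|%:R.

Let gap g x : R :=
  (\sum_a (q g a x - (if 0 < q g a x then #|site_supp g x|%:R^-1 else 0)) ^+ 2) / 4.

Lemma site_gap g : {ae mu, forall x, gap g x <= lnN g x - \sum_a eta (q g a x)}.
Proof.
apply: ae_mono (site_prob_sum1 g) => x p1.
by apply: uniform_gap => // a; have /andP[] := site_prob01 mu g a x.
Qed.

Let gap_ge0 g x : 0 <= gap g x.
Proof. by rewrite divr_ge0// sumr_ge0// => a _; exact: sqr_ge0. Qed.

Lemma le_log_support g : h <= \int[mu]_x lnN g x.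
Proof.
apply: le_trans (le_site_entropy g) _; rewrite -subr_ge0.
have iq := integrable_sum_eta (@measurable_site_prob _ _ mu g) (site_prob01 mu g).
have iN := integrable_supp g (fun s => ln #|s|%:R).
rewrite -RintegralB//; apply: Rintegral_ae_ge0; first exact: integrable_sub.
by apply: ae_mono (site_gap g) => x; exact: le_trans.
Qed.

Lemma site_prob_uniform g : \int[mu]_x lnN g x <= h ->
  {ae mu, forall x, forall a, q g a x = (if 0 < q g a x then #|site_supp g x|%:R^-1 else 0)}.
Proof.
move=> Nh.
have iq := integrable_sum_eta (@measurable_site_prob _ _ mu g) (site_prob01 mu g).
have iN := integrable_supp g (fun s => ln #|s|%:R).
have igap : mu.-integrable setT (EFin \o gap g).
  apply: (@bounded_integrable _ _ _ mu _ (#|A|%:R * 1)).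
    apply: measurable_funM; last exact: measurable_cst.
    apply: measurable_sum => a; apply: measurable_funX; apply: measurable_funB.
      exact: measurable_site_prob.
    have := measurable_fun_finite_valued (fun s : {set A} => if a \in s then #|s|%:R^-1 else 0 : R) (@measurable_site_supp g).
    by apply: eq_measurable_fun => x _ /=; rewrite inE.
  move=> x; rewrite ger0_norm// ler_pdivrMr//.
  have u01 a : 0 <= (if 0 < q g a x then #|site_supp g x|%:R^-1 else 0 : R) <= 1.
    case: ifP => qa; last by rewrite lexx ler01.
    have s0 : (0 < #|site_supp g x|)%N by rewrite card_gt0; apply/set0Pn; exists a; rewrite inE.
    by rewrite invr_ge0 ler0n invf_le1 ?ler1n// ltr0n.
  rewrite -mulrA -(sum_const_fin A); apply: ler_sum => a _.
  have := u01 a; set u := (if _ then _ else _) => /andP[u0 u1].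
  have /andP[q0 q1] : 0 <= q g a x <= 1 := site_prob01 mu g a x.
  rewrite -[X in X <= _]real_normK ?num_real// mul1r -[4%:R](_ : 2 ^+ 2 = _); last by rewrite -natrX.
  by rewrite lerXn2r ?nnegrE// ler_norml; apply/andP; split; lra.
have : {ae mu, forall x, gap g x = 0}.
  apply: Rintegral_le0_ae => //; apply: (@le_trans _ _ (\int[mu]_x (lnN g x - \sum_a eta (q g a x)))).
    rewrite -subr_ge0 -RintegralB//; last exact: integrable_sub.
    apply: Rintegral_ae_ge0; first by apply: integrable_sub => //; exact: integrable_sub.
    by apply: ae_mono (site_gap g) => x; rewrite subr_ge0.
  by rewrite RintegralB//; have := le_site_entropy g; move: Nh; lra.
apply: ae_mono => x /eqP; rewrite mulf_eq0 invr_eq0 pnatr_eq0 orbF.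
rewrite psumr_eq0; last by move=> a _; exact: sqr_ge0.
by move=> /allP z a; have := z a (mem_index_enum a); rewrite sqrf_eq0 subr_eq0 => /eqP.
Qed.

Hypothesis mu_shift : shift_invariant mu.

Lemma Rintegral_shift v (F : (Zinf -> A) -> R) (M : R) :
  measurable_fun setT (F : borel Zinf A -> R) -> (forall x, `|F x| <= M) ->
  \int[mu]_x F (shift v x) = \int[mu]_x F x.
Proof.
move=> mF FM; pose tau : borel Zinf A -> borel Zinf A := shift v.
have mtau : measurable_fun setT tau by exact: (@measurable_reindex _ _ A (fun g => g + v)).
have iFtau : mu.-integrable (tau @^-1` setT) ((EFin \o F) \o tau).
  rewrite preimage_setT; apply: (@bounded_integrable _ _ _ mu (F \o tau) M).
    exact: measurableT_comp.
  by move=> x; exact: FM.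
have mEF : measurable_fun setT (EFin \o (F : borel Zinf A -> R)) by exact/measurable_EFinP.
have := integral_pushforward mtau mEF iFtau measurableT.
rewrite preimage_setT => e; congr fine; rewrite -[LHS]e.
by apply: eq_measure_integral => E mE _; exact: mu_shift.
Qed.

Lemma incr_entropy_translate v g S :
  incr_entropy mu (v + g) (translate v S) = incr_entropy mu g S.
Proof. exact: (incr_translate (block_entropy_translate mu_shift)). Qed.

Lemma cp_shift g S a x : cp mu (translate g S) g a x = cp mu S 0 a (shift g x).
Proof.
have cylS y : cylinder [set` translate g S] y = shift g @^-1` cylinder [set` S] (shift g y).
  apply/seteqP; split=> z yz k /= kS; rewrite /shift.
    by apply: yz; rewrite /= mem_translate addrK.
  by have := yz (k - g); rewrite /= -mem_translate /shift subrK; exact.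
have prs (E : set (borel Zinf A)) : measurable E -> pr mu (shift g @^-1` E) = pr mu E.
  by move=> mE; rewrite /pr mu_shift.
rewrite /cp cylS prs; last exact: measurable_cylinder.
congr (_ / _); rewrite -[RHS]prs; last exact: measurable_cp.
by congr (pr mu _); apply/seteqP; split=> y [yx] /=; rewrite /shift add0r => ya; split.
Qed.

(** The versions at different sites are chosen independently, so equivariance can only hold almost
    surely. It passes to the limit from [cp], where [cp_shift] is exact; the constant 10 is twice
    the 5 of [site_prob_approx]. *)
Lemma site_prob_shift g a : {ae mu, forall x, q g a x = q 0 a (shift g x)}.
Proof.
pose d1 x := `|q g a x - q 0 a (shift g x)|.
have mtau : measurable_fun setT (shift g : borel Zinf A -> borel Zinf A).
  exact: (@measurable_reindex _ _ A (fun k => k + g)).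
have iq0 : mu.-integrable setT (EFin \o (fun x => q 0 a (shift g x))).
  apply: (@bounded_integrable _ _ _ mu _ 1).
    exact: (measurableT_comp (@measurable_site_prob _ _ mu 0 a) mtau).
  by move=> x; have /andP[? ?] := site_prob01 mu 0 a (shift g x); rewrite ger0_norm.
have id1 : mu.-integrable setT (EFin \o d1).
  by apply: integrable_norm; apply: integrable_sub => //; exact: integrable_site_prob.
have : {ae mu, forall x, d1 x = 0}.
  apply: (@Rintegral_small_ae _ _ _ _ _ 10) => // [x|t t0]; first exact: normr_ge0.
  have [S Sg St] := past 0 (exprn_gt0 2 t0).
  have S0 := past_notin Sg.
  pose T := translate g S.
  have gT : g \notin T by rewrite mem_translate subrr.
  have Tt : incr_entropy mu g T <= h + t ^+ 2.
    by have := incr_entropy_translate g 0 S; rewrite addr0 -/T => ->; exact: ltW.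
  pose F x := `|cp mu S 0 a x - q 0 a x|.
  have iF : mu.-integrable setT (EFin \o F).
    by apply: integrable_norm; apply: integrable_sub; [exact: integrable_cp|exact: integrable_site_prob].
  have mF : measurable_fun setT (F : borel Zinf A -> R).
    by have /integrableP[/measurable_EFinP] := iF.
  have F1 x : `|F x| <= 1.
    rewrite normr_id ler_norml; have /andP[? ?] := cp01 mu S 0 a x.
    by have /andP[? ?] : 0 <= q 0 a x <= 1 := site_prob01 mu 0 a x; apply/andP; split; lra.
  have iFs : mu.-integrable setT (EFin \o (fun x => F (shift g x))).
    apply: (@bounded_integrable _ _ _ mu _ 1) => //; exact: (measurableT_comp mF mtau).
  have icp : mu.-integrable setT (EFin \o (fun x => `|cp mu T g a x - q g a x|)).
    by apply: integrable_norm; apply: integrable_sub; [exact: integrable_cp|exact: integrable_site_prob].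
  apply: (@le_trans _ _ (\int[mu]_x (`|cp mu T g a x - q g a x| + F (shift g x)))).
    apply: le_Rintegral => //; first exact: integrable_add.
    move=> x _; rewrite /d1 /F -cp_shift distrC; apply: le_trans (ler_distD (cp mu T g a x) _ _) _.
    by rewrite addrC lerD// distrC.
  rewrite RintegralD// (Rintegral_shift g mF F1).
  have := site_prob_approx le_h a gT t0 Tt.
  have := site_prob_approx le_h a S0 t0 (ltW St).
  rewrite -/(q _ _); lra.
by apply: ae_mono => x /eqP; rewrite normr_eq0 subr_eq0 => /eqP.
Qed.

Lemma log_support_shift g : \int[mu]_x lnN g x = \int[mu]_x lnN 0 x.
Proof.
have mN0 : measurable_fun setT (lnN 0 : borel Zinf A -> R).
  exact: (measurable_fun_finite_valued (fun s : {set A} => ln #|s|%:R) (@measurable_site_supp 0)).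
rewrite -(@Rintegral_shift g (lnN 0) (\sum_(s : {set A}) `|ln #|s|%:R|)) //; last first.
  by move=> x; rewrite /lnN (bigD1 (site_supp 0 x))//= lerDl sumr_ge0.
apply: eq_ae_Rintegral.
- exact: (integrable_supp g (fun s => ln #|s|%:R)).
- apply: (@bounded_integrable _ _ _ mu _ (\sum_(s : {set A}) `|ln #|s|%:R|)).
    exact: (measurableT_comp mN0 (@measurable_reindex _ _ A (fun k => k + g))).
  by move=> x; rewrite /lnN (bigD1 (site_supp 0 (shift g x)))//= lerDl sumr_ge0.
have /ae_mono : {ae mu, forall x, forall a, q g a x = q 0 a (shift g x)}.
  by apply: ae_forall_countable => [|a]; [exact: countableP|exact: site_prob_shift].
apply=> x qx; rewrite /lnN; congr (ln _%:R); apply: eq_card => a.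
by rewrite !inE qx.
Qed.

End SiteProbabilityLaw.

(** * Uniform products *)

Section UniformLetters.
Variables (R : realType) (A : alphabetType).
Implicit Types (s : nat -> hat A) (w : nat -> A) (u : R).

(* Digits of [u] in the mixed radix system with bases [#|s 0|, #|s 1|, ...], read as letters. *)
Fixpoint letters s u (k : nat) : A :=
  let c := #|val (s 0%N)| in
  let i := Num.truncn (c%:R * u) in
  if k is k'.+1 then letters (fun l => s l.+1) (c%:R * u - i%:R) k'
  else nth point (enum (val (s 0%N))) i.

Let size_gt0 s k : (0 : R) < #|val (s k)|%:R.
Proof. by rewrite ltr0n hat_card_gt0. Qed.

Lemma truncn_digit (c : nat) u : (0 < c)%N -> 0 <= u -> u < 1 ->
  (Num.truncn (c%:R * u) < c)%N /\
  (Num.truncn (c%:R * u))%:R <= c%:R * u < (Num.truncn (c%:R * u))%:R + 1.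
Proof.
move=> c0 u0 u1; have cu0 : 0 <= c%:R * u by rewrite mulr_ge0.
have /andP[t1 t2] := Num.Theory.truncn_itv cu0; split; last by rewrite t1 natr1.
by rewrite -(ltr_nat R) (le_lt_trans t1)// gtr_pMr// ltr0n.
Qed.

Lemma letters_mem s u k : 0 <= u -> u < 1 -> letters s u k \in val (s k).
Proof.
elim: k s u => [|k IH] s u u0 u1 /=; have [ic /andP[iu ui]] := truncn_digit (hat_card_gt0 (s 0%N)) u0 u1.
  by rewrite -mem_enum mem_nth// -cardE.
by apply: (IH (fun l => s l.+1)); lra.
Qed.

(** The first digit [i] confines [u] to [[i / c, (i + 1) / c)], which [u |-> c u - i] maps onto
    [[0, 1)]; there the induction hypothesis handles the remaining digits. *)
Lemma letters_itv s w n : (forall k, (k < n)%N -> w k \in val (s k)) ->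
  exists a, [/\ 0 <= a, a + \prod_(k < n) #|val (s k)|%:R^-1 <= 1 &
    forall u, (0 <= u < 1 /\ (forall k, (k < n)%N -> letters s u k = w k)) <->
      a <= u < a + \prod_(k < n) #|val (s k)|%:R^-1].
Proof.
elim: n s w => [|n IH] s w ws.
  by exists 0; rewrite big_ord0 add0r; split=> // u; split=> [[]|].
have [a [a0 a1 aP]] := IH (fun k => s k.+1) (fun k => w k.+1) (fun k => ws k.+1).
rewrite big_ord_recl /=; set L := \prod_(_ < _) _ in a1 aP *.
pose c := #|val (s 0%N)|; have c0 : 0 < c%:R :> R by exact: size_gt0.
pose i := index (w 0%N) (enum (val (s 0%N))).
have w0 : w 0%N \in enum (val (s 0%N)) by rewrite mem_enum; exact: ws.
have ic : (i < c)%N by rewrite /c cardE index_mem.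
have ic1 : i%:R + 1 <= c%:R :> R by rewrite natr1 ler_nat.
have L0 : 0 <= L by apply: prodr_ge0 => k _; rewrite invr_ge0.
have i0 : 0 <= i%:R :> R by [].
exists ((i%:R + a) / c%:R); split; first by rewrite divr_ge0 ?addr_ge0// ltW.
  by rewrite -/c [c%:R^-1 * L]mulrC -mulrDl ler_pdivrMr// mul1r; lra.
move=> u; rewrite -/c [c%:R^-1 * L]mulrC -mulrDl ler_pdivrMr// ltr_pdivlMr//.
split=> [[/andP[u0 u1] uw]|/andP[au ua]].
  have [tc /andP[t1 t2]] := truncn_digit (hat_card_gt0 (s 0%N)) u0 u1.
  have ti : Num.truncn (c%:R * u) = i.
    have /= := uw 0%N (ltn0Sn n); rewrite -/c /i => <-.
    by rewrite index_uniq ?enum_uniq// -cardE.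
  have /aP /andP[]: 0 <= c%:R * u - i%:R < 1 /\
      forall k, (k < n)%N -> letters (fun l => s l.+1) (c%:R * u - i%:R) k = w k.+1.
    split; first by move: t1 t2; rewrite -/c ti => ? ?; apply/andP; split; lra.
    by move=> k kn; have /= := uw k.+1 kn; rewrite -/c ti.
  by rewrite (mulrC u) => ? ?; apply/andP; split; lra.
have [|/andP[v0 v1] vw] := (aP (c%:R * u - i%:R)).2.
  by move: au ua; rewrite (mulrC u) => ? ?; apply/andP; split; lra.
have ti : Num.truncn (c%:R * u) = i by apply: Num.Theory.truncn_def; rewrite -natr1; apply/andP; split; lra.
split.
  apply/andP; split; first by rewrite -(pmulr_rge0 _ c0); lra.
  by rewrite -(ltr_pM2l c0) mulr1; lra.
case=> [_|k kn] /=; rewrite -/c ti; first by rewrite nth_index.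
exact: vw.
Qed.

Lemma letters_measure s w n :
  measurable ([set u | 0 <= u < 1 /\ forall k, (k < n)%N -> letters s u k = w k] : set (measurableTypeR R)) /\
  lebesgue_measure ([set u | 0 <= u < 1 /\ forall k, (k < n)%N -> letters s u k = w k] : set (measurableTypeR R)) =
  (\prod_(k < n) ((w k \in val (s k))%:R / #|val (s k)|%:R))%:E.
Proof.
have [ws|] := boolP [forall k : 'I_n, w k \in val (s k)]; last first.
  move=> /forallPn[k wk]; rewrite (_ : mkset _ = set0).
    by rewrite measure0 (bigD1 k)//= (negbTE wk) mul0r mul0r.
  apply/seteqP; split=> // u [/andP[u0 u1] uw].
  by move: wk; rewrite -(uw k (ltn_ord k)) letters_mem.
have {}ws k : (k < n)%N -> w k \in val (s k) by move=> kn; exact: (forallP ws (Ordinal kn)).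
have [a [a0 a1 aP]] := letters_itv ws.
set L := \prod_(_ < _) _ in a1 aP.
rewrite (_ : mkset _ = `[a, a + L[%classic); last first.
  by apply/seteqP; split=> u; [move/aP; rewrite /= in_itv|rewrite /= in_itv => /aP].
split; first exact: measurable_itv.
rewrite lebesgue_measure_itv /= lte_fin.
have L0 : 0 < L by apply: prodr_gt0 => k _; rewrite invr_gt0.
rewrite ltrDl L0 -EFinB; congr (_%:E).
rewrite addrC addKr; apply: eq_bigr => k _.
by rewrite ws// mul1r.
Qed.

End UniformLetters.

Section UnitInterval.
Variable R : realType.

Lemma measurable_unit : measurable (`[0, 1[%classic : set (measurableTypeR R)).
Proof. exact: measurable_itv. Qed.

Definition unit_measure := mrestr (@lebesgue_measure R) measurable_unit.

HB.instance Definition _ := Measure.on unit_measure.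

Lemma unit_measureT : unit_measure setT = 1%E.
Proof. by rewrite /unit_measure /mrestr setTI lebesgue_measure_itv /= lte_fin ltr01 oppr0 adde0. Qed.

HB.instance Definition _ := Measure_isProbability.Build _ _ _ unit_measure unit_measureT.

End UnitInterval.

Lemma pushforward_probability d1 d2 (T1 : measurableType d1) (T2 : measurableType d2)
    (R : realType) (P : probability T1 R) (f : T1 -> T2) : measurable_fun setT f ->
  exists m : probability T2 R, forall E, m E = P (f @^-1` E).
Proof.
move=> mf.
pose X : {mfun T1 >-> T2} := HB.pack f (isMeasurableFun.Build _ _ _ _ f mf).
by exists (distribution P X).
Qed.

Section ProductExistence.
Variables (R : realType) (A : alphabetType).

(** The mixed radix digits of a uniform point of [[0, 1)] are independent and uniform, so the
    product measure is a pushforward of Lebesgue measure. Outside the unit interval [f] takes a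
    default value of no weight. *)
Lemma sequence_product (s : nat -> hat A) : exists m : probability (borel nat A) R,
  forall (w : nat -> A) n, m [set x | forall k, (k < n)%N -> x k = w k] =
    (\prod_(k < n) ((w k \in val (s k))%:R / #|val (s k)|%:R))%:E.
Proof.
pose f (u : measurableTypeR R) : borel nat A :=
  fun k => if (0 <= u < 1) then letters s u k else point.
have mletter k a : measurable ([set u | 0 <= u < 1 /\ letters s u k = a] : set (measurableTypeR R)).
  rewrite (_ : mkset _ = \bigcup_(w in [set w : {ffun 'I_k.+1 -> A} | w ord_max = a])
      [set u | 0 <= u < 1 /\ forall l, (l < k.+1)%N -> letters s u l = w (inord l)]).
    apply: fin_bigcup_measurable => [|w _]; first exact: finite_finset.
    by have [mw _] := @letters_measure R A s (fun l => w (inord l)) k.+1.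
  apply/seteqP; split=> [u [u01 ua]|u [w /= wa [u01 uw]]].
    exists [ffun l : 'I_k.+1 => letters s u l] => /=; first by rewrite ffunE.
    by split=> // l lk; rewrite ffunE inordK.
  by split=> //; rewrite uw//; rewrite -wa; congr (w _); apply: val_inj; rewrite /= inordK.
have mf : measurable_fun setT f.
  apply: measurable_to_borel; first exact: countableP.
  move=> k a; rewrite (_ : mkset _ = [set u | 0 <= u < 1 /\ letters s u k = a] `|`
      (~` `[0, 1[%classic `&` [set u | point = a])).
    apply: measurableU; first exact: mletter.
    apply: measurableI; first by apply: measurableC; exact: measurable_unit.
    have [pa|pa] := pselect ((point : A) = a).
      by rewrite (_ : mkset _ = setT)//; apply/seteqP; split.
    by rewrite (_ : mkset _ = set0)//; apply/seteqP; split.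
  apply/seteqP; split=> u /=; rewrite /f in_itv /=.
    by case: ifP => u01 ua; [left|right].
  by case: ifP => u01 [[? ?]|[]].
have [m mE] := pushforward_probability (@unit_measure R) mf.
exists m => w n; have [_ <-] := @letters_measure R A s w n; rewrite mE /unit_measure /= /mrestr; congr (lebesgue_measure _).
apply/seteqP; split=> u /=; rewrite in_itv /= /f.
  by move=> [uw u01]; split=> // k /uw; rewrite u01.
by move=> [u01 uw]; rewrite u01.
Qed.

Lemma sequence_product_event (s : nat -> hat A) (m : probability (borel nat A) R) :
  (forall (w : nat -> A) n, m [set x | forall k, (k < n)%N -> x k = w k] =
    (\prod_(k < n) ((w k \in val (s k))%:R / #|val (s k)|%:R))%:E) ->
  forall (D : nat -> {set A}) n, m [set x | forall k, (k < n)%N -> x k \in D k] =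
    (\prod_(k < n) (#|D k :&: val (s k)|%SET%:R / #|val (s k)|%:R))%:E.
Proof.
move=> mw D n.
pose U (x : borel nat A) := [ffun k : 'I_n => x k].
pose E : set (borel nat A) := [set x | forall k, (k < n)%N -> x k \in D k].
have dE (C : set (nat -> A)) : (forall x y, (forall k, (k < n)%N -> x k = y k) -> C x -> C y) ->
    measurable (C : set (borel nat A)).
  move=> nC; apply: fin_det_measurable; exists (iota 0 n) => x y xy; apply: nC => k kn.
  by apply: xy; rewrite mem_iota.
have mE : measurable E by apply: dE => x y xy xD k kn; rewrite -xy// xD.
have mU v : measurable [set x | U x = v].
  by apply: dE => x y xy /= <-; apply/ffunP => k; rewrite !ffunE xy.
have Uv (v : {ffun 'I_n -> A}) : pr m (E `&` [set x | U x = v]) =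
    \prod_(k < n) ((v k \in D k :&: val (s k))%SET%:R / #|val (s k)|%:R).
  have [vD|/forallPn[k vk]] := boolP [forall k, v k \in D k]; last first.
    rewrite (_ : _ `&` _ = set0) ?pr_set0; last first.
      apply/seteqP; split=> // x [xD /= xv].
      by move: vk; rewrite -xv ffunE xD.
    by rewrite (bigD1 k)//= !inE (negbTE vk) mul0r mul0r.
  pose w (k : nat) : A := if insub k is Some k' then v k' else point.
  have wv (k : 'I_n) : w k = v k by rewrite /w valK.
  rewrite (_ : _ `&` _ = [set x | forall k, (k < n)%N -> x k = w k]).
    rewrite /pr mw /=; apply: eq_bigr => k _; rewrite wv !inE.
    by rewrite (forallP vD k).
  apply/seteqP; split=> [x [xD /= xv] k kn|x xw].
    by have := wv (Ordinal kn); rewrite -xv ffunE /= => ->.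
  have xv : U x = v by apply/ffunP => k; rewrite ffunE xw ?wv.
  by split=> // k kn; have := forallP vD (Ordinal kn); rewrite -xv ffunE.
rewrite prE// (pr_partition m mE mU); congr (_%:E).
under eq_bigr do rewrite Uv.
rewrite -(bigA_distr_bigA (fun (k : 'I_n) a => (a \in D k :&: val (s k))%SET%:R / #|val (s k)|%:R)) /=.
apply: eq_bigr => k _; rewrite -mulr_suml; congr (_ / _).
by rewrite -sum1_card natr_sum [RHS]big_mkcond /=; apply: eq_bigr => a _; case: (a \in _).
Qed.

Lemma uniform_product_exists (xh : Zinf -> hat A) :
  exists m : probability (borel Zinf A) R, is_uniform_product xh m.
Proof.
have /countable_injP[e einj] := countable_Zinf.
have {}einj g k : e g = e k -> g = k by apply: einj; rewrite inE.
(* The alphabets are transported along the enumeration [e]; numbers that it misses receive a dummy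
   singleton. *)
pose s k := if pselect (exists g, e g = k) is left ex then xh (sval (cid ex)) else hat1 point.
have se g : s (e g) = xh g.
  rewrite /s; case: pselect => [ex|[]]; last by exists g.
  by congr xh; apply: einj; exact: svalP (cid ex).
have [m0 m0w] := sequence_product s; have m0D := sequence_product_event m0w.
have [m mE] := pushforward_probability m0 (@measurable_reindex _ _ A e).
exists m => S B; rewrite mE.
pose n := (\max_(g <- S) e g).+1.
have en g : g \in S -> (e g < n)%N by move=> gS; rewrite ltnS (big_rem g) //= leq_maxl.
(* The condition is vacuous when [k] numbers no site of [S]: then [D k] is the whole alphabet and
   its factor is 1. *)
pose D k := [set a | [forall g : S, (e (val g) == k) ==> (a \in B (val g))]]%SET.
have De g : g \in S -> D (e g) = B g.
  move=> gS; apply/setP => a; rewrite inE; apply/forallP/idP => [/(_ [` gS]%fset)|aB k].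
    by rewrite /= eqxx.
  by apply/implyP => /eqP/einj ->.
rewrite (_ : _ @^-1` _ = [set x | forall k, (k < n)%N -> x k \in D k]); last first.
  apply/seteqP; split=> x xB.
    move=> k kn; rewrite inE; apply/forallP => g; apply/implyP => /eqP <-.
    by apply: xB; exact: fsvalP.
  by move=> g gS; rewrite -(De g gS); apply: xB; exact: en.
rewrite m0D; congr (_%:E).
pose F k : R := #|D k :&: val (s k)|%SET%:R / #|val (s k)|%:R.
rewrite -(big_mkord predT F) /index_iota subn0.
rewrite (bigID (fun k => k \in map e S)) /= [X in _ * X]big1 ?mulr1; last first.
  move=> k kS; rewrite /F (_ : D k = finset.setTfor A) ?finset.setTI ?divff//.
    by rewrite pnatr_eq0 -lt0n hat_card_gt0.
  apply/setP => a; rewrite !inE; apply/forallP => g; apply/implyP => /eqP ek.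
  by move: kS; rewrite -ek map_f//; exact: fsvalP.
rewrite -big_filter (perm_big (map e S)).
  by rewrite big_map big_seq [RHS]big_seq; apply: eq_bigr => g gS; rewrite /F De// se.
apply: uniq_perm; first by apply: filter_uniq; exact: (iota_uniq 0 n).
  by rewrite map_inj_uniq ?fset_uniq// => g k; exact: einj.
move=> k; rewrite mem_filter (mem_iota 0 n) add0n andbC; case: (boolP (k \in map e S)) => [|_]; last by rewrite andbF.
by move=> /mapP[g gS ->]; rewrite andbT en.
Qed.

Lemma uniform_productP (xh : Zinf -> hat A) : is_uniform_product xh (uniform_product R xh).
Proof.
rewrite /uniform_product; case: pselect => [ex|[]]; first exact: svalP (cid ex).
exact: uniform_product_exists.
Qed.

End ProductExistence.

(** * The support map *)

Section AxialPower.
Variables (A : alphabetType) (X : set (int -> A)).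
Hypothesis X_subshift : subshift X.

Lemma axial_power_closed :
  closed (axial_power X : set {ptws Zinf -> discrete_topology A}).
Proof.
have [Xclosed _] := X_subshift.
apply/(@closedP Zinf A) => x xY g i; apply: (closedP X).1 Xclosed _ _ => W.
have [y Yy xy] := xY [seq g + gen i *~ m | m <- W].
by exists (fun m => y (g + gen i *~ m)) => // m mW; apply: xy; exact: map_f.
Qed.

Lemma axial_power_shift v x : axial_power X x -> axial_power X (shift v x).
Proof.
move=> Yx g i; have := Yx (g + v) i; congr X; apply/funext => m.
by rewrite /shift addrAC.
Qed.

(** A choice from a limit agrees on any finite set with a choice from a nearby member, the rest
    being picked arbitrarily; closedness of [Y] concludes. *)
Lemma multichoice_closed (Y : set (Zinf -> A)) :
  closed (Y : set {ptws Zinf -> discrete_topology A}) ->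
  closed (multichoice Y : set {ptws Zinf -> discrete_topology (hat A)}).
Proof.
move=> Yclosed; apply/(@closedP Zinf (hat A)) => xh xhY z zxh.
apply: (closedP Y).1 Yclosed _ _ => S; have [yh Yyh xyh] := xhY S.
exists (fun g => if g \in S then z g else hpick (yh g)) => [|g gS]; last by rewrite gS.
by apply: Yyh => g; case: ifP => [/xyh <-|_]; [exact: zxh|exact: hpickP].
Qed.

Lemma multichoice_singletons : axial_power X !=set0 -> exists xh, multichoice X xh.
Proof.
move=> [y Yy]; exists (fun m => hat1 (y (0 + gen 0 *~ m))) => z zy.
rewrite (_ : z = fun m => y (0 + gen 0 *~ m)); first exact: Yy.
by apply/funext => m; have := zy m; rewrite inE => /eqP.
Qed.

End AxialPower.

(** * Upper limits from convergence in mean *)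

Section LimitTools.
Variable R : realType.

Lemma limn_sup_eq (u : nat -> R) (l : R) :
  (forall e, 0 < e -> \forall n \near \oo, u n <= l + e) ->
  (forall e, 0 < e -> forall N, exists2 n, (N <= n)%N & l - e < u n) ->
  limn_sup u = l.
Proof.
move=> ule ugt; apply: cvg_lim => //; apply/cvgrPdist_le => e e0.
have [N _ uN] := ule e e0.
exists N => // n /= Nn; rewrite /sups /=.
have ub : ubound (sdrop u n) (l + e).
  by move=> _ [k /= nk <-]; apply: uN; exact: leq_trans Nn nk.
have sup_le : sup (sdrop u n) <= l + e by apply: ge_sup => //; exists (u n), n => //=.
have [k nk uk] := ugt e e0 n.
have le_sup : u k <= sup (sdrop u n) by apply: ub_le_sup; [exists (l + e)|exists k].
by rewrite ler_norml; apply/andP; split; lra.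
Qed.

(** Convergence in mean yields almost surely a lower limit 0, not pointwise convergence; this
    suffices for an upper limit of scores. On the event that [f n >= c] for all [n >= N], the
    integrals stay above [c] times its mass. *)
Lemma mean_small_often d (T : measurableType d) (mu : probability T R) (f : nat -> T -> R) :
  (forall n, mu.-integrable setT (EFin \o f n)) -> (forall n t, 0 <= f n t) ->
  (fun n => \int[mu]_t f n t) @ \oo --> 0 ->
  {ae mu, forall t, forall e, 0 < e -> forall N, exists2 n, (N <= n)%N & f n t < e}.
Proof.
move=> intf f0 If.
have mf n : measurable_fun setT (f n) by have /integrableP[/measurable_EFinP] := intf n.
have aeNk N k : {ae mu, forall t, exists2 n, (N <= n)%N & f n t < k.+1%:R^-1}.
  pose c : R := k.+1%:R^-1; have c0 : 0 < c by rewrite invr_gt0.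
  pose E := \bigcap_(n in [set n | (N <= n)%N]) [set t | c <= f n t].
  have mE : measurable E.
    apply: bigcap_measurable; first by exists N => /=.
    move=> n _; rewrite -[mkset _]setTI; apply: measurable_fun_ler => //.
  have E0 : mu E = 0%E.
    rewrite prE//; congr (_%:E); apply/eqP; rewrite eq_le pr_ge0 andbT.
    rewrite -(pmulr_rle0 _ c0); apply: (cvgr_to_ge If); near=> n.
    have Nn : (N <= n)%N by near: n; exact: nbhs_infty_ge.
    rewrite -Rintegral_indic// -RintegralZl//; last exact: integrable_indic.
    apply: le_Rintegral => //.
      rewrite (_ : EFin \o _ = fun t => (c%:E * (\1_E t)%:E)%E)//.
      by apply: integrableZl => //; exact: integrable_indic.
    move=> t _; rewrite indicE; case: (boolP (t \in E)) => [/set_mem Et|_]; rewrite ?mulr1 ?mulr0//.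
    exact: Et.
  have : mu.-negligible E by apply/negligibleP.
  apply: negligibleS => t /= nt n /= Nn; rewrite leNgt; apply/negP => ftn.
  by apply: nt; exists n.
have : {ae mu, forall t, forall N k, exists2 n, (N <= n)%N & f n t < k.+1%:R^-1}.
  by apply: ae_foralln => N; apply: ae_foralln => k; exact: aeNk.
apply: ae_mono => t ft e e0 N.
have [k ke] : exists k : nat, k.+1%:R^-1 < e.
  have /cvgrPdist_lt/(_ e e0)[k _ /(_ k (leqnn k))] := @cvg_harmonic R.
  by rewrite /= sub0r normrN ger0_norm ?invr_ge0// => ke; exists k.
by have [n Nn fn] := ft N k; exists n => //; exact: lt_trans ke.
Unshelve. all: by end_near.
Qed.

End LimitTools.

Section PhiMap.
Variables (R : realType) (A : alphabetType) (mu : probability (borel Zinf A) R).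

Lemma phiE g x : phi mu x g = insubd (hat1 (x g)) (site_supp mu g x).
Proof.
rewrite /phi (_ : [set a | (0 < cond_prob mu g a x)%E]%SET = site_supp mu g x)//.
by apply/setP => a; rewrite !inE PcE lte_fin clip01_gt0.
Qed.

Lemma phi_val g x : site_supp mu g x != finset.set0 -> val (phi mu x g) = site_supp mu g x.
Proof. by move=> s0; rewrite phiE val_insubd s0. Qed.

Lemma measurable_phi : measurable_fun setT (phi mu).
Proof.
apply: measurable_to_borel; first exact: countable_Zinf.
move=> g s; pose V (x : borel Zinf A) := (site_supp mu g x, x g).
have mV w : measurable [set x | V x = w].
  rewrite (_ : mkset _ = [set x | site_supp mu g x = w.1] `&` [set x | x g = w.2]).
    by apply: measurableI; [exact: measurable_site_supp|exact: (@measurable_coord Zinf A)].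
  by apply/seteqP; split=> [x /= <-//|x []]; case: w => u i /= <- <-.
have := measurable_finite_valued [set w | insubd (hat1 w.2) w.1 = s] mV.
by congr measurable; apply/seteqP; split=> x /=; rewrite phiE.
Qed.

Lemma measurable_multichoice_max (X : set (int -> A)) : subshift X ->
  measurable (multichoice_max R X : set (borel Zinf (hat A))).
Proof.
move=> sX; rewrite (_ : multichoice_max R X = multichoice (axial_power X) `&`
    [set xh | limsup_score R xh = h_ind R X]); last by apply/seteqP; split.
apply: measurableI; first by apply: closed_measurable; apply: multichoice_closed; exact: axial_power_closed.
have ms n : measurable_fun setT ((fun xh => score R (restr (folner n) xh)) : borel Zinf (hat A) -> R).
  have := @measurable_det_fun R (hat A) (folner n) (fun xh => score R (restr (folner n) xh)).
  apply=> x y xy; congr (score R _); apply/ffunP => g; rewrite !ffunE xy//; exact: fsvalP.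
have : measurable_fun setT (@limsup_score R A : borel Zinf (hat A) -> R).
  apply: measurable_fun_limn_sup => //.
  - move=> xh _; exists (ln #|A|%:R) => _ [n _ <-]; apply: score_restr_le.
      by rewrite folnerE card_box expn_gt0.
    exact: sum_lnc_le.
  - move=> xh _; exists 0 => _ [n _ <-]; rewrite score_restr mulr_ge0 ?invr_ge0// sumr_ge0// => g _.
    exact: lnc_ge0.
move=> /(_ measurableT [set h_ind R X] (measurable_set1 _)); rewrite setTI.
exact.
Qed.

End PhiMap.

(** * Supports as multi-choice configurations, and the mixture formula *)

Section UniformProductMixture.
Variables (R : realType) (A : alphabetType) (mu : probability (borel Zinf A) R).
Variable h : R.
Hypothesis le_h : forall g S, g \notin S -> h <= incr_entropy mu g S.
Hypothesis past : forall g (e : R), 0 < e -> exists2 S : {fset Zinf},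
  (forall s, s \in S -> lexlt s g) & incr_entropy mu g S < h + e.

Lemma site_supp_neq0 : {ae mu, forall x, forall g, site_supp mu g x != finset.set0}.
Proof.
apply: ae_forall_countable; first exact: countable_Zinf.
move=> g; apply: ae_mono (site_prob_sum1 le_h past g) => x p1.
apply/eqP => s0; have : \sum_a site_prob mu g a x = 0.
  apply: big1 => a _; apply/eqP; rewrite eq_le; have /andP[-> _] := site_prob01 mu g a x.
  rewrite andbT leNgt; apply/negP => qa.
  by have := finset.in_set0 a; rewrite -s0 inE qa.
by rewrite p1 => /eqP; rewrite oner_eq0.
Qed.

(** By the cylinder formula a null pattern almost surely has a vanishing product of site
    probabilities, and there are countably many patterns on the sets [S n]. A choice from [phi mu x]
    has positive products, so all its patterns have positive mass and occur in [Y]; closedness puts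
    the choice in [Y]. *)
Lemma phi_multichoice (Y : set (Zinf -> A)) :
  closed (Y : set {ptws Zinf -> discrete_topology A}) -> mu Y = 1%E ->
  {ae mu, forall x, multichoice Y (phi mu x)}.
Proof.
move=> Yclosed Y1; have [S cofS] := cofinal_family countable_Zinf.
have mY : measurable (Y : set (borel Zinf A)) := closed_measurable Yclosed.
have aeS : {ae mu, forall x, forall n (w : {ffun S n -> A}),
    pr mu (cylinder [set` S n] (ffun_ext w)) = 0 ->
    \prod_(g <- S n) site_prob mu g (ffun_ext w g) x = 0}.
  apply: ae_foralln => n; apply: ae_forall_countable => [|w]; first exact: countableP.
  have [z|nz] := eqVneq (pr mu (cylinder [set` S n] (ffun_ext w))) 0; last first.
    by apply: aeW => x z; rewrite z eqxx in nz.
  have p01 x := prod01 (S n) (fun g => site_prob01 mu g (ffun_ext w g) x).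
  have ip : mu.-integrable setT (EFin \o fun x => \prod_(g <- S n) site_prob mu g (ffun_ext w g) x).
    apply: (@bounded_integrable _ _ _ mu _ 1).
      by apply: measurable_prod => g _; exact: measurable_site_prob.
    by move=> x; have /andP[? ?] := p01 x; rewrite ger0_norm.
  have := @Rintegral_le0_ae _ _ _ mu _ ip.
  rewrite -(cylinder_site_prob le_h past) z lexx => ae0.
  apply: ae_mono (ae0 _ isT) => [x|x]; last by have /andP[] := p01 x.
  by move=> ->.
apply: ae_mono2 aeS site_supp_neq0 => x xS xs y yx.
apply: (closedP Y).1 Yclosed _ _ => T; have [n Tn] := cofS T.
have prod0 : 0 < \prod_(g <- S n) site_prob mu g (y g) x.
  apply: prodr_gt0 => g _; have := yx g; rewrite phi_val ?xs//.
  by rewrite inE.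
pose w : {ffun S n -> A} := restr (S n) y.
have wy g : g \in S n -> ffun_ext w g = y g by exact: ffun_ext_restr.
have cyl0 : pr mu (cylinder [set` S n] (ffun_ext w)) <> 0.
  move=> z; have := xS n w z; rewrite big_seq.
  under eq_bigr => g gS do rewrite wy//.
  by rewrite -big_seq => p0; rewrite p0 ltxx in prod0.
apply: contrapT => nY; apply: cyl0; apply/eqP; rewrite eq_le pr_ge0 andbT.
have nY0 : pr mu (~` Y) = 0 by rewrite /pr probability_setC// Y1 subee.
rewrite -nY0; apply: le_pr; [exact: measurable_cylinder|exact: measurableC|].
move=> z xz Yz; apply: nY; exists z => // g /Tn gS.
by rewrite (xz g gS) wy.
Qed.

Lemma hat_weight01 (a : A) (s : hat A) :
  0 <= ((a \in val s)%:R / #|val s|%:R : R) <= 1.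
Proof.
rewrite divr_ge0//= ler_pdivrMr ?ltr0n ?hat_card_gt0// mul1r ler_nat.
by apply: leq_trans (hat_card_gt0 s); case: (_ \in _).
Qed.

Hypothesis uniform : forall g, {ae mu, forall x, forall a, site_prob mu g a x =
  (if 0 < site_prob mu g a x then #|site_supp mu g x|%:R^-1 else 0)}.

Lemma cylinder_phi (T : {fset Zinf}) (w : Zinf -> A) :
  pr mu (cylinder [set` T] w) =
  \int[mu]_x \prod_(g <- T) ((w g \in val (phi mu x g))%:R / #|val (phi mu x g)|%:R).
Proof.
rewrite (cylinder_site_prob le_h past); apply: eq_ae_Rintegral.
- apply: (@bounded_integrable _ _ _ mu _ 1).
    by apply: measurable_prod => g _; exact: measurable_site_prob.
  by move=> x; have /andP[? ?] := prod01 T (fun g => site_prob01 mu g (w g) x); rewrite ger0_norm.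
- apply: (@bounded_integrable _ _ _ mu _ 1).
    apply: measurable_prod => g _.
    have mg s : measurable [set x | phi mu x g = s].
      have := @measurable_phi R A mu measurableT _ (@measurable_coord Zinf (hat A) g s).
      by rewrite setTI.
    exact: (measurable_fun_finite_valued (fun s : hat A => (w g \in val s)%:R / #|val s|%:R : R) mg).
  move=> x; have /andP[? ?] := prod01 T (fun g => hat_weight01 (w g) (phi mu x g)).
  by rewrite ger0_norm.
have aeu : {ae mu, forall x, forall g a, site_prob mu g a x =
    (if 0 < site_prob mu g a x then #|site_supp mu g x|%:R^-1 else 0)}.
  by apply: ae_forall_countable; [exact: countable_Zinf|exact: uniform].
apply: ae_mono2 aeu site_supp_neq0 => x xu xs; apply: eq_bigr => g _.
by rewrite xu phi_val ?xs// inE; case: ifP => _; rewrite ?mul1r ?mul0r.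
Qed.

(** Measurability of the kernel goes through the same induction as the identity: [uniform_product]
    is obtained by choice, and only its values on finitely determined sets are explicit. *)
Lemma mu_eq_mixture (E : set (borel Zinf A)) : measurable E ->
  measurable_fun setT (fun xh : borel Zinf (hat A) => uniform_product R xh E) /\
  mu E = (\int[mu]_x uniform_product R (phi mu x) E)%E.
Proof.
move: E; apply: (borel_dynkin_ind countable_Zinf).
- move=> C [S0 SC]; pose T := [fset g in S0]%fset.
  have TC : det_by T C by move=> x y xy; apply: SC => g gS; apply: xy; rewrite inE.
  have mC : measurable (C : set (borel Zinf A)) by apply: fin_det_measurable; exists S0.
  (* Any finitely determined set is a finite disjoint union of cylinders, selected by the 0-1
     coefficients [c]. *)
  pose c (w : {ffun T -> A}) : R := (w \in restr T @` C)%:R.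
  have mE (m : probability (borel Zinf A) R) :
      m C = (\sum_w c w * pr m (cylinder [set` T] (ffun_ext w)))%:E.
    rewrite prE// (pr_partition m mC (@measurable_restr A T)); congr (_%:E); apply: eq_bigr => w _.
    have wE : cylinder [set` T] (ffun_ext w) = [set x | restr T x = w].
      by rewrite cylinderE restr_ffun_ext.
    rewrite wE /c; have [/set_mem[y Cy yw]|wC] := boolP (w \in _).
      rewrite mul1r; congr (pr m _); apply/seteqP; split=> [x []//|x /= xw]; split=> //.
      by apply: TC Cy => g gT; have /restrP := etrans xw (esym yw) => ->.
    rewrite mul0r (_ : _ `&` _ = set0) ?pr_set0//; apply/seteqP; split=> // x [Cx /= xw].
    by move/negP: wC; apply; apply/mem_set; exists x.
  have uE xh w : pr (uniform_product R xh) (cylinder [set` T] w) =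
      \prod_(g <- T) ((w g \in val (xh g))%:R / #|val (xh g)|%:R).
    have := uniform_productP R xh T (fun g => [set w g]%SET); rewrite /pr.
    rewrite (_ : mkset _ = cylinder [set` T] w); last first.
      by apply/seteqP; split=> x xw g gT; have := xw g gT; rewrite ?inE => /eqP.
    move=> -> /=; apply: eq_bigr => g _; congr (_%:R / _).
    have [wx|wx] := boolP (w g \in val (xh g)).
      by rewrite (finset.setIidPl _) ?cards1// finset.sub1set.
    by apply/eqP; rewrite cards_eq0; apply/eqP/setP => a; rewrite !inE; case: eqP => //= ->; apply/negbTE.
  have m1 w : measurable_fun setT
      (fun xh : borel Zinf (hat A) => c w * \prod_(g <- T) ((ffun_ext w g \in val (xh g))%:R / #|val (xh g)|%:R)).
    apply: measurable_funM; first exact: measurable_cst.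
    apply: measurable_prod => g _.
    exact: (measurable_fun_finite_valued (fun s : hat A => (ffun_ext w g \in val s)%:R / #|val s|%:R : R)
      (@measurable_coord Zinf (hat A) g)).
  pose G (xh : borel Zinf (hat A)) := \sum_w c w * \prod_(g <- T) ((ffun_ext w g \in val (xh g))%:R / #|val (xh g)|%:R).
  have GE xh : uniform_product R xh C = (G xh)%:E.
    by rewrite mE; congr (_%:E); apply: eq_bigr => w _; rewrite uE.
  split.
    rewrite (_ : (fun xh => _) = EFin \o G); last by apply/funext => xh; rewrite GE.
    by apply/measurable_EFinP; apply: measurable_sum => w; exact: m1.
  under eq_integral do rewrite GE.
  have i1 w : mu.-integrable setT (EFin \o fun x =>
      c w * \prod_(g <- T) ((ffun_ext w g \in val (phi mu x g))%:R / #|val (phi mu x g)|%:R)).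
    apply: (@bounded_integrable _ _ _ mu _ 1).
      exact: (measurableT_comp (m1 w) (@measurable_phi R A mu)).
    move=> x; have /andP[? ?] := prod01 T (fun g => hat_weight01 (ffun_ext w g) (phi mu x g)).
    rewrite ger0_norm ?mulr_ge0 ?ler0n// /c.
    by case: (_ \in _); rewrite ?mul1r ?mul0r.
  have iG : mu.-integrable setT (EFin \o (G \o phi mu)).
    rewrite (_ : EFin \o _ = fun x => (\sum_w (c w * \prod_(g <- T) ((ffun_ext w g \in val (phi mu x g))%:R / #|val (phi mu x g)|%:R))%:E)%E).
      by apply: integrable_sum => // w _; exact: i1.
    by apply/funext => x /=; rewrite sumEFin.
  rewrite -[RHS]fineK; last exact: (integrable_fin_num measurableT iG).
  rewrite mE; congr (_%:E); rewrite -/(Rintegral _ _ _).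
  transitivity (\int[mu]_x G (phi mu x)) => //.
  rewrite /G Rintegral_sum//; apply: eq_bigr => w _.
  rewrite cylinder_phi; have [wC|wC] := boolP (w \in restr T @` C); rewrite /c.
    by rewrite wC mul1r; apply: eq_Rintegral => x _; rewrite mul1r.
  rewrite (negbTE wC) mul0r; have := @Rintegral_cst _ _ _ mu setT measurableT 0.
  rewrite mul0r => I0; rewrite -[LHS]I0.
  by apply: eq_Rintegral => x _; rewrite mul0r.
- move=> C mC [mUC muC]; split.
    rewrite (_ : (fun xh => _) = fun xh : borel Zinf (hat A) => (1 - uniform_product R xh C)%E).
      by apply: emeasurable_funB.
    by apply/funext => xh; rewrite probability_setC.
  under eq_integral do rewrite probability_setC//.
  have mUphi := measurableT_comp mUC (@measurable_phi R A mu).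
  have i1 : mu.-integrable setT (cst 1%E) by exact: finite_measure_integrable_cst.
  have iU : mu.-integrable setT (fun x => uniform_product R (phi mu x) C).
    apply: (le_integrable measurableT mUphi _ i1) => x _.
    by rewrite gee0_abs//= normr1 probability_le1.
  by rewrite integralB// integral_cst// [X in (1 * X)%E]probability_setT mul1e -muC probability_setC.
- move=> F mF tF IH.
  have mU : measurable (\bigcup_n F n : set (borel Zinf A)) by exact: bigcupT_measurable.
  have UE xh : uniform_product R xh (\bigcup_n F n) = (\sum_(n <oo) uniform_product R xh (F n))%E.
    exact: measure_semi_bigcup.
  split.
    rewrite (_ : (fun xh => _) = fun xh : borel Zinf (hat A) => (\sum_(n <oo) uniform_product R xh (F n))%E).
      apply: ge0_emeasurable_sum => // k _; exact: (IH k).1.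
    by apply/funext => xh; rewrite UE.
  under eq_integral do rewrite UE.
  rewrite integral_nneseries//; last first.
    by move=> n; exact: (measurableT_comp (IH n).1 (@measurable_phi R A mu)).
  rewrite measure_semi_bigcup//; apply: eq_eseriesr => n _; exact: (IH n).2.
Qed.

Lemma Phi_pushforward (E : set (borel Zinf A)) : measurable E ->
  mu E = Phi (pushforward mu (phi mu)) E.
Proof.
move=> mE; have [mU ->] := mu_eq_mixture mE.
rewrite /Phi (ge0_integral_pushforward (@measurable_phi R A mu)) ?preimage_setT//.
Qed.

End UniformProductMixture.

(** * Measures of maximal entropy *)

Section MaximalEntropy.
Variables (R : realType) (A : alphabetType) (mu : probability (borel Zinf A) R).
Variable X : set (int -> A).
Hypothesis X_subshift : subshift X.
Hypothesis mu_max : max_entropy_measure mu (axial_power X).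
Hypothesis mu_perm : perm_invariant mu.

Let Y := axial_power X.

Let muY : mu Y = 1%E. Proof. by case: mu_max. Qed.

Let mu_shift : shift_invariant mu. Proof. by case: mu_max. Qed.

Let Y0 : Y !=set0.
Proof.
apply/set0P/eqP => Ye; have := muY; rewrite Ye measure0 => /eqP.
by rewrite eq_sym onee_eq0.
Qed.

Let X_choice := multichoice_singletons Y0.

Let L : R := \int[mu]_x ln #|site_supp mu 0 x|%:R.

(** Maximality equates two [limn]; since both sequences converge, it identifies the entropy rate
    with the growth rate of the language, which dominates [h_ind]. *)
Lemma max_entropy_rate : exists h : R, [/\ h_ind R X <= h,
  forall g S, g \notin S -> h <= incr_entropy mu g S &
  forall g (e : R), 0 < e -> exists2 S : {fset Zinf},
    (forall s, s \in S -> lexlt s g) & incr_entropy mu g S < h + e].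
Proof.
have [h [cvh le_h past]] := entropy_rate mu_shift mu_perm; exists h; split=> //.
have [h' cvh'] := @language_growth R A Y Y0 (@axial_power_shift A X).
have <- : h' = h.
  have [_ _] := mu_max; rewrite /measure_entropy /top_entropy => e.
  by rewrite -(cvg_lim (@Rhausdorff R) cvh) -(cvg_lim (@Rhausdorff R) cvh').
apply: (cvgr_to_ge cvh'); apply: nearW => n; exact: h_ind_le_language.
Qed.

Section Rate.
Variable h : R.
Hypothesis h_ind_le : h_ind R X <= h.
Hypothesis le_h : forall g S, g \notin S -> h <= incr_entropy mu g S.
Hypothesis past : forall g (e : R), 0 < e -> exists2 S : {fset Zinf},
  (forall s, s \in S -> lexlt s g) & incr_entropy mu g S < h + e.

Let sc n (x : borel Zinf A) : R := score R (restr (folner n.+1) (phi mu x)).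

(** Agrees almost surely with [sc]. Stated with supports instead of [phi], it avoids the default of
    [insubd] and has a mean computable site by site. *)
Let mean n (x : borel Zinf A) : R := #|` folner n.+1|%:R^-1 * \sum_(g <- folner n.+1) ln #|site_supp mu g x|%:R.

Let folner_gt0 n : (0 < #|` folner n|)%N.
Proof. by rewrite folnerE card_box expn_gt0. Qed.

Let ae_mean : {ae mu, forall x, forall n, sc n x = mean n x /\ sc n x <= window_score R X n.+1}.
Proof.
have := phi_multichoice le_h past (axial_power_closed X_subshift) muY.
apply: ae_mono2 (site_supp_neq0 le_h past) => x xs xY n; split; last exact: folner_score_le.
rewrite /sc score_restr; congr (_ * _); apply: eq_bigr => g _.
by rewrite /lnc phi_val.
Qed.

Let integrable_mean n : mu.-integrable setT (EFin \o mean n).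
Proof.
have mm : measurable_fun setT (mean n).
  apply: measurable_funM; first exact: measurable_cst.
  apply: measurable_sum => g.
  exact: (measurable_fun_finite_valued (fun s : {set A} => ln #|s|%:R) (@measurable_site_supp _ _ mu g)).
apply: (@bounded_integrable _ _ _ mu _ (#|` folner n.+1|%:R^-1 * \sum_(g <- folner n.+1) ln #|A|%:R)) => // x.
have le_lnA (s : {set A}) : 0 <= (ln #|s|%:R : R) <= ln #|A|%:R.
  case: (posnP #|s|) => [->|s0]; first by rewrite ln0// lexx ln_ge0// ler1n; apply/card_gt0P; exists point.
  by rewrite ln_ge0 ?ler1n// ler_ln ?posrE ?ltr0n ?ler_nat ?max_card// (leq_trans s0 (max_card _)).
rewrite ger0_norm; last by rewrite mulr_ge0 ?invr_ge0// sumr_ge0// => g _; case/andP: (le_lnA (site_supp mu g x)).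
rewrite ler_wpM2l ?invr_ge0//; apply: ler_sum => g _.
by case/andP: (le_lnA (site_supp mu g x)).
Qed.

Let integral_mean n : \int[mu]_x mean n x = L.
Proof.
have isupp g : mu.-integrable setT (EFin \o (fun x => ln #|site_supp mu g x|%:R)).
  exact: (integrable_supp mu g (fun s => ln #|s|%:R)).
have isum : mu.-integrable setT (EFin \o (fun x => \sum_(g <- folner n.+1) ln #|site_supp mu g x|%:R)).
  rewrite (_ : EFin \o _ = fun x => (\sum_(g <- folner n.+1) (ln #|site_supp mu g x|%:R)%:E)%E).
    by apply: integrable_sum => // g _; exact: isupp.
  by apply/funext => x /=; rewrite sumEFin.
rewrite /mean RintegralZl// Rintegral_sum//.
under eq_bigr => g _ do rewrite (log_support_shift le_h past mu_shift) -/L.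
by rewrite sum_const_seq mulKf// pnatr_eq0 -lt0n.
Qed.

Let integrable_gap n : mu.-integrable setT (EFin \o (fun x => window_score R X n.+1 - mean n x)).
Proof.
apply: (@integrable_sub _ _ _ mu (cst _) (mean n)); last exact: integrable_mean.
exact: finite_measure_integrable_cst.
Qed.

Let integral_gap n : \int[mu]_x (window_score R X n.+1 - mean n x) = window_score R X n.+1 - L.
Proof.
rewrite RintegralB//; last exact: finite_measure_integrable_cst.
have := @Rintegral_cst _ _ _ mu setT measurableT (window_score R X n.+1).
by rewrite -/(pr mu setT) pr_setT mulr1 => ->; rewrite integral_mean.
Qed.

Let ae_gap n : {ae mu, forall x, 0 <= window_score R X n.+1 - mean n x}.
Proof. by apply: ae_mono ae_mean => x /(_ n)[<-]; rewrite subr_ge0. Qed.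

Let cvg_scores : (fun n => window_score R X n.+1) @ \oo --> h_ind R X.
Proof.
by have := @cvg_window_score R A X X_subshift X_choice; rewrite -cvg_shiftS.
Qed.

(** Every [mean n] has mean [L] and is almost surely at most the window score, whose limit is
    [h_ind]; conversely [h_ind <= h <= L]. *)
Lemma log_support_rate : L = h_ind R X.
Proof.
apply/eqP; rewrite eq_le; apply/andP; split.
  apply: (cvgr_to_ge cvg_scores); apply: nearW => n.
  by rewrite -subr_ge0 -integral_gap; exact: Rintegral_ae_ge0.
exact: le_trans h_ind_le (le_log_support le_h past 0).
Qed.

Lemma log_support_le g : \int[mu]_x ln #|site_supp mu g x|%:R <= h.
Proof.
by rewrite (log_support_shift le_h past mu_shift) -/L log_support_rate.
Qed.

(** Window scores cap every score from above in the limit. The gaps below these caps are almost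
    surely nonnegative with means tending to 0, so almost surely they are small infinitely often. *)
Lemma limsup_score_phi : {ae mu, forall x, limsup_score R (phi mu x) = h_ind R X}.
Proof.
have gap0 : (fun n => \int[mu]_x `|window_score R X n.+1 - mean n x|) @ \oo --> (0 : R).
  rewrite (_ : (fun n => _) = fun n => window_score R X n.+1 - L).
    by rewrite -(subrr L) {2}log_support_rate; apply: cvgB => //; exact: cvg_cst.
  apply/funext => n; rewrite -integral_gap; apply: eq_ae_Rintegral => //.
    exact: integrable_norm.
  by apply: ae_mono (ae_gap n) => x gx; rewrite ger0_norm.
have often := mean_small_often (fun n => integrable_norm (integrable_gap n))
  (fun n x => normr_ge0 _) gap0.
apply: ae_mono2 ae_mean often => x xm xo; apply: limn_sup_eq => e e0.
  have /cvgrPdist_le/(_ e e0)[N _ wN] := @cvg_window_score R A X X_subshift X_choice.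
  exists N.+1 => // -[//|n] /= Nn; apply: le_trans (xm n).2 _.
  by have := wN n.+1 (ltnW Nn); rewrite /= ler_distlC => /andP[].
move=> N; have e2 : 0 < e / 2 by rewrite divr_gt0.
have /cvgrPdist_le/(_ _ e2)[M _ wM] := cvg_scores.
have [n Nn fn] := xo _ e2 (maxn N M); exists n.+1.
  by apply: leqW; exact: leq_trans (leq_maxl _ _) Nn.
have := wM n (leq_trans (leq_maxr _ _) Nn); rewrite /= ler_distlC => /andP[wn _].
have [e' _] := xm n; rewrite -/(sc n x) e'.
move: fn; rewrite ltr_distlC => /andP[+ _]; move: wn.
by move: (window_score R X n.+1) (mean n x) => w m; lra.
Qed.

End Rate.
End MaximalEntropy.

Theorem theorem4p1 (R : realType) (Sigma : alphabetType) (X : set (int -> Sigma))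
    (mu : probability (borel Zinf Sigma) R) :
  subshift X ->
  max_entropy_measure mu (axial_power X) ->
  perm_invariant mu ->
  let mu_hat : set (borel Zinf (hat Sigma)) -> \bar R :=
    pushforward mu (phi mu) in
  mu_hat (multichoice_max R X) = 1%E /\
  (forall E : set (borel Zinf Sigma), measurable E -> mu E = Phi mu_hat E).
Proof.
move=> sX mu_max mu_perm; have [muY _ _] := mu_max.
have [h [h_ind_le le_h past]] := max_entropy_rate sX mu_max mu_perm.
have Ylim := limsup_score_phi sX mu_max h_ind_le le_h past.
have Yphi := phi_multichoice le_h past (axial_power_closed sX) muY.
split; last first.
  apply: (Phi_pushforward le_h past) => g; apply: (site_prob_uniform le_h past).
  exact: (log_support_le sX mu_max h_ind_le le_h past).
have mM := measurable_phi mu measurableT (measurable_multichoice_max R sX).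
rewrite setTI in mM.
have [B [mB B0 MB]] : {ae mu, forall x, multichoice_max R X (phi mu x)}.
  by apply: ae_mono2 Yphi Ylim => x; split.
rewrite /= /pushforward -[_ @^-1` _]setCK probability_setC; last exact: measurableC.
by rewrite (subset_measure0 (measurableC mM) mB MB B0) sube0.
Qed.
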